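(* Let $n\ge 2$ be an integer. For every transcendental real number $\xi$ we have \[ \omega_n^*(\xi)\ \ge\ a\,n,\qquad\text{where } a=\frac{1}{2-\log 2}=0.765\cdots. \]
   Context: For an algebraic number $\alpha$, $H(\alpha)$ denotes its naive height: the largest absolute value of the coefficients of its minimal polynomial over $\mathbb{Z}$ (irreducible, primitive, positive leading coefficient). For a real number $\xi$ and integer $n\ge1$, $\omega_n^*(\xi)$ is the supremum of the real numbers $\omega^*>0$ for which there are infinitely many algebraic numbers $\alpha$ of degree at most $n$ with $0<|\xi-\alpha|\le H(\alpha)^{-\omega^*-1}$. *)

(* Defs.v *)
From HB Require Import structures.
From mathcomp Require Import all_boot all_order all_algebra.
From mathcomp Require Import all_classical all_reals all_analysis.
From mathcomp Require Import complex.

Set Implicit Arguments.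
Unset Strict Implicit.
Unset Printing Implicit Defensive.

Import Order.TTheory GRing.Theory Num.Theory.

Local Open Scope classical_set_scope.
Local Open Scope ring_scope.

Definition algebraic (K : numFieldType) (x : K) : Prop :=
  algebraicOver (@ratr K) x.

Definition transcendental (K : numFieldType) (x : K) : Prop :=
  ~ algebraic x.

(* [irreducible_poly] over [int] ignores constant factors (divisibility is    *)
(* pseudo-divisibility), so irreducibility in Z[X] is its conjunction with    *)
(* primitivity, [zcontents p = 1].                                            *)
Definition is_minpolyZ (K : numFieldType) (x : K) (p : {poly int}) : Prop :=
  [/\ root (map_poly intr p) x, irreducible_poly p, zcontents p = 1
    & 0 < lead_coef p].

(* The minimal polynomial of x over Z; 0 when x is not algebraic.             *)
Definition minpolyZ (K : numFieldType) (x : K) : {poly int} :=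
  xget 0 [set p | is_minpolyZ x p].

Definition alg_degree (K : numFieldType) (x : K) : nat := (size (minpolyZ x)).-1.

Definition naive_height (K : numFieldType) (x : K) : nat :=
  (\max_(i < size (minpolyZ x)) `|((minpolyZ x)`_i)%R|)%N.

(* The algebraic numbers range over the complex numbers R[i], in which real   *)
(* bounds on the modulus are expressed through the embedding [%:C].           *)
Definition good_approx (R : realType) (n : nat) (xi w : R) : set R[i] :=
  [set alpha : R[i] | [/\ algebraic alpha, (alg_degree alpha <= n)%N
    & 0 < `|xi%:C%C - alpha| <=
        (((naive_height alpha)%:R : R) `^ (- w - 1))%:C%C]].

Definition omega_star (R : realType) (n : nat) (xi : R) : \bar R :=
  ereal_sup [set w%:E | w in [set w : R | 0 < w /\
                                infinite_set (good_approx n xi w)]].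

Lemma minpolyZ_exists (K : numFieldType) (x : K) :
  algebraic x -> exists p, is_minpolyZ x p.
Proof.
move=> [p p0 px].
pose P (m : nat) := `[< exists q : {poly int},
  [/\ q != 0, root (map_poly intr q) x & size q = m] >].
have exP : exists m, P m.
  have [q [a a0 pE]] := rat_poly_scale p.
  exists (size q); apply/asboolP; exists q; split => //.
    by apply: contraNneq p0 => q0; rewrite pE q0 map_poly0 scaler0.
  move: px; rewrite pE map_polyZ /= rootZ; last first.
    by rewrite fmorph_eq0 invr_eq0 intr_eq0.
  rewrite -map_poly_comp; congr (is_true (root _ x)).
  by apply: eq_map_poly => z /=; rewrite ratr_int.
case: (ex_minnP exP) => m /asboolP[q [q0 qx sq]] minm.
have {}minm (r : {poly int}) :
    r != 0 -> root (map_poly intr r) x -> (m <= size r)%N.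
  by move=> r0 rx; apply: minm; apply/asboolP; exists r.
have c0 : zcontents q != 0 by rewrite zcontents_eq0.
pose r := zprimitive q.
have r0 : r != 0 by rewrite zprimitive_eq0.
have sr : size r = m by rewrite size_zprimitive.
have rx : root (map_poly intr r) x.
  by move: qx; rewrite {1}[q]zpolyEprim map_polyZ /= rootZ // intr_eq0.
exists r; split => //.
- split.
    rewrite ltnNge; apply/negP => /size1_polyC rE.
    move: rx r0; rewrite rE map_polyC /= rootC intr_eq0 polyC_eq0.
    by move=> ->.
  move=> d sd /Pdiv.Idomain.dvdpP[[c k] /= cz E].
  have cr0 : c *: r != 0 by rewrite scale_poly_eq0 negb_or cz.
  have k0 : k != 0 by apply: contraNneq cr0 => k0; rewrite E k0 mul0r.
  have d0 : d != 0 by apply: contraNneq cr0 => d0; rewrite E d0 mulr0.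
  have sE : size r = (size k + size d).-1 by rewrite -size_mul // -E size_scale.
  have : root (map_poly intr (c *: r)) x.
    by rewrite map_polyZ /= rootZ // intr_eq0.
  rewrite E rmorphM /= rootM => /orP[kx|dx].
    have := minm _ k0 kx; rewrite -sr sE.
    move: sd d0; rewrite -size_poly_gt0; case: (size d) => [//|[//|s]] _ _.
    by rewrite addnS /= addnS ltnNge leq_addr.
  have := minm _ d0 dx; rewrite -sr => led.
  rewrite -Pdiv.Idomain.dvdp_size_eqp.
    rewrite eqn_leq led andbT sE.
    by move: k0; rewrite -size_poly_gt0; case: (size k) => [//|s] _; rewrite addSn leq_addl.
  by apply/Pdiv.Idomain.dvdpP; exists (c, k).
- by rewrite zcontents_primitive q0.
- by rewrite -sgz_gt0 sgz_lead_primitive q0.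
Qed.

Lemma is_minpolyZ_unique (K : numFieldType) (x : K) (p q : {poly int}) :
  is_minpolyZ x p -> is_minpolyZ x q -> p = q.
Proof.
move=> [px ip cp lp] [qx iq cq lq].
have p0 := irredp_neq0 ip; have q0 := irredp_neq0 iq.
have sg : size (gcdp p q) != 1.
  apply/negP => /eqP /eqP cpq.
  have /Pdiv.Idomain.Bezout_coprimepP [[u v] /= E] := cpq.
  move: E; rewrite eqp_sym => /Pdiv.Idomain.eqpP [[a b] /= /andP[a0 b0]].
  move/(congr1 (fun r => (map_poly (intr : int -> K) r).[x])).
  rewrite !map_polyZ /= rmorphD /= !rmorphM /= rmorph1 !hornerE.
  by move/rootP: px => ->; move/rootP: qx => ->; rewrite !mulr0 addr0 mulr0 => /eqP;
     rewrite intr_eq0 (negbTE a0).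
have gp := ip.2 _ sg (Pdiv.Idomain.dvdp_gcdl p q).
have gq := iq.2 _ sg (Pdiv.Idomain.dvdp_gcdr p q).
have : p %= q by apply: (Pdiv.Idomain.eqp_trans _ gq); rewrite Pdiv.Idomain.eqp_sym.
move=> /Pdiv.Idomain.eqpP[[a b] /= /andP[a0 b0]] E.
rewrite [p]zpolyEprim [q]zpolyEprim cp cq !scale1r.
by rewrite -(zprimitiveZ p a0) E zprimitiveZ.
Qed.

Lemma minpolyZP (K : numFieldType) (x : K) :
  algebraic x -> is_minpolyZ x (minpolyZ x).
Proof. by move=> /minpolyZ_exists; apply: (xgetPex 0). Qed.

(* Main.v *)
Require Import Defs.
From HB Require Import structures.
From mathcomp Require Import all_boot all_order all_fingroup all_algebra all_field.
From mathcomp Require Import all_classical all_reals all_analysis.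
From mathcomp Require Import complex polyorder qpoly.
From mathcomp Require Import ring lra zify.

(** Suppose that [omega_n^*(xi) < w < a n]. Every root [alpha] of an integer
    polynomial [P] of degree at most [n] then satisfies [|xi - alpha| >> H^(-w-1)],
    hence [|P'(xi)| << |P(xi)| H(P)^(w+1)].

    Choose an irreducible [F], of degree [d], whose exponent of approximation to
    [0] at [xi] is nearly extremal, put [h = H(F)], and measure integer polynomials
    by [N_E(P) = max (H(P), E |P(xi)|)], where [E] is chosen such that the smallest
    norm of a polynomial prime to [F] is about [N_E(F) = h]. A reduced basis of the
    lattice of integer polynomials of degree at most [n] provides [G_1, ..., G_d],
    independent modulo [F], with [h^(n+1-d) N_E(G_1) ... N_E(G_d) << E^(1+o(1))] and
    [N_E(G_1) = h]. For [1 <= t <= d] put [J = d - t]. A proper nonzero subspace of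
    [Q[X]/(F)] is not stable under multiplication by [X], so that among the
    products [X^j G_i] with [j <= J] and [i <= t] there are [d] ones independent
    modulo [F], namely [J + 1] multiples of [G_1] and one product of norm at most
    [N_E(G_i)] for each [i = 2, ..., t]. Together with the [X^j F], [j <= n - d + J],
    they have a nonzero integral determinant. Expanding it along the columns
    [P(xi)] and [P'(xi)] gives
    [E^2 << h^(n+1-d+2J) N_E(G_1) ... N_E(G_t) N_E(G_t)^(w+1)].
    In logarithmic scale these inequalities form a linear recurrence in [t]
    incompatible with the volume bound when [w (2 - log 2) < n]. The number
    [log 2] comes from minimizing [D + 2 (w+2) ((w+1)/(w+2))^D] over [D]. For
    [n = 3] a sharper estimate of the first determinant is needed. *)

Set Implicit Arguments.
Unset Strict Implicit.
Unset Printing Implicit Defensive.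
Import Order.TTheory GRing.Theory Num.Theory.
Local Open Scope ring_scope.

(** * The l1 norm of polynomials *)

Section L1.
Variable K : numDomainType.
Implicit Types (p q : {poly K}) (a x : K).

Definition l1 p : K := \sum_(i < size p) `|p`_i|.

Lemma l1E m p : (size p <= m)%N -> l1 p = \sum_(i < m) `|p`_i|.
Proof.
move=> sp; rewrite /l1 (big_ord_widen m (fun i => `|p`_i|) sp) big_mkcond /=.
by apply: eq_bigr => i _; case: ltnP => // /(nth_default 0) ->; rewrite normr0.
Qed.

Lemma l1_ge0 p : 0 <= l1 p. Proof. exact: sumr_ge0. Qed.

Lemma l1_coef p i : `|p`_i| <= l1 p.
Proof.
have [ltip|leip] := ltnP i (size p).
  by rewrite /l1 (bigD1 (Ordinal ltip)) //= lerDl sumr_ge0.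
by rewrite nth_default // normr0 l1_ge0.
Qed.

Lemma l1_eq0 p : (l1 p == 0) = (p == 0).
Proof.
apply/eqP/eqP => [p0|->]; last by rewrite /l1 size_poly0 big_ord0.
apply/polyP => i; rewrite coef0; apply/normr0_eq0/le_anti.
by rewrite normr_ge0 andbT; have := l1_coef p i; rewrite p0.
Qed.

Lemma l1_gt0 p : p != 0 -> 0 < l1 p.
Proof. by move=> p0; rewrite lt0r l1_eq0 p0 l1_ge0. Qed.

Lemma l1D p q : l1 (p + q) <= l1 p + l1 q.
Proof.
pose m := maxn (size p) (size q).
rewrite (@l1E m (p + q)) ?(leq_trans (size_polyD _ _)) //.
rewrite (@l1E m p) ?leq_maxl // (@l1E m q) ?leq_maxr // -big_split.
by apply: ler_sum => i _; rewrite coefD ler_normD.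
Qed.

Lemma l1_sum (I : Type) (r : seq I) (P : pred I) (F : I -> {poly K}) :
  l1 (\sum_(i <- r | P i) F i) <= \sum_(i <- r | P i) l1 (F i).
Proof.
apply: (big_ind2 (fun p a => l1 p <= a)) => //; first by rewrite (eqP (_ : l1 0 == 0)) // l1_eq0.
by move=> p a q b pa qb; rewrite (le_trans (l1D _ _)) // lerD.
Qed.

Lemma l1Z a p : l1 (a *: p) = `|a| * l1 p.
Proof.
rewrite (@l1E (size p)) ?size_scale_leq // /l1 mulr_sumr.
by apply: eq_bigr => i _; rewrite coefZ normrM.
Qed.

Lemma l1XnM j p : l1 ('X^j * p) = l1 p.
Proof.
rewrite -commr_polyXn (@l1E (j + size p)); last first.
  by rewrite (leq_trans (size_polyMleq _ _)) // size_polyXn addnS /= addnC.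
rewrite big_split_ord /= big1 ?add0r => [|i _].
  by apply: eq_bigr => i _; rewrite coefMXn ltnNge leq_addr /= addKn.
by rewrite coefMXn ltn_ord normr0.
Qed.

Lemma l1M p q : l1 (p * q) <= l1 p * l1 q.
Proof.
rewrite -{1}[p]coefK poly_def mulr_suml (le_trans (l1_sum _ _ _)) // [l1 p]/l1 mulr_suml.
by apply: ler_sum => i _; rewrite -scalerAl l1Z l1XnM.
Qed.

Lemma l1C a : l1 a%:P = `|a|.
Proof. by rewrite (@l1E 1) ?size_polyC_leq1 // big_ord1 coefC. Qed.

Lemma l1_XsubC a : l1 ('X - a%:P) = 1 + `|a|.
Proof.
by rewrite /l1 size_XsubC !big_ord_recl big_ord0 !coefB !coefX !coefC /= sub0r subr0 normrN normr1 addr0 addrC.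
Qed.

Lemma horner_l1 m p x M :
  (size p <= m.+1)%N -> `|x| <= M -> 1 <= M -> `|p.[x]| <= l1 p * M ^+ m.
Proof.
move=> sp xM M1; rewrite horner_coef (le_trans (ler_norm_sum _ _ _)) // [l1 p]/l1 mulr_suml.
apply: ler_sum => i _; rewrite normrM ler_wpM2l // normrX.
rewrite (le_trans (lerXn2r i _ _ xM)) ?nnegrE // ?(le_trans _ M1) //.
by rewrite ler_weXn2l // -ltnS (leq_trans _ sp).
Qed.

Lemma l1_deriv m p : (size p <= m.+1)%N -> l1 p^`() <= m%:R * l1 p.
Proof.
move=> sp; rewrite (@l1E m); last by rewrite (leq_trans (size_poly _ _)) //; case: (size p) sp.
rewrite (l1E sp) big_ord_recl mulrDr mulr_sumr -[leLHS]add0r lerD ?mulr_ge0 //.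
apply: ler_sum => i _; rewrite coef_deriv normrMn -[leLHS]mulr_natl ler_wpM2r //.
by rewrite ler_nat ltn_ord.
Qed.

(** The identity [p_k = q_(k+1) + a p_(k+1)] is unrolled from the top coefficient downwards; with
    [|a| <= 1] no step amplifies. *)
Lemma l1_XsubC_div_small p a i : `|a| <= 1 -> `|p`_i| <= l1 (('X - a%:P) * p).
Proof.
move=> a1; set q := (_ * p).
have qE k : q`_k.+1 = p`_k - a * p`_k.+1.
  by rewrite /q mulrBl coefB coefCM coefXM.
have sq : (size q <= (size p).+1)%N.
  by rewrite (leq_trans (size_polyMleq _ _)) // size_XsubC.
have H k : (k <= size p)%N -> `|p`_(size p - k)| <= \sum_(size p - k <= j < size p) `|q`_j.+1|.
  elim: k => [|k IH] ltk; first by rewrite subn0 nth_default // normr0 sumr_ge0.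
  rewrite big_ltn ?ltn_subrL ?(leq_ltn_trans (leq0n k) ltk) //.
  have -> : (size p - k.+1).+1 = (size p - k)%N by rewrite subnSK.
  have := qE (size p - k.+1)%N; rewrite subnSK // => E.
  have -> : p`_(size p - k.+1) = q`_(size p - k) + a * p`_(size p - k) by rewrite E subrK.
  rewrite (le_trans (ler_normD _ _)) // lerD // normrM.
  rewrite (le_trans _ (IH (ltnW ltk))) // -[leRHS]mul1r ler_wpM2r //.
have [ltip|leip] := ltnP i (size p); last by rewrite nth_default // normr0 l1_ge0.
have := H (size p - i)%N (leq_subr _ _); rewrite subKn ?(ltnW ltip) // => /le_trans; apply.
rewrite (l1E sq) big_ord_recl /= -[leLHS]add0r lerD //.
rewrite (eq_bigr (fun j : 'I_(size p) => (fun j => `|q`_j.+1|) j)) //.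
rewrite -(big_mkord xpredT (fun j => `|q`_j.+1|)) [leRHS](@big_cat_nat _ _ _ i) ?(ltnW ltip) //=.
by rewrite lerDr sumr_ge0.
Qed.

(** For [|a| >= 1] the recursion runs upwards from the constant coefficient, dividing by [a] at each
    step. *)
Lemma l1_XsubC_div_large p a i : 1 <= `|a| -> `|a| * `|p`_i| <= l1 (('X - a%:P) * p).
Proof.
move=> a1; set q := (_ * p).
have q0 : q`_0 = - (a * p`_0) by rewrite /q mulrBl coefB coefCM coefXM sub0r.
have qE k : q`_k.+1 = p`_k - a * p`_k.+1 by rewrite /q mulrBl coefB coefCM coefXM.
have H k : `|a| * `|p`_k| <= \sum_(j < k.+1) `|q`_j|.
  elim: k => [|k IH]; first by rewrite big_ord1 q0 normrN normrM.
  rewrite big_ord_recr /= -normrM.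
  have -> : a * p`_k.+1 = p`_k - q`_k.+1 by rewrite qE opprB addrC subrK.
  rewrite (le_trans (ler_normB _ _)) // lerD // (le_trans _ IH) //.
  by rewrite -[leLHS]mul1r ler_wpM2r.
rewrite (le_trans (H i)) // (@l1E (i.+1 + size q)) ?leq_addl //.
by rewrite big_split_ord /= lerDl sumr_ge0.
Qed.

Lemma l1_XsubC_div p a :
  l1 p * (1 + `|a|) <= (size p).*2%:R * l1 (('X - a%:P) * p).
Proof.
have [a1|a1] := real_leP (normr_real a) (@real1 K).
  apply: (@le_trans _ _ (l1 p * 2%:R)); first by rewrite ler_wpM2l ?l1_ge0 // -[2%:R]/(1 + 1) lerD2l.
  rewrite -muln2 natrM mulrAC ler_wpM2r // [l1 p]/l1.
  apply: le_trans (_ : \sum_(i < size p) l1 (('X - a%:P) * p) <= _); last first.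
    by rewrite sumr_const card_ord mulr_natl.
  by apply: ler_sum => i _; exact: l1_XsubC_div_small.
have {}a1 := ltW a1.
apply: (@le_trans _ _ (l1 p * (2%:R * `|a|))).
  by rewrite ler_wpM2l ?l1_ge0 // mulr_natl mulr2n lerD2r.
rewrite [leLHS]mulrCA -mul2n natrM -mulrA ler_wpM2l // mulrC [l1 p]/l1 mulr_sumr.
apply: le_trans (_ : \sum_(i < size p) l1 (('X - a%:P) * p) <= _); last first.
  by rewrite sumr_const card_ord mulr_natl.
by apply: ler_sum => i _; exact: l1_XsubC_div_large.
Qed.

Lemma l1_prod_XsubC (rs : seq K) :
  l1 (\prod_(a <- rs) ('X - a%:P)) <= \prod_(a <- rs) (1 + `|a|).
Proof.
elim: rs => [|a rs IH]; first by rewrite !big_nil l1C normr1.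
by rewrite !big_cons (le_trans (l1M _ _)) // l1_XsubC ler_wpM2l // addr_ge0.
Qed.

Lemma l1_prod_XsubC_div (rs : seq K) p m :
  (size (\prod_(a <- rs) ('X - a%:P) * p)%R <= m)%N ->
  l1 p * \prod_(a <- rs) (1 + `|a|) <=
    m.*2%:R ^+ size rs * l1 (\prod_(a <- rs) ('X - a%:P) * p).
Proof.
elim: rs p => [|a rs IH] p; rewrite ?big_nil ?mulr1 ?expr0 ?mul1r //.
rewrite !big_cons => sz.
have [->|p0] := eqVneq p 0.
  by rewrite !mulr0 (eqP (_ : l1 0 == 0)) ?l1_eq0 // mul0r mulr0.
rewrite mulrA.
have sp : (size p <= m)%N.
  have : ('X - a%:P) * \prod_(j <- rs) ('X - j%:P) != 0.
    by rewrite mulf_neq0 ?polyXsubC_eq0 // monic_neq0 ?monic_prod_XsubC.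
  move=> M0; apply: leq_trans sz; rewrite size_mul //.
  by move: M0; rewrite -size_poly_gt0; case: size => // k _; rewrite addSn leq_addl.
set P := \prod_(j <- rs) _ in sz *.
have E : ('X - a%:P) * P * p = P * (('X - a%:P) * p) by rewrite mulrCA mulrA.
apply: (@le_trans _ _ ((size p).*2%:R * l1 (('X - a%:P) * p) * \prod_(j <- rs) (1 + `|j|))).
  by rewrite ler_wpM2r ?l1_XsubC_div // prodr_ge0 // => i _; rewrite addr_ge0.
have P0 : 0 <= \prod_(j <- rs) (1 + `|j|) by apply: prodr_ge0 => j _; rewrite addr_ge0.
rewrite -mulrA exprS -mulrA; apply: ler_pM; rewrite ?mulr_ge0 ?l1_ge0 //.
  by rewrite ler_nat leq_double.
by rewrite E; apply: IH; rewrite -E.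
Qed.
End L1.

Lemma l1_map (K : numDomainType) (p : {poly int}) :
  l1 (map_poly (intr : int -> K) p) = (l1 p)%:~R.
Proof.
rewrite (@l1E _ (size p)) ?size_poly // /l1 rmorph_sum /=.
by apply: eq_bigr => i _; rewrite coef_map intr_norm.
Qed.

Lemma l1_int_ge1 (p : {poly int}) : p != 0 -> 1 <= l1 p.
Proof. by move=> /l1_gt0. Qed.

(** Gelfond's inequality. Splitting [p] into linear factors bounds [l1 p] by [|lead_coef p|] times
    the product of the [1 + |a|] over the roots; dividing [p * q] by these factors one at a time
    recovers the same product multiplied by [l1 q]. *)
Lemma l1_mul_le (K : numClosedFieldType) (p q : {poly K}) m :
  (size (p * q)%R <= m)%N -> l1 p * l1 q <= m.*2%:R ^+ m * l1 (p * q).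
Proof.
move=> sz.
have [->|p0] := eqVneq p 0.
  by rewrite mul0r (eqP (_ : l1 0 == 0)) ?l1_eq0 // mul0r mulr0.
have [->|q0] := eqVneq q 0.
  by rewrite mulr0 (eqP (_ : l1 0 == 0)) ?l1_eq0 // !mulr0.
have [rs E] := closed_field_poly_normal p.
have lp : lead_coef p != 0 by rewrite lead_coef_eq0.
move: sz; rewrite {1 2 3}E -scalerAl size_scale // => sz; rewrite !l1Z -mulrA [leRHS]mulrCA.
rewrite ler_wpM2l //.
have := l1_prod_XsubC_div sz; rewrite mulrC => H.
apply: le_trans (_ : _ <= \prod_(a <- rs) (1 + `|a|) * l1 q) _.
  by rewrite ler_wpM2r ?l1_ge0 ?l1_prod_XsubC.
apply: le_trans H _; rewrite ler_wpM2r ?l1_ge0 //.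
have s0 : \prod_(a <- rs) ('X - a%:P) != 0 by rewrite monic_neq0 ?monic_prod_XsubC.
rewrite size_mul // size_prod_XsubC /= in sz.
rewrite ler_weXn2l //; last first.
  by apply: leq_trans sz; rewrite leq_addr.
rewrite -[1]/(1%:R) ler_nat -addnn.
rewrite -size_poly_gt0 in q0.
by rewrite addn_gt0 (leq_trans q0) // (leq_trans _ sz) // leq_addl.
Qed.

(** * Determinants of families of polynomials *)

Definition coef_mx (K : nzRingType) N M (P : 'I_N -> {poly K}) : 'M[K]_(N, M) :=
  \matrix_(i, j) (P i)`_j.

Lemma det_coef_mx_monic (K : comNzRingType) N (P : 'I_N -> {poly K}) :
  (forall i, P i \is monic) -> (forall i : 'I_N, size (P i) = i.+1) ->
  \det (coef_mx N P) = 1.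
Proof.
move=> mP sP; rewrite det_trig.
  rewrite big1 // => i _; rewrite mxE.
  by have /monicP := mP i; rewrite lead_coefE sP.
by apply/is_trig_mxP => i j ltij; rewrite mxE nth_default // sP.
Qed.

Lemma coef_mx_comp (K : comNzRingType) N (P : 'I_N -> {poly K}) (q : {poly K}) :
  (forall i, size (P i) <= N)%N ->
  coef_mx N (fun i => P i \Po q) = coef_mx N P *m coef_mx N (fun j : 'I_N => q ^+ j).
Proof.
move=> sP; apply/matrixP => i j; rewrite !mxE comp_polyE coef_sum.
rewrite (big_ord_widen N (fun k => ((P i)`_k *: q ^+ k)`_j) (sP i)) big_mkcond /=.
apply: eq_bigr => k _; rewrite !mxE; case: ltnP => [_|/(nth_default 0) ->]; first by rewrite coefZ.
by rewrite mul0r.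
Qed.

Lemma size_XDC_exp (K : idomainType) (c : K) j : size (('X + c%:P) ^+ j) = j.+1.
Proof. by rewrite -[c]opprK polyCN size_exp_XsubC. Qed.

Lemma monic_XDC_exp (K : nzRingType) (c : K) j : ('X + c%:P) ^+ j \is monic.
Proof. by rewrite -[c]opprK polyCN monic_exp ?monicXsubC. Qed.

(** Substituting [X + c] multiplies the coefficient matrix by that of the powers [(X + c)^j], which
    is unitriangular. *)
Lemma det_coef_mx_shift (K : idomainType) N (P : 'I_N -> {poly K}) (c : K) :
  (forall i, size (P i) <= N)%N ->
  \det (coef_mx N (fun i => P i \Po ('X + c%:P))) = \det (coef_mx N P).
Proof.
move=> sP; rewrite coef_mx_comp // det_mulmx.
rewrite (@det_coef_mx_monic _ _ (fun j : 'I_N => ('X + c%:P) ^+ j)) ?mulr1 //.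
  by move=> i; exact: monic_XDC_exp.
by move=> i; exact: size_XDC_exp.
Qed.

Lemma ler_det (R : numDomainType) N (B : 'M[R]_N) (M : R) :
  (forall s : 'S_N, \prod_i `|B i (s i)| <= M) -> `|\det B| <= N`!%:R * M.
Proof.
move=> H; rewrite /determinant (le_trans (ler_norm_sum _ _ _)) //.
rewrite -card_Sn mulr_natl -sumr_const; apply: ler_sum => s _.
by rewrite normrM normr_sign mul1r normr_prod.
Qed.

Lemma ler_det_scaled (R : numDomainType) N (B : 'M[R]_N) (v f : 'I_N -> R) :
  (forall i, 0 <= v i) -> (forall i j, `|B i j| <= v i * f j) ->
  `|\det B| <= N`!%:R * (\prod_i f i * \prod_i v i).
Proof.
move=> v0 H; apply: ler_det => s.
rewrite [\prod_i f i](reindex_inj (@perm_inj _ s)) /= mulrC -big_split /=.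
by apply: ler_prod => i _; rewrite normr_ge0 H.
Qed.

Lemma intmx_det_ge1 (R : numDomainType) N (A : 'M[int]_N) :
  \det A != 0 -> 1 <= `|\det (map_mx intr A)| :> R.
Proof.
move=> A0; rewrite det_map_mx -intr_norm -[1]/(1%:~R) ler_int.
by rewrite -gtz0_ge1 normr_gt0.
Qed.

Lemma coef0_shift (K : comNzRingType) (p : {poly K}) c : (p \Po ('X + c%:P))`_0 = p.[c].
Proof. by rewrite -horner_coef0 horner_comp !hornerE. Qed.

Lemma coef1_shift (K : comNzRingType) (p : {poly K}) c : (p \Po ('X + c%:P))`_1 = p^`().[c].
Proof.
have -> : (p \Po ('X + c%:P))`_1 = (p \Po ('X + c%:P))^`()`_0 by rewrite coef_deriv.
by rewrite deriv_comp derivD derivX derivC addr0 mulr1 coef0_shift.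
Qed.

Lemma l1_shift (R : numDomainType) (p : {poly R}) c m :
  (size p <= m.+1)%N -> l1 (p \Po ('X + c%:P)) <= l1 p * (1 + `|c|) ^+ m.
Proof.
move=> sp; rewrite comp_polyE (le_trans (l1_sum _ _ _)) // [l1 p]/l1 mulr_suml.
apply: ler_sum => i _; rewrite l1Z ler_wpM2l //.
have le1 : 1 <= 1 + `|c| by rewrite lerDl.
apply: (@le_trans _ _ ((1 + `|c|) ^+ i)); last first.
  by rewrite ler_weXn2l // -ltnS (leq_trans _ sp).
elim: (nat_of_ord i) => [|k IH]; first by rewrite !expr0 l1C normr1.
rewrite !exprS (le_trans (l1M _ _)) // ler_pM ?l1_ge0 //.
by rewrite -[c]opprK polyCN l1_XsubC normrN opprK.
Qed.

(** Translating by [x] puts the values at [x] and the derivatives at [x] into columns 0 and 1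
    without changing the determinant, a nonzero integer. Each of the [m] other columns costs a
    factor [(1 + |x|)^(m+1)]. *)
Lemma int_poly_det_bound (R : numDomainType) m (Q : 'I_m.+2 -> {poly int}) (x : R)
    (v : 'I_m.+2 -> R) (e0 e1 : R) :
  (forall i, size (Q i) <= m.+2)%N -> \det (coef_mx m.+2 Q) != 0 ->
  0 <= e0 -> 0 <= e1 ->
  (forall i, (l1 (Q i))%:~R <= v i) ->
  (forall i, `|(map_poly intr (Q i)).[x]| <= v i * e0) ->
  (forall i, `|(map_poly intr (Q i))^`().[x]| <= v i * e1) ->
  1 <= (m.+2)`!%:R * ((1 + `|x|) ^+ (m.+1 * m) * (e0 * e1 * \prod_i v i)).
Proof.
move=> sQ dQ e0_ge0 e1_ge0 lv v0 v1.
pose P i : {poly R} := map_poly intr (Q i).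
have sP i : (size (P i) <= m.+2)%N by rewrite (leq_trans (size_poly _ _)).
have vg i : 0 <= v i by apply: le_trans (lv i); rewrite ler0z l1_ge0.
have := intmx_det_ge1 R dQ.
have -> : map_mx intr (coef_mx m.+2 Q) = coef_mx m.+2 P.
  by apply/matrixP => i j; rewrite !mxE coef_map.
rewrite -(det_coef_mx_shift x) // => /le_trans; apply.
pose f (j : 'I_m.+2) := if j == 0 :> nat then e0 else if j == 1 :> nat then e1 else (1 + `|x|) ^+ m.+1.
have -> : (1 + `|x|) ^+ (m.+1 * m) * (e0 * e1 * \prod_i v i) = \prod_i f i * \prod_i v i.
  rewrite [\prod_i f i]big_ord_recl big_ord_recl /= [f ord0]/f [f (lift _ _)]/f /=.
  rewrite [X in _ = _ * (_ * X) * _](eq_bigr (fun=> (1 + `|x|) ^+ m.+1)) // prodr_const card_ord -exprM.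
  move: (\prod_i v i) => V; move: ((1 + _) ^+ _) => KK.
  by ring.
apply: ler_det_scaled => // i j; rewrite mxE /f.
case: eqP => [->|_]; first by rewrite coef0_shift v0.
case: eqP => [->|_]; first by rewrite coef1_shift v1.
rewrite (le_trans (l1_coef _ _)) // (le_trans (l1_shift _ (sP i))) //.
by rewrite ler_wpM2r ?exprn_ge0 ?addr_ge0 // l1_map.
Qed.

(** * Sylvester matrices and translation *)

Definition sylv (K : nzRingType) a b (p q : {poly K}) (u : {poly K}) (i : 'I_(a + b)) : {poly K} :=
  match fintype.split i with inl j => u ^+ j * p | inr j => u ^+ j * q end.

(** The base [u] of [sylv] is free because rows built on [X - c] become, after [X -> X + c], the
    Sylvester rows of the translated polynomials. Passing from base [X] to base [X - c] is
    unitriangular in each of the two blocks of rows. *)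
Lemma sylv_monic (K : idomainType) a b (p q : {poly K}) (c : K) N :
  coef_mx N (sylv (a := a) (b := b) p q ('X - c%:P)) =
  block_mx (coef_mx a (fun j : 'I_a => ('X - c%:P) ^+ j)) 0 0
     (coef_mx b (fun j : 'I_b => ('X - c%:P) ^+ j)) *m coef_mx N (sylv (a := a) (b := b) p q 'X).
Proof.
have E k (j : 'I_k) (r : {poly K}) :
    ('X - c%:P) ^+ j * r = \sum_(l < k) (('X - c%:P) ^+ j)`_l *: ('X^l * r).
  under eq_bigr do rewrite scalerAl.
  rewrite -mulr_suml -poly_def; congr (_ * _); apply/polyP => l; rewrite coef_poly.
  case: ltnP => // lekl; rewrite nth_default // size_exp_XsubC.
  by rewrite (leq_trans _ lekl).
apply/matrixP => i j; rewrite !mxE big_split_ord /=.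
case: (split_ordP i) => k ->; rewrite /sylv.
- rewrite (unsplitK (inl k)) E coef_sum [X in _ = _ + X]big1 ?addr0 => [|l _]; last first.
    by rewrite block_mxEur mxE mul0r.
  apply: eq_bigr => l _; rewrite block_mxEul !mxE (unsplitK (inl l)).
  by rewrite coefZ.
- rewrite (unsplitK (inr k)) E coef_sum [X in _ = X + _]big1 ?add0r => [|l _]; last first.
    by rewrite block_mxEdl mxE mul0r.
  apply: eq_bigr => l _; rewrite block_mxEdr !mxE (unsplitK (inr l)).
  by rewrite coefZ.
Qed.

Lemma det_sylv_shift (K : idomainType) a b (p q : {poly K}) (c : K) :
  (size p <= b.+1)%N -> (size q <= a.+1)%N ->
  \det (coef_mx (a + b) (sylv (a := a) (b := b) (p \Po ('X + c%:P)) (q \Po ('X + c%:P)) 'X)) =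
  \det (coef_mx (a + b) (sylv (a := a) (b := b) p q 'X)).
Proof.
move=> sp sq.
have -> : coef_mx (a + b) (sylv (a := a) (b := b) (p \Po ('X + c%:P)) (q \Po ('X + c%:P)) 'X) =
  coef_mx (a + b) (fun i => sylv (a := a) (b := b) p q ('X - c%:P) i \Po ('X + c%:P)).
  apply/matrixP => i j; rewrite !mxE /sylv; congr (_`_j).
  case: fintype.split => k; rewrite comp_polyM rmorphXn /= comp_polyB comp_polyX comp_polyC;
  by rewrite -addrA subrr addr0.
rewrite det_coef_mx_shift; last first.
  move=> i; rewrite /sylv; case: (split_ordP i) => k _.
    rewrite (leq_trans (size_polyMleq _ _)) // size_exp_XsubC.
    by have := ltn_ord k; lia.
  rewrite (leq_trans (size_polyMleq _ _)) // size_exp_XsubC.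
  by have := ltn_ord k; lia.
have mon k : \det (coef_mx k (fun j : 'I_k => ('X - c%:P) ^+ j)) = 1.
  by apply: det_coef_mx_monic => j; rewrite ?size_exp_XsubC // monic_exp // monicXsubC.
by rewrite sylv_monic det_mulmx det_ublock !mon !mul1r.
Qed.

(* Only two rows have a nonzero entry in column 0, so a nonvanishing term of  *)
(* the Leibniz expansion that uses both of them in columns 0 and 1 gains a    *)
(* further factor [e1] in column 2.                                           *)
Lemma sylv_bound (R : realDomainType) a b (p q : {poly R}) (e0 e1 h : R) :
  (2 < a + b)%N -> 0 <= e0 <= e1 -> 0 <= h ->
  (forall i, `|p`_i| <= h) -> (forall i, `|q`_i| <= h) ->
  `|p`_0| <= h * e0 -> `|q`_0| <= h * e0 ->
  `|p`_1| <= h * e1 -> `|q`_1| <= h * e1 ->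
  `|\det (coef_mx (a + b) (sylv (a := a) (b := b) p q 'X))| <=
    (a + b)`!%:R * (h ^+ (a + b) * (e0 * e1 ^+ 2 + e0 ^+ 2)).
Proof.
move=> N2 /andP[e0g e01] hg ph qh p0 q0 p1 q1.
have e1g : 0 <= e1 := le_trans e0g e01.
pose N := (a + b)%N.
pose B := coef_mx N (sylv (a := a) (b := b) p q 'X).
(* [sh i] is the power of [X] carried by row [i], hence the column of its constant coefficient. *)
pose sh (i : 'I_N) : nat := match fintype.split i with inl j => j | inr j => j end.
have Bh i c : `|B i c| <= h.
  rewrite /B mxE /sylv; case: fintype.split => k; rewrite coefXnM; case: ifP => // _;
    by rewrite normr0.
have B0 i (c : 'I_N) : (c < sh i)%N -> B i c = 0.
  by rewrite /B mxE /sh /sylv; case: fintype.split => k ck; rewrite coefXnM ck.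
have Be0 i (c : 'I_N) : c = sh i :> nat -> `|B i c| <= h * e0.
  by rewrite /B mxE /sh /sylv; case: fintype.split => k ->; rewrite coefXnM ltnn subnn.
have Be1 i (c : 'I_N) : c = (sh i).+1 :> nat -> `|B i c| <= h * e1.
  by rewrite /B mxE /sh /sylv; case: fintype.split => k ->; rewrite coefXnM ltnNge leqnSn subSnn.
have lt3 k : (k < 3)%N -> (k < N)%N by move=> k3; apply: leq_trans N2.
pose c0 := Ordinal (lt3 0%N isT); pose c1 := Ordinal (lt3 1%N isT); pose c2 := Ordinal (lt3 2%N isT).
apply: ler_det => s; rewrite -/B.
pose t (c : 'I_N) := (s^-1)%g c.
have t_inj : injective t by exact: perm_inj.
have -> : \prod_i `|B i (s i)| = \prod_c `|B (t c) c|.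
  rewrite (reindex_inj t_inj) /=; apply: eq_bigr => c _.
  by rewrite /t permKV.
have R0 : 0 <= h ^+ N * (e0 * e1 ^+ 2 + e0 ^+ 2).
  by rewrite mulr_ge0 ?exprn_ge0 // addr_ge0 ?mulr_ge0 ?exprn_ge0.
have vanish c : B (t c) c = 0 -> \prod_c `|B (t c) c| <= h ^+ N * (e0 * e1 ^+ 2 + e0 ^+ 2).
  by move=> z; rewrite (bigD1 c) //= z normr0 mul0r.
have main f0 f1 f2 : `|B (t c0) c0| <= h * f0 -> `|B (t c1) c1| <= h * f1 ->
    `|B (t c2) c2| <= h * f2 -> f0 * f1 * f2 <= e0 * e1 ^+ 2 + e0 ^+ 2 ->
    \prod_c `|B (t c) c| <= h ^+ N * (e0 * e1 ^+ 2 + e0 ^+ 2).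
  move=> b0 b1 b2 fE.
  pose f (c : nat) := nth 1 [:: f0; f1; f2] c.
  apply: (@le_trans _ _ (\prod_(c < N) (h * f c))).
    apply: ler_prod => c _; rewrite normr_ge0 /=.
    have [c_lt3|c_ge3] := ltnP c 3; last by rewrite /f nth_default // mulr1.
    case: c c_lt3 => [[|[|[|//]]] Hc] /= _.
    - by rewrite (_ : Ordinal Hc = c0) //; apply: val_inj.
    - by rewrite (_ : Ordinal Hc = c1) //; apply: val_inj.
    - by rewrite (_ : Ordinal Hc = c2) //; apply: val_inj.
  rewrite big_split /= prodr_const card_ord ler_wpM2l ?exprn_ge0 //.
  apply: le_trans fE; rewrite -(big_mkord xpredT f) big_ltn; last exact/lt3.
  rewrite big_ltn; last exact/lt3.
  rewrite big_ltn // big_nat big1 ?mulr1 ?mulrA // => c /andP[c3 _].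
  by rewrite /f nth_default.
have [s0|s0] := posnP (sh (t c0)); last by apply: (vanish c0); apply: B0.
have F0 : `|B (t c0) c0| <= h * e0 by apply: Be0; rewrite s0.
have [s1|s1] := posnP (sh (t c1)).
  have F1 : `|B (t c1) c1| <= h * e1 by apply: Be1; rewrite s1.
  (* The rows of shift 0 are [p] and [q] themselves; columns 0 and 1 have consumed both. *)
  have s2 : sh (t c2) != 0%N.
    apply/eqP => s2.
    have n01 : t c0 != t c1 by rewrite (inj_eq t_inj).
    have n02 : t c0 != t c2 by rewrite (inj_eq t_inj).
    have n12 : t c1 != t c2 by rewrite (inj_eq t_inj).
    move: s0 s1 s2 n01 n02 n12; rewrite /sh.
    case: (split_ordP (t c0)) => i0 ->; case: (split_ordP (t c1)) => i1 ->;
    case: (split_ordP (t c2)) => i2 -> z0 z1 z2;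
    by rewrite ?eq_lshift ?eq_rshift -?val_eqE /= ?z0 ?z1 ?z2.
  apply: (main e0 e1 e1) => //; last by rewrite expr2 mulrA lerDl exprn_ge0.
  case: (ltngtP (sh (t c2)) 2) => [lt2|gt2|e2].
  - by apply: Be1 => /=; case: (sh _) s2 lt2 => [//|[|]].
  - by rewrite B0 // normr0 mulr_ge0.
  - by apply: le_trans (Be0 _ _ _) _; rewrite ?e2 // ler_wpM2l.
have [e|ne] := eqVneq (sh (t c1)) 1%N; last first.
  by apply: (vanish c1); apply: B0 => /=; case: (sh _) s1 ne => [//|[|]].
apply: (main e0 e0 1) => //; rewrite ?mulr1 //; first by apply: Be0; rewrite e.
by rewrite -expr2 lerDr mulr_ge0 ?exprn_ge0.
Qed.

(** * Residues modulo an irreducible polynomial *)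

Lemma rVpolyE (K : nzRingType) m (v : 'rV[K]_m) : rVpoly v = \sum_(i < m) v 0 i *: 'X^i.
Proof.
rewrite {1}[v]row_sum_delta linear_sum; apply: eq_bigr => i _.
by rewrite linearZ /= rVpoly_delta.
Qed.

Section Residues.
Variables (K : fieldType) (d : nat) (F : {poly K}).
Hypotheses (irrF : irreducible_poly F) (sF : size F = d.+2).
Implicit Types p q : {poly K}.

(** Since [size F = d.+2], the degree of [F] is [d + 1] wherever this convention is in force, one
    more than the [d] in the code. *)
Definition res p : 'rV[K]_d.+1 := poly_rV (p %% F).

Let F0 : F != 0. Proof. exact: irredp_neq0. Qed.

Lemma resD p q : res (p + q) = res p + res q.
Proof. by rewrite /res modpD linearD. Qed.

Lemma resZ a p : res (a *: p) = a *: res p.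
Proof. by rewrite /res modpZl linearZ. Qed.

Lemma res_sum (I : Type) (r : seq I) (P : pred I) (G : I -> {poly K}) :
  res (\sum_(i <- r | P i) G i) = \sum_(i <- r | P i) res (G i).
Proof.
apply: (big_ind2 (fun p v => res p = v)) => //; first by rewrite /res mod0p linear0.
by move=> p u q v <- <-; rewrite resD.
Qed.

Lemma res_eq0 p : (res p == 0) = (F %| p).
Proof.
rewrite /dvdp -(inj_eq (can_inj (@rVpolyK _ d.+1))) linear0 poly_rV_K //.
by rewrite -ltnS -sF ltn_modp.
Qed.

Lemma res_rVpoly (v : 'rV_d.+1) : res (rVpoly v) = v.
Proof. by rewrite /res modp_small ?rVpolyK // sF ltnS size_poly. Qed.

Definition resX : 'M[K]_d.+1 := \matrix_(i < d.+1) res ('X * 'X^i).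

Lemma res_mulX p : res ('X * p) = res p *m resX.
Proof.
have -> : res ('X * p) = res ('X * (p %% F)) by rewrite /res modp_mul.
rewrite mulmx_sum_row.
have -> : p %% F = \sum_(i < d.+1) (res p) 0 i *: 'X^i.
  rewrite -[LHS](@poly_rV_K _ d.+1); last by rewrite -ltnS -sF ltn_modp.
  by rewrite rVpolyE.
rewrite mulr_sumr res_sum; apply: eq_bigr => i _.
by rewrite -scalerAr resZ rowK.
Qed.

Lemma res_mulXn k p : res ('X^k * p) = res p *m resX ^+ k.
Proof.
elim: k => [|k IH]; first by rewrite expr0 mul1r mulmx1.
by rewrite exprS -mulrA res_mulX IH exprSr mulmxA.
Qed.

(** A combination of the rows is the residue of [g p] with [deg g < deg F]; if it vanishes, [F],
    being prime to [p], divides [g], and [g = 0]. *)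
Lemma res_powers_free p m : (m <= d.+1)%N -> ~~ (F %| p) ->
  row_free (\matrix_(k < m) res ('X^k * p)).
Proof.
move=> led np; apply: inj_row_free => v.
rewrite mulmx_sum_row => H.
have {}H : res (rVpoly v * p) = 0.
  rewrite -[RHS]H rVpolyE mulr_suml res_sum; apply: eq_bigr => k _.
  by rewrite rowK -scalerAl resZ.
move/eqP: H; rewrite res_eq0 Gauss_dvdpl; last by rewrite irreducible_poly_coprime.
move=> Fv; apply: (can_inj (@rVpolyK _ m)); rewrite linear0.
apply/eqP; apply: contraTT Fv => v0; apply/negP => /dvdp_leq -/(_ v0).
by rewrite sF leqNgt (leq_ltn_trans (size_poly _ _)).
Qed.

(** The subspace contains a nonzero residue [p] together with all [X^k p], of which the first
    [d + 1] are independent. *)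
Lemma resX_stable_full m (S : 'M[K]_(m, d.+1)) :
  S != 0 -> (S *m resX <= S)%MS -> row_full S.
Proof.
move=> S0 stS; have [i vi0] : exists i, row i S != 0.
  apply/existsP; apply: contraNT S0; rewrite negb_exists => /forallP H.
  by apply/eqP/row_matrixP => i; rewrite row0; apply/eqP; rewrite -[_ == _]negbK H.
have npF : ~~ (F %| rVpoly (row i S)) by rewrite -res_eq0 res_rVpoly.
have := res_powers_free (leqnn _) npF; rewrite /row_free => /eqP fr.
rewrite /row_full eqn_leq rank_leq_col -[leqLHS]fr; apply: mxrankS.
apply/row_subP => k; rewrite rowK res_mulXn res_rVpoly.
elim: (nat_of_ord k) => [|l IH]; first by rewrite mulmx1 row_sub.
by rewrite exprSr mulmxA; apply: submx_trans (submxMr _ IH) stS.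
Qed.

Fixpoint resX_span m (A : 'M[K]_(m, d.+1)) j : 'M[K]_d.+1 :=
  if j is j'.+1 then (resX_span A j' + resX_span A j' *m resX)%MS else <<A>>%MS.

(** As long as the span is proper it is not stable under [X], so each further multiplication raises
    the rank. *)
Lemma rank_resX_span m (A : 'M[K]_(m, d.+1)) j :
  (0 < \rank A)%N -> (minn (\rank A + j) d.+1 <= \rank (resX_span A j))%N.
Proof.
move=> rA; elim: j => [|j IH] /=; first by rewrite addn0 genmxE geq_minl.
set S := resX_span A j in IH *.
have leS : (S <= S + S *m resX)%MS by exact: addsmxSl.
have [stS|nst] := boolP (S *m resX <= S)%MS.
  have : row_full S.
    apply: resX_stable_full => //; rewrite -mxrank_eq0 -lt0n (leq_trans _ IH) //.
    by rewrite leq_min ltn_addr.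
  by rewrite /row_full => /eqP fS; rewrite (leq_trans _ (mxrankS leS)) // fS geq_minr.
have : (S < S + S *m resX)%MS.
  by rewrite ltmxE leS /= addsmx_sub submx_refl nst.
move/rank_ltmx; apply: leq_trans.
by move: IH; lia.
Qed.

Lemma resX_span_sub m r (A : 'M[K]_(m, d.+1)) (B : 'M[K]_(r, d.+1)) J :
  (forall k, (k <= J)%N -> (A *m resX ^+ k <= B)%MS) -> (resX_span A J <= B)%MS.
Proof.
move=> H.
suff: forall j k, (j + k <= J)%N -> (resX_span A j *m resX ^+ k <= B)%MS.
  by move=> /(_ J 0%N); rewrite addn0 leqnn mulmx1; apply.
elim=> [|j IH] k lek /=.
  by apply: submx_trans (H k lek); apply: submxMr; rewrite genmxE.
rewrite (submx_trans (_ : _ <= resX_span A j *m resX ^+ k + resX_span A j *m resX ^+ k.+1)%MS) //.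
  by rewrite addsmxMr -mulmxA exprS.
by rewrite addsmx_sub !IH //; lia.
Qed.

Definition seq_mx (f : nat -> 'rV[K]_d.+1) m : 'M[K]_(m, d.+1) := \matrix_(k < m) f k.

Lemma seq_mx_free_ext f m (v : 'rV[K]_d.+1) :
  row_free (seq_mx f m) -> ~~ (v <= seq_mx f m)%MS ->
  row_free (seq_mx (fun k => if (k < m)%N then f k else v) m.+1).
Proof.
move=> fr nv; set f' := fun k => _.
have le1 : (seq_mx f m <= seq_mx f' m.+1)%MS.
  apply/row_subP => i; rewrite rowK.
  have -> : f i = row (widen_ord (leqnSn m) i) (seq_mx f' m.+1).
    by rewrite rowK /f' /= ltn_ord.
  exact: row_sub.
have le2 : (v <= seq_mx f' m.+1)%MS.
  have -> : v = row ord_max (seq_mx f' m.+1) by rewrite rowK /f' /= ltnn.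
  exact: row_sub.
have : (seq_mx f m < seq_mx f' m.+1)%MS.
  by rewrite ltmxE le1; apply: contra nv; apply: submx_trans.
move/rank_ltmx; move: fr; rewrite /row_free => /eqP -> H.
by rewrite eqn_leq rank_leq_row H.
Qed.

(* A pair [c k = (j, i)] stands for [X^j * G i]; the first [J + 1] pairs are  *)
(* the multiples of [G 0].                                                    *)
Lemma select_multiples (G : nat -> {poly K}) t J :
  (t + J <= d)%N -> row_free (seq_mx (fun i => res (G i)) t.+1) ->
  exists c : nat -> nat * nat,
    [/\ row_free (seq_mx (fun k => res ('X^((c k).1) * G (c k).2)) (J + t).+1),
        forall k, (k <= J + t)%N -> ((c k).1 <= J)%N
      & forall k, (k <= J + t)%N -> ((c k).2 <= k - J)%N].
Proof.
elim: t => [|t IH] tJ frG.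
  exists (fun k => (k, 0%N)); split=> [|k|k _] //=; last by rewrite addn0.
  rewrite addn0; apply: res_powers_free; first by lia.
  rewrite -res_eq0; apply/negP => /eqP z.
  have := frG; rewrite /row_free => /eqP; have -> : seq_mx (fun i => res (G i)) 1 = 0.
    by apply/row_matrixP => i; rewrite rowK row0 ord1 z.
  by rewrite mxrank0.
have [|| c [fc c1 c2]] := IH; first by lia.
  have le : (seq_mx (fun i => res (G i)) t.+2 <= seq_mx (fun i => res (G i)) t.+1 + res (G t.+1))%MS.
    apply/row_subP => i; rewrite rowK; have [lti|] := ltnP i t.+1.
      apply: submx_trans (addsmxSl _ _).
      have -> : res (G i) = row (Ordinal lti) (seq_mx (fun i => res (G i)) t.+1) by rewrite rowK.
      exact: row_sub.
    move=> lei; have -> : nat_of_ord i = t.+1 by have := ltn_ord i; lia.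
    exact: addsmxSr.
  have := mxrankS le; move: frG; rewrite /row_free => /eqP -> H.
  rewrite eqn_leq rank_leq_row /=.
  have := leq_trans H (mxrank_adds_leqif _ _).1.
  have := rank_leq_row (res (G t.+1)); lia.
pose A := seq_mx (fun i => res (G i)) t.+2.
pose B := seq_mx (fun k => res ('X^((c k).1) * G (c k).2)) (J + t).+1.
have rA : \rank A = t.+2 by move: frG; rewrite /row_free => /eqP.
(* The products [X^k G_i] with [k <= J] and [i <= t + 1] span a space of dimension at least
   [t + 2 + J], more than the [J + t + 1] vectors already selected, so one of them is new. *)
have nAB : ~~ [forall k : 'I_J.+1, forall i : 'I_t.+2, res ('X^k * G i) <= B]%MS.
  apply/negP => /forallP H.
  have : (resX_span A J <= B)%MS.
    apply: resX_span_sub => k lek; apply/row_subP => i.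
    rewrite row_mul rowK -res_mulXn.
    by have /forallP/(_ i) := H (Ordinal (lek : (k < J.+1)%N)).
  move/mxrankS; have := @rank_resX_span _ A J; rewrite rA => /(_ isT).
  have := rank_leq_row B; lia.
move: nAB; rewrite negb_forall => /existsP[k]; rewrite negb_forall => /existsP[i nki].
exists (fun l => if (l < (J + t).+1)%N then c l else (nat_of_ord k, nat_of_ord i)); split.
- rewrite addnS; have := seq_mx_free_ext fc nki.
  set f1 := seq_mx _ _; set f2 := seq_mx _ _; suff -> : f1 = f2 by [].
  by apply/row_matrixP => l; rewrite !rowK; case: (_ < _)%N.
- by move=> l; case: ifP => [/c1 + _ //|_ _]; exact: (ltn_ord k).
- move=> l; case: ifP => [/c2 + _ //|ltl lel] /=.
  by have := ltn_ord i; lia.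
Qed.

End Residues.

(** Exchange argument. Indices are recorded rather than vectors, because the complementary indices
    enter the volume bound. *)
Lemma complete_basis (K : fieldType) d (v : 'rV[K]_d.+1) N (B : 'I_N -> 'rV[K]_d.+1) m :
  v != 0 -> (m <= d)%N -> row_full (\matrix_(i < N) B i) ->
  exists s : seq 'I_N, [/\ uniq s, size s = m &
    row_free (seq_mx (fun k => if k is k'.+1 then nth 0 (map B s) k' else v) m.+1)].
Proof.
move=> v0 + fullB; elim: m => [_|m IH ltm].
  exists [::]; split=> //; rewrite /row_free.
  have -> : seq_mx (fun k : nat => match k with 0 => v | k'.+1 => nth 0 (map B [::]) k' end) 1 = v.
    by apply/row_matrixP => i; rewrite rowK ord1 /=; apply/rowP => j; rewrite mxE.
  by rewrite eqn_leq rank_leq_row lt0n mxrank_eq0.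
have [s [us ss fs]] := IH (ltnW ltm).
set f := fun k => _ in fs.
have [H|] := boolP [forall i, (B i <= seq_mx f m.+1)%MS].
  have : (\matrix_(i < N) B i <= seq_mx f m.+1)%MS.
    by apply/row_subP => i; rewrite rowK (forallP H).
  move/mxrankS; move: fullB; rewrite /row_full => /eqP ->.
  by have := rank_leq_row (seq_mx f m.+1); lia.
rewrite negb_forall => /existsP[i ni].
have nis : i \notin s.
  apply: contra ni => iin; have ltk : (index i s < m)%N by rewrite -ss index_mem.
  have -> : B i = row (lift ord0 (Ordinal ltk)) (seq_mx f m.+1).
    by rewrite rowK /f /= (nth_map i) ?index_mem // nth_index.
  exact: row_sub.
exists (rcons s i); split; rewrite ?rcons_uniq ?nis ?size_rcons ?ss //.
have := seq_mx_free_ext fs ni.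
set f1 := seq_mx _ _; set f2 := seq_mx _ _; suff -> : f1 = f2 by [].
apply/row_matrixP => l; rewrite !rowK; case: l => [[|l] /= ltl] //.
rewrite map_rcons nth_rcons size_map ss ltnS; case: ltngtP => //.
by move: ltl; rewrite !ltnS; lia.
Qed.

Arguments res {K} d F p.

Local Notation toQ := (map_poly (intr : int -> rat)).

Definition join_family a b (f g : nat -> {poly int}) (i : 'I_(a + b)) : {poly int} :=
  match fintype.split i with inl j => f j | inr k => g k end.

(** Modulo [F], a relation among the rows is a relation among the [Q k], whose coefficients
    therefore vanish; what remains is [u F = 0], so [u = 0]. *)
Lemma det_join_family d (F : {poly int}) a (Q : nat -> {poly int}) :
  irreducible_poly F -> size F = d.+2 ->
  row_free (seq_mx (fun k => res d (toQ F) (toQ (Q k))) d.+1) ->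
  (forall k, (k < d.+1)%N -> (size (Q k) <= a + d.+1)%N) ->
  \det (coef_mx (a + d.+1) (join_family (a := a) (b := d.+1) (fun j => 'X^j * F) Q)) != 0.
Proof.
move=> irrF sF fr sQ; set A := coef_mx _ _.
have irrQ : irreducible_poly (toQ F) by apply/irreducible_rat_int.
have sFQ : size (toQ F) = d.+2 by rewrite size_map_inj_poly //; apply: intr_inj.
have F0 : toQ F != 0 by exact: irredp_neq0.
suff : \det (map_mx (intr : int -> rat) A) != 0 by rewrite det_map_mx intr_eq0.
rewrite -unitfE -unitmxE -row_free_unit; apply: inj_row_free => v vA.
pose P i := toQ (join_family (a := a) (b := d.+1) (fun j => 'X^j * F) Q i).
have sP i : (size (P i) <= a + d.+1)%N.
  rewrite /P size_map_inj_poly //; last exact: intr_inj.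
  rewrite /join_family; case: fintype.split => k; last exact: sQ.
  rewrite (leq_trans (size_polyMleq _ _)) // size_polyXn sF.
  by have := ltn_ord k; lia.
have {}vA : \sum_i v 0 i *: P i = 0.
  apply/polyP => j; rewrite coef0 coef_sum; have [ltj|lej] := ltnP j (a + d.+1).
    have /rowP/(_ (Ordinal ltj)) := vA; rewrite !mxE => E; rewrite -[RHS]E.
    by apply: eq_bigr => i _; rewrite coefZ !mxE coef_map.
  by rewrite big1 // => i _; rewrite coefZ nth_default ?mulr0 // (leq_trans (sP i)).
rewrite big_split_ord /= in vA.
pose u := \sum_(i < a) v 0 (lshift d.+1 i) *: 'X^i.
have uE : \sum_(i < a) v 0 (lshift d.+1 i) *: P (lshift d.+1 i) = u * toQ F.
  rewrite mulr_suml; apply: eq_bigr => i _; rewrite /P /join_family (unsplitK (inl i)).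
  by rewrite rmorphM /= map_polyXn scalerAl.
rewrite uE in vA.
have vr k : v 0 (rshift a k) = 0.
  have : \row_k v 0 (rshift a k) *m seq_mx (fun k => res d (toQ F) (toQ (Q k))) d.+1 =
      0 *m seq_mx (fun k => res d (toQ F) (toQ (Q k))) d.+1.
    rewrite mul0mx mulmx_sum_row.
    have := congr1 (res d (toQ F)) vA.
    rewrite (resD d) (res_sum d) /=; have -> : res d (toQ F) 0 = 0.
      by apply/eqP; rewrite (res_eq0 irrQ sFQ) dvdp0.
    have -> : res d (toQ F) (u * toQ F) = 0.
      by apply/eqP; rewrite (res_eq0 irrQ sFQ) dvdp_mull.
    rewrite add0r => E; rewrite -[RHS]E; apply: eq_bigr => i _.
    by rewrite resZ rowK mxE /P /join_family (unsplitK (inr i)).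
  by move/(row_free_inj fr)/rowP/(_ k); rewrite !mxE.
have u0 : u = 0.
  move: vA; rewrite [X in _ + X]big1 ?addr0 => [|i _]; last by rewrite vr scale0r.
  by move/eqP; rewrite mulf_eq0 (negbTE F0) orbF => /eqP.
apply/rowP => i; rewrite mxE; case: (split_ordP i) => j ->; last by rewrite vr.
have := congr1 (fun p : {poly rat} => p`_j) u0; rewrite /u coef0 coef_sum (bigD1 j) //=.
rewrite big1 ?addr0 => [|l nlj]; first by rewrite coefZ coefXn eqxx mulr1.
by rewrite coefZ coefXn eq_sym (inj_eq val_inj) (negbTE nlj) mulr0.
Qed.

(** * Lattice reduction *)

Section Lattice.
Variable R : realType.

Definition rnorm N (v : 'rV[R]_N) : R := \big[Num.max/0]_(i < N) `|v 0 i|.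

Lemma rnorm_ge0 N (v : 'rV[R]_N) : 0 <= rnorm v.
Proof. exact: bigmax_ge_id. Qed.

Lemma rnorm_coord N (v : 'rV[R]_N) i : `|v 0 i| <= rnorm v.
Proof. exact: le_bigmax. Qed.

Lemma rnorm_le N (v : 'rV[R]_N) x : 0 <= x -> (forall i, `|v 0 i| <= x) -> rnorm v <= x.
Proof. by move=> x0 H; apply/bigmax_leP. Qed.

Lemma rnorm_max N (v : 'rV[R]_N.+1) : exists j, rnorm v = `|v 0 j|.
Proof.
pose j := [arg max_(i > ord0) `|v 0 i|]%O; exists j; apply/le_anti.
rewrite rnorm_coord andbT; apply: rnorm_le => // i.
by rewrite /j; case: arg_maxP => // k _; apply.
Qed.

Lemma rnorm_xcol N (A : 'M[R]_N) i j k : rnorm (row k (xcol i j A)) = rnorm (row k A).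
Proof.
suff H (B : 'M[R]_N) : rnorm (row k (xcol i j B)) <= rnorm (row k B).
  apply/le_anti; rewrite H /=; have := H (xcol i j A); congr (rnorm (row k _) <= _).
  by rewrite !xcolE -mulmxA -perm_mxM tperm2 perm_mx1 mulmx1.
apply: rnorm_le => [|l]; first exact: rnorm_ge0.
by have := rnorm_coord (row k B) (tperm i j l); rewrite !mxE.
Qed.

Definition unimod N (U : 'M[int]_N) := `|\det U| == 1.

Lemma unimodM N (U V : 'M[int]_N) : unimod U -> unimod V -> unimod (U *m V).
Proof. by rewrite /unimod det_mulmx normrM => /eqP -> /eqP ->; rewrite mulr1. Qed.

Lemma unimod_xrow N (U : 'M[int]_N) i j : unimod U -> unimod (xrow i j U).
Proof.
rewrite xrowE => H; apply: unimodM => //.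
by rewrite /unimod det_perm normr_sign.
Qed.

Lemma norm_det_unimod N (U : 'M[int]_N) : unimod U -> `|\det (map_mx intr U)| = 1 :> R.
Proof. by move=> /eqP U1; rewrite det_map_mx -intr_norm U1. Qed.

Local Notation ir := (map_mx (intr : int -> R)).

(** The first row of [U] is a nonzero integer vector, recovered from that of [U G] through the
    inverse of [G]. This makes the infimum in the reduction positive. *)
Lemma lattice_first_row N (G : 'M[R]_N.+1) : \det G != 0 ->
  exists2 c, 0 < c & forall U, unimod U -> c <= rnorm (row 0 (ir U *m G)).
Proof.
move=> dG; have Gu : G \in unitmx by rewrite unitmxE unitfE.
pose K := 1 + \sum_k \sum_j `|invmx G k j|.
have K0 : 0 < K by rewrite ltr_pwDl // sumr_ge0 // => k _; rewrite sumr_ge0.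
exists K^-1; first by rewrite invr_gt0.
move=> U uU.
have [j Uj] : exists j, U 0 j != 0.
  apply/existsP; apply: contraTT uU; rewrite negb_exists => /forallP H.
  rewrite /unimod (expand_det_row U 0) big1 ?normr0 // => j _.
  by have := H j; rewrite negbK => /eqP ->; rewrite mul0r.
have U1 : 1 <= `|(U 0 j)%:~R| :> R by rewrite -intr_norm -[1]/(1%:~R) ler_int -gtz0_ge1 normr_gt0.
have : row 0 (ir U) = row 0 (ir U *m G) *m invmx G by rewrite row_mul mulmxK.
move/rowP/(_ j); rewrite 2!mxE => E.
rewrite -[K^-1]mul1r ler_pdivrMr //.
apply: le_trans U1 _; rewrite E mxE (le_trans (ler_norm_sum _ _ _)) //.
rewrite /K mulrDr mulr1 ler_wpDl ?rnorm_ge0 // mulr_sumr; apply: ler_sum => k _.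
rewrite normrM ler_pM ?rnorm_coord // (bigD1 j) //= lerDl sumr_ge0 //.
Qed.

(** Induction on the dimension, in the sup norm: a nearly shortest basis vector is put first, the
    others are projected along its largest coordinate, the projections are reduced recursively, and
    the lifts are corrected by integral multiples of the first vector. *)
Lemma lattice_reduction N : exists2 C : R, 0 < C & forall G : 'M[R]_N, \det G != 0 ->
  exists2 U, unimod U & \prod_i rnorm (row i (ir U *m G)) <= C * `|\det G|.
Proof.
elim: N => [|N [C C0 IH]].
  exists 1 => // G _; exists 1%:M; first by rewrite /unimod det1 normr1.
  by rewrite big_ord0 det_mx00 normr1 mulr1.
exists (4 ^+ N * C) => [|G dG]; first by rewrite mulr_gt0 ?exprn_gt0.
have [c c0 cP] := lattice_first_row dG.
pose S : set R := [set x | exists2 U, unimod U & x = rnorm (row 0 (ir U *m G))]%classic.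
have infS : has_inf S.
  split; last by exists c => x [U uU ->]; exact: cP.
  exists (rnorm (row 0 (ir 1%:M *m G))); exists 1%:M => //.
  by rewrite /unimod det1 normr1.
have cinf : c <= inf S.
  by apply: lb_le_inf; [exact: infS.1|move=> x [U uU ->]; exact: cP].
have inf0 : 0 < inf S := lt_le_trans c0 cinf.
(* The first vector has norm [v] below [3/2] of the infimum, so every possible first row has norm at
   least [2/3 v]. *)
have [v [U0 uU0 vE] vinf] := @inf_adherent _ S (inf S / 2) (divr_gt0 inf0 (ltr0n _ 2)) infS.
have vmin U : unimod U -> 2 / 3 * v <= rnorm (row 0 (ir U *m G)).
  move=> uU; have : inf S <= rnorm (row 0 (ir U *m G)).
    by apply: ge_inf; [exact: infS.2|exists U].
  lra.
have v0 : 0 < v by apply: (lt_le_trans c0); rewrite vE cP.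
have [j0 j0E] := rnorm_max (row 0 (ir U0 *m G)).
(* The largest coordinate moves to column 0, so that the pivot has absolute value [v]. *)
pose H : 'M[R]_(1 + N) := xcol 0 j0 (ir U0 *m G).
have rH i : rnorm (row i H) = rnorm (row i (ir U0 *m G)) by exact: rnorm_xcol.
pose p := H 0 0.
have pv : `|p| = v by rewrite vE j0E /p /H !mxE tpermL.
have p0 : p != 0 by rewrite -normr_gt0 pv.
have dH : `|\det H| = `|\det G|.
  by rewrite /H xcolE !det_mulmx !normrM norm_det_unimod // det_perm normr_sign mulr1 mul1r.
pose r := ursubmx H; pose cv := dlsubmx H; pose D := drsubmx H.
(* The Schur complement of the pivot: the other rows projected along the first one. *)
pose G' := D - p^-1 *: (cv *m r).
have HE : H = block_mx p%:M r cv D.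
  rewrite -[H]submxK; congr block_mx; rewrite [LHS]mx11_scalar; congr (_ %:M).
  by rewrite 2!mxE /p; congr (H _ _); apply: val_inj.
have HF : H = block_mx 1%:M 0 (p^-1 *: cv) 1%:M *m block_mx p%:M r 0 G'.
  rewrite mulmx_block !mul1mx !mul0mx !addr0 -scalemxAl mul_mx_scalar.
  by rewrite scalerA mulVf // scale1r -scalemxAl /G' addrC subrK -HE.
have dHp : \det H = p * \det G'.
  by rewrite HF det_mulmx det_lblock det_ublock !det1 !mul1r det_scalar1.
have dG' : \det G' != 0.
  have : \det H != 0 by rewrite -normr_gt0 dH normr_gt0.
  by rewrite dHp mulf_eq0 negb_or => /andP[].
have [U' uU' U'P] := IH G' dG'.
have [al alE] : exists al : 'cV[R]_N, al = ir U' *m cv by eexists.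
(* Rounding to a nearest integer leaves a multiple [t] of the first row with [|t| <= 1/2]. *)
pose mm : 'cV[int]_N := \col_i Num.floor (al i 0 / p + 1/2).
pose U1 : 'M[int]_(1 + N) := block_mx 1%:M 0 (- mm) U'.
have uU1 : unimod U1 by rewrite /unimod det_lblock det1 mul1r.
exists (U1 *m U0); first exact: unimodM.
have E i : rnorm (row i (ir (U1 *m U0) *m G)) = rnorm (row i (ir U1 *m H)).
  by rewrite map_mxM -mulmxA /H [xcol _ _ _]xcolE [in RHS]mulmxA -xcolE rnorm_xcol.
rewrite (eq_bigr _ (fun i _ => E i)) (@big_ord_recl _ _ _ N) /=.
have U1E : ir U1 = block_mx 1%:M 0 (- ir mm) (ir U').
  by rewrite map_block_mx map_mx1 map_mx0 map_mxN.
have U1H : ir U1 *m H = block_mx p%:M r (al - ir mm *m p%:M) (ir U' *m D - ir mm *m r).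
  by rewrite U1E HE mulmx_block !mul1mx !mul0mx !addr0 !mulNmx ![- _ + _]addrC -alE.
have -> : rnorm (row ord0 (ir U1 *m H)) = v.
  have -> : row ord0 (ir U1 *m H) = row 0 H; last by rewrite rH vE.
  have gen (i : 'I_(1 + N)) j : i = lshift N (0 : 'I_1) -> (ir U1 *m H) i j = H i j.
    move=> ->; rewrite U1H [in RHS]HE.
    by case: (split_ordP j) => k ->; rewrite ?block_mxEul ?block_mxEur.
  apply/rowP => j; rewrite [LHS]mxE [RHS]mxE; apply: gen; exact: val_inj.
(* Any row can be swapped into first place, so its norm [x] is at least [2/3 v]; with
   [x <= y + v / 2] this gives [x <= 4 y], the source of [4 ^+ N]. *)
have key i : rnorm (row (lift ord0 i) (ir U1 *m H)) <= 4 * rnorm (row i (ir U' *m G')).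
  set x := rnorm _; set y := rnorm _.
  have xv : 2 / 3 * v <= x.
    rewrite /x -E; apply: le_trans (vmin (xrow 0 (lift ord0 i) (U1 *m U0)) _) _.
      by apply: unimod_xrow; exact: unimodM.
    suff -> : row 0 (ir (xrow 0 (lift ord0 i) (U1 *m U0)) *m G) = row (lift ord0 i) (ir (U1 *m U0) *m G) by [].
    by rewrite !row_mul; congr (_ *m _); apply/rowP => j; rewrite !mxE tpermL.
  suff : x <= y + v / 2 by lra.
  have y0 : 0 <= y by exact: rnorm_ge0.
  have li : lift ord0 i = rshift 1 i by apply: val_inj.
  pose t := al i 0 / p - (mm i 0)%:~R.
  have t2 : `|t| <= 1 / 2.
    rewrite /t [mm i 0]mxE; have := floor_le_tmp (al i 0 / p + 1 / 2).
    have := floorD1_gt (al i 0 / p + 1 / 2).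
    set f := Num.floor _; rewrite intrD; set ff := (f%:~R : R) => a1 a2.
    by rewrite ler_norml; apply/andP; split; lra.
  apply: rnorm_le => [|j]; first by lra.
  rewrite mxE U1H li; case: (split_ordP j) => k ->.
    rewrite (@block_mxEdl _ 1 N 1 N) mul_mx_scalar (ord1 k).
    have -> : (al - p *: ir mm) i 0 = t * p.
      by rewrite !mxE /t mulrBl divfK // !mxE mulrC.
    rewrite normrM pv; apply: le_trans (_ : 1 / 2 * v <= _); last by lra.
    by rewrite ler_wpM2r // ltW.
  have Eent : (ir U' *m D - ir mm *m r) i k = (ir U' *m G') i k + t * r 0 k.
    rewrite /G' mulmxBr -scalemxAr mulmxA -alE.
    have mr : (ir mm *m r) i k = (mm i 0)%:~R * r 0 k by rewrite [LHS]mxE big_ord1 [ir mm i 0]mxE.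
    have ar : (p^-1 *: (al *m r)) i k = p^-1 * (al i 0 * r 0 k).
      by rewrite [LHS]mxE; congr (_ * _); rewrite [LHS]mxE big_ord1.
    have subE (A B : 'M[R]_N) : (A - B) i k = A i k - B i k by rewrite !mxE.
    rewrite !subE mr ar /t.
    by move: ((ir U' *m D) i k) => W; field.
  rewrite (@block_mxEdr _ 1 N 1 N) Eent (le_trans (ler_normD _ _)) // lerD //.
    by have := rnorm_coord (row i (ir U' *m G')) k; rewrite mxE.
  rewrite normrM mulrC; apply: ler_pM => //; last by lra.
  have := rnorm_coord (row 0 H) (rshift 1 k); rewrite rH -vE [row 0 H 0 _]mxE.
  by congr (`|_| <= _); rewrite [RHS]mxE [RHS]mxE; congr (H _ _); apply: val_inj.
apply: (@le_trans _ _ (v * \prod_i (4 * rnorm (row i (ir U' *m G'))))).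
  rewrite ler_wpM2l ?(ltW v0) //; apply: ler_prod => i _; rewrite rnorm_ge0 /=; exact: key.
rewrite big_split /= prodr_const card_ord -dH dHp normrM pv.
have := ler_wpM2l (ltW v0) (ler_wpM2l (exprn_ge0 N (ler0n R 4)) U'P); lra.
Qed.
End Lattice.

(** * Numerical estimates *)

Section Numerics.
Variable R : realType.

Lemma expR_ge_taylor (x : R) m : 0 <= x -> \sum_(k < m) x ^+ k / k`!%:R <= expR x.
Proof.
move=> x0; rewrite /expR /pseries.
have -> : \sum_(k < m) x ^+ k / k`!%:R = series (exp_coeff x) m.
  by rewrite /series /= big_mkord.
apply: nondecreasing_cvgn_le; last exact: is_cvg_series_exp_coeff.
by apply: nondecreasing_series => k _ _; exact: exp_coeff_ge0.
Qed.

(** The claim is [exp(-0.692) >= 1/2]. Ten halvings of the exponent reduce it to [1 + x <= exp x] at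
    [x = -0.692 / 1024]; the decimals are lower bounds for [exp(-0.692 / 2^k)]. *)
Lemma ln2_ge : 692 / 1000 <= ln 2 :> R.
Proof.
rewrite -ler_expR lnK ?posrE //.
have E : expR (- (692 / 1000)) >= 1 / 2 :> R.
  have sq (a b x : R) : 0 <= a -> b <= a * a -> a <= expR (x / 2) -> b <= expR x.
    move=> a0 ba ax; rewrite [x](_ : _ = x / 2 + x / 2); last by lra.
    by rewrite expRD (le_trans ba) // ler_pM.
  apply: (sq (707 / 1000 + 392 / 1000 / 1000)); [by lra|by lra|].
  apply: (sq (841 / 1000 + 66 / 1000 / 1000)); [by lra|by lra|].
  apply: (sq (917 / 1000 + 97 / 1000 / 1000)); [by lra|by lra|].
  apply: (sq (957 / 1000 + 652 / 1000 / 1000)); [by lra|by lra|].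
  apply: (sq (978 / 1000 + 597 / 1000 / 1000)); [by lra|by lra|].
  apply: (sq (989 / 1000 + 241 / 1000 / 1000)); [by lra|by lra|].
  apply: (sq (994 / 1000 + 606 / 1000 / 1000)); [by lra|by lra|].
  apply: (sq (997 / 1000 + 299 / 1000 / 1000 + 400 / 1000 / 1000 / 1000)); [by lra|by lra|].
  apply: (sq (998 / 1000 + 648 / 1000 / 1000 + 800 / 1000 / 1000 / 1000)); [by lra|by lra|].
  apply: (sq (999 / 1000 + 324 / 1000 / 1000 + 210 / 1000 / 1000 / 1000)); [by lra|by lra|].
  by apply: le_trans (expR_ge1Dx _); lra.
by move: E; rewrite expRN mul1r lef_pV2 // ?posrE ?expR_gt0.
Qed.

Lemma ln2_le : ln 2 <= 693 / 1000 + 2 / 1000 / 10 :> R.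
Proof.
rewrite -ler_expR lnK ?posrE //.
apply: le_trans (expR_ge_taylor 9 _); last by lra.
rewrite !big_ord_recr big_ord0 /= !factS fact0 !natrM; lra.
Qed.

End Numerics.

(** * Positivity of the function governing the recurrence *)

Section Phi.
Variable R : realType.

Definition phi (n D : nat) (w : R) : R :=
  n%:R - 3 - 3 * w + D%:R + 2 * (w + 2) * ((w + 1) / (w + 2)) ^+ D.

(** The logarithm of the left side is [1/s + 1/(12 s^3) + ...], the exponent on the right is
    [1/s + 0.13/s^3 + ...], and [0.13 > 1/12]. The cubic Taylor polynomial of [exp] turns this into
    a polynomial inequality. *)
Lemma ratio_le_expR (s : R) : 3 <= s ->
  (s + 1 / 2) / (s - 1 / 2) <= expR ((s - 13 / 100 / s)^-1).
Proof.
move=> s3; have s0 : 0 < s by lra.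
set x := (s - 13 / 100 / s)^-1.
have c0 : 0 < s - 13 / 100 / s.
  rewrite subr_gt0 ltr_pdivrMr //; nra.
have x0 : 0 < x by rewrite invr_gt0.
apply: le_trans (expR_ge_taylor 4 (ltW x0)).
rewrite !big_ord_recr big_ord0 /= !factS fact0 !natrM !mulr1 !divr1 expr0 expr1 add0r.
rewrite ler_pdivrMr; last by lra.
have xE : x = s / (s ^+ 2 - 13 / 100).
  by rewrite /x; field; rewrite !lt0r_neq0 //; nra.
rewrite xE.
have q0 : 0 < s ^+ 2 - 13 / 100 by nra.
set q := s ^+ 2 - _ in q0 *.
rewrite -subr_ge0.
have -> : (1 + s / q + (s / q) ^+ 2 / 2 + (s / q) ^+ 3 / (3 * 2)) * (s - 1 / 2) - (s + 1 / 2) =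
  ((6 * q ^+ 3 + 6 * s * q ^+ 2 + 3 * s ^+ 2 * q + s ^+ 3) * (s - 1 / 2) - 6 * q ^+ 3 * (s + 1 / 2)) / (6 * q ^+ 3).
  by field; lra.
apply: divr_ge0; last by rewrite mulr_ge0 // exprn_ge0 // ltW.
have -> : (6 * q ^+ 3 + 6 * s * q ^+ 2 + 3 * s ^+ 2 * q + s ^+ 3) * (s - 1 / 2) - 6 * q ^+ 3 * (s + 1 / 2) =
  s ^+ 3 * (7 / 25 * s - 11 / 100 - 78 / 100 / 100) + s ^+ 2 * (78 / 100 / 100 * (s - 1))
  - 3 * (13 / 100) ^+ 2 * s + 6 * (13 / 100) ^+ 3 by rewrite /q; field.
have s2 : 9 <= s ^+ 2 by nra.
have s3' : 0 <= s ^+ 3 * (7 / 25 * s - 11 / 100 - 78 / 100 / 100).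
  by rewrite mulr_ge0 ?exprn_ge0 ?(ltW s0) //; lra.
have : 9 * (78 / 100 / 100 * (s - 1)) <= s ^+ 2 * (78 / 100 / 100 * (s - 1)).
  by rewrite ler_wpM2r //; lra.
lra.
Qed.

(** The term in [r^D] is bounded below by an exponential in [D], and the tangent of slope [-1] to
    that exponential cancels the summand [D]. The point of tangency brings in [ln 2]; there remains
    [n - w (2 - ln 2)] plus a small positive constant. *)
Lemma phi_ge_large n D (w : R) : (6 <= n)%N -> 76 / 100 * n%:R <= w ->
  w * (2 - ln 2) <= n%:R -> 1 / 1000 <= phi n D w.
Proof.
move=> n6 wn nw.
have n6' : 6 <= n%:R :> R by rewrite ler_nat.
have [->|D0] := posnP D.
  by rewrite /phi expr0 mulr1; have := ln2_le R; nra.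
have L1 := ln2_ge R; set L := ln 2 in L1 nw.
pose s := w + 3 / 2; have s6 : 6 + 6 / 100 <= s by rewrite /s; lra.
have s0 : 0 < s by lra.
pose c := s - 13 / 100 / s.
have cs : c * s = s ^+ 2 - 13 / 100 by rewrite /c; field; lra.
have c0 : 0 < c by rewrite -(pmulr_lgt0 _ s0) cs; nra.
have rr : ((w + 1) / (w + 2))^-1 <= expR c^-1.
  rewrite invf_div; have := @ratio_le_expR s; rewrite -/c /s => H.
  have -> : w + 2 = w + 3 / 2 + 1 / 2 by lra.
  have -> : w + 1 = w + 3 / 2 - 1 / 2 by lra.
  by apply: H; rewrite -/s; lra.
set r := (w + 1) / (w + 2) in rr *.
have r0 : 0 < r by rewrite divr_gt0; rewrite /s in s6; lra.
have rE : expR (- c^-1) <= r by rewrite expRN -[r]invrK lef_pV2 // posrE ?expR_gt0 // invr_gt0.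
have D1 : 0 <= D%:R - 1 / 2 :> R.
  by have : 1 <= D%:R :> R; [rewrite ler1n|lra].
(* Squaring turns the half-integral exponent [D - 1/2] into [D + D.-1], and
   [(w + 1) (w + 2) = s^2 - 1/4] is at least [c^2]. *)
have key : 2 * c * expR (- ((D%:R - 1 / 2) / c)) <= 2 * (w + 2) * r ^+ D.
  rewrite -(ler_pXn2r (_ : 0 < 2)%N) ?nnegrE //; last 2 first.
  - by rewrite !mulr_ge0 ?expR_ge0 // ltW.
  - by rewrite !mulr_ge0 ?exprn_ge0 ?(ltW r0) //; rewrite /s in s6; lra.
  have -> : (2 * (w + 2) * r ^+ D) ^+ 2 = 4 * ((w + 1) * (w + 2)) * r ^+ (D + D.-1).
    have -> : (2 * (w + 2) * r ^+ D) ^+ 2 = 4 * (w + 2) ^+ 2 * r ^+ (D + D).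
      by rewrite exprMn -exprM muln2 addnn; ring.
    have -> : (D + D = (D + D.-1).+1)%N by rewrite -addnS prednK.
    rewrite [r ^+ _.+1]exprS; move: (r ^+ (D + D.-1)) => X; rewrite /r; field.
    by rewrite lt0r_neq0 //; rewrite /s in s6; lra.
  have -> : (2 * c * expR (- ((D%:R - 1 / 2) / c))) ^+ 2 = 4 * c ^+ 2 * expR (- c^-1) ^+ (D + D.-1).
    rewrite exprMn -expRM_natl -expRM_natl exprMn; congr (_ * expR _); first by ring.
    rewrite natrD -subn1 natrB //; field; lra.
  apply: ler_pM.
  - by rewrite mulr_ge0 // exprn_ge0 // ltW.
  - by rewrite exprn_ge0 // expR_ge0.
  - rewrite ler_pM2l //.
    have -> : (w + 1) * (w + 2) = s ^+ 2 - 1 / 4 by rewrite /s; field.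
    rewrite -(ler_pM2r (_ : 0 < s ^+ 2)) ?exprn_gt0 // -exprMn cs.
    have s2 : 36 <= s ^+ 2 by nra.
    by move: (s ^+ 2) s2 => q q36; nra.
  - by rewrite lerXn2r ?nnegrE ?expR_ge0 ?(ltW r0).
have tang : c * (1 + L) - D%:R + 1 / 2 <= 2 * c * expR (- ((D%:R - 1 / 2) / c)).
  have -> : 2 * c * expR (- ((D%:R - 1 / 2) / c)) = c * expR (L - (D%:R - 1 / 2) / c).
    by rewrite expRD lnK ?posrE //; ring.
  apply: le_trans (_ : c * (1 + (L - (D%:R - 1 / 2) / c)) <= _).
    have -> // : c * (1 + (L - (D%:R - 1 / 2) / c)) = c * (1 + L) - D%:R + 1 / 2.
    by field; lra.
  by rewrite ler_pM2l // expR_ge1Dx.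
have cE : c = w + 3 / 2 - 13 / 100 / s by [].
have s1 : 13 / 100 / s <= 13 / 606.
  by rewrite ler_pdivrMr //; lra.
rewrite /phi -/r; move: key tang; set A := 2 * (w + 2) * _; set B := 2 * c * _ => key tang.
set u := 13 / 100 / s in cE s1.
have u0 : 0 <= u by rewrite /u divr_ge0 // ltW.
rewrite cE in tang.
have L2 := ln2_le R; rewrite -/L in L2.
suff : 1 / 1000 <= n%:R - 3 - 3 * w + (w + 3 / 2 - u) * (1 + L) + 1 / 2 by lra.
have -> : n%:R - 3 - 3 * w + (w + 3 / 2 - u) * (1 + L) + 1 / 2 =
  (n%:R - w * (2 - L)) + (3 / 2 * L - 1 - u * (1 + L)) by field.
have : u * (1 + L) <= 13 / 606 * (1 + L) by rewrite ler_wpM2r //; lra.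
lra.
Qed.
End Phi.

Section Phi.
Variable R : realType.

(** Binomial expansion of [(1 - 1/(w + 2))^D] in nested form; for [D <= 5] the displayed terms are
    all of them. *)
Lemma phiE5 n D (w : R) : (D <= 5)%N -> 0 <= w ->
  phi n D w = n%:R + 1 - w - D%:R + D%:R * (D%:R - 1) *
    ((w + 2)^-1 - (D%:R - 2) / 3 * ((w + 2)^-1 ^+ 2 - (D%:R - 3) / 4 * ((w + 2)^-1 ^+ 3
      - (D%:R - 4) / 5 * (w + 2)^-1 ^+ 4))).
Proof.
move=> D5 w0; have w2 : w + 2 != 0 by rewrite lt0r_neq0 //; lra.
move: D D5 => [|[|[|[|[|[|//]]]]]] _; rewrite /phi; by field.
Qed.

(** Finitely many pairs [(n, D)], each giving a polynomial inequality in [w] and [u = 1 / (w + 2)].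
    The pair [n = D = 3] is excluded because the bound fails there at the upper end of the range of
    [w]. *)
Lemma phi_ge_small n D (w : R) : (1 < n < 6)%N -> (D <= n)%N -> (n == 3%N) ==> (D <= 2)%N ->
  76 / 100 * n%:R <= w -> w * (2 - ln 2) <= n%:R -> 1 / 1000 <= phi n D w.
Proof.
move=> n6 Dn n3 wn nw.
have w0 : 0 <= w by apply: le_trans wn; rewrite mulr_ge0.
have {}nw : w * (1 + 306 / 1000 + 8 / 1000 / 10) <= n%:R.
  by apply: le_trans nw; rewrite ler_wpM2l //; have := ln2_le R; lra.
have D5 : (D <= 5)%N by move: n6 Dn; lia.
rewrite phiE5 //.
have w2 : 0 < w + 2 by lra.
have uE : (w + 2) * (w + 2)^-1 = 1 by rewrite divff // lt0r_neq0.
move: (w + 2)^-1 uE => u uE.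
have u0 : 0 < u by rewrite -(pmulr_rgt0 _ w2) uE.
move: n n6 Dn n3 wn nw => [|[|[|[|[|[|//]]]]]] //= _.
- move: D D5 => [|[|[|//]]] _ _ _ wn nw.
  + by nra.
  + by nra.
  + by nra.
- move: D D5 => [|[|[|//]]] _ _ _ wn nw.
  + by nra.
  + by nra.
  + by nra.
- move: D D5 => [|[|[|[|[|//]]]]] _ _ _ wn nw.
  + by nra.
  + by nra.
  + by nra.
  + by nra.
  + by nra.
- move: D D5 => [|[|[|[|[|[|//]]]]]] _ _ _ wn nw.
  + by nra.
  + by nra.
  + by nra.
  + by nra.
  + by nra.
  + by nra.
Qed.
End Phi.

Lemma phi_ge (R : realType) n D (w : R) : (1 < n)%N -> (D <= n)%N -> (n == 3%N) ==> (D <= 2)%N ->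
  76 / 100 * n%:R <= w -> w * (2 - ln 2) <= n%:R -> 1 / 1000 <= phi n D w.
Proof.
move=> n1 Dn n3 wn nw; have [n6|n6] := ltnP n 6; last exact: phi_ge_large.
by apply: phi_ge_small; rewrite ?n1.
Qed.

(** * Inconsistency of the logarithmic inequalities *)

Section FinalSystem.
Variables (R : realType) (n d : nat) (w tau : R) (z : nat -> R).
Let eta : R := 1 / 100 / 100.
Let k0 : R := n%:R + 1 - d%:R.
(** In units of [log h], [tau] stands for [log E], [z i] for the logarithm of a norm, and [k0]
    counts factors [h] in the volume. In this section [d] is the degree of [F] itself. *)
Let Z t := k0 + \sum_(i < t) z i.
Hypotheses (n1 : (1 < n)%N) (d0 : (0 < d)%N) (dn : (d <= n)%N).
Hypotheses (wn : 76 / 100 * n%:R <= w) (nw : w * (2 - ln 2) <= n%:R).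
Hypotheses (z0 : z 0%N = 1) (z1 : forall i, (i < d)%N -> 1 <= z i).
Hypothesis det_le : forall t, (t < d)%N ->
  2 * tau <= 2 * (d%:R - t.+1%:R) + Z t.+1 + (w + 1) * z t + eta.
Hypothesis vol_le : Z d <= tau + eta.
Hypothesis sylv_le : 3 * tau <= n%:R + d%:R + 2 * w + 2 + eta.

Lemma w_ge0 : 0 <= w. Proof. by apply: le_trans wn; rewrite mulr_ge0. Qed.
Let rho := (w + 1) / (w + 2).
Lemma rho_ge0 : 0 <= rho. Proof. by have := w_ge0 => w0; rewrite divr_ge0 //; lra. Qed.
Let tau' := tau - eta / 2.
Let v D : R := n%:R + 3 + 2 * w + D%:R - 2 * tau'.

(** The deviation of [Z t] from the affine sequence for which the determinant inequalities are
    equalities. *)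
Let U t := Z t - (2 * tau' - 2 * d%:R - 2 * (w + 1)) - 2 * t%:R.

Lemma U_step t : (t < d)%N -> rho * U t <= U t.+1.
Proof.
have w0 := w_ge0; move=> td; have := det_le td.
have ZS : Z t.+1 = Z t + z t by rewrite /Z big_ord_recr /= addrA.
rewrite /U ZS /rho mulrAC ler_pdivrMr; last by lra.
rewrite -[t.+1]addn1 natrD /tau'; move: (Z t) (z t) => a b; rewrite -subr_ge0 => H.
rewrite -subr_ge0; apply: le_trans H _; rewrite le_eqVlt; apply/orP; left; apply/eqP; by field.
Qed.

Lemma U_iter t k : (t + k <= d)%N -> rho ^+ k * U t <= U (t + k).
Proof.
elim: k => [|k IH] tk; first by rewrite addn0 expr0 mul1r.
rewrite addnS exprS -mulrA; apply: le_trans (U_step _); last by rewrite addnS in tk.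
by rewrite ler_wpM2l ?rho_ge0 // IH //; rewrite addnS in tk; apply: ltnW.
Qed.

(** [v D] is the lower bound for [U (d - D)] that follows from [z i >= 1], and the volume bound
    limits [U d] from above; [D] steps of the recurrence link the two. *)
Lemma v_bound D : (D <= d)%N -> tau' - 2 * (w + 1) + rho ^+ D * v D <= 3 / 2 * eta.
Proof.
have w0 := w_ge0; move=> Dd; have := @U_iter (d - D) D; rewrite subnK // leqnn => /(_ isT) H.
have Ud : U d <= 3 / 2 * eta - tau' + 2 * (w + 1).
  by rewrite /U /tau'; move: vol_le; lra.
have UD : v D <= U (d - D).
  have : k0 + (d - D)%:R <= Z (d - D).
    rewrite /Z lerD2l -[leLHS]mulr1 mulr_natl.
    have {1}-> : (d - D)%N = #|'I_(d - D)| by rewrite card_ord.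
    rewrite -sumr_const; apply: ler_sum => i _; apply: z1.
    by rewrite (leq_trans (ltn_ord i)) // leq_subr.
  by rewrite /U /v /k0 natrB //; lra.
have := le_trans (ler_wpM2l (exprn_ge0 D rho_ge0) UD) H; lra.
Qed.

Lemma final_system_inconsistent : False.
Proof.
have w0 := w_ge0; have L2 := ln2_le R; have n2 : 2 <= n%:R :> R by rewrite ler_nat.
have wL : w * (1306 / 1000) <= n%:R by apply: le_trans nw; rewrite ler_wpM2l //; lra.
have wn1 : w <= n%:R by lra.
have eta0 : 0 < eta by rewrite /eta; lra.
have H0 := v_bound (leq0n d).
rewrite expr0 mul1r in H0.
(* The determinant inequality at [t = 0], where [z 0 = 1], makes [v] reach [w + 2] at [d]. As [v]
   grows by 1 at each step, some [D < d] satisfies [w + 1 <= v D < w + 2]. *)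
have vd : w + 2 <= v d.
  have := det_le d0; rewrite /Z big_ord1 z0 /v /tau' /k0; lra.
pose P D := w + 1 <= v D.
have exP : exists D, P D by exists d; rewrite /P; lra.
case: (ex_minnP exP) => D PD minD.
have Dd' : (D <= d)%N by apply: minD; rewrite /P; lra.
have vS k : v k.+1 = v k + 1 by rewrite /v -[k.+1]addn1 natrD addrA; lra.
have vD2 : v D < w + 2.
  case: D PD minD Dd' => [|D] PD minD Dd'.
    by move: H0; rewrite /v /eta; lra.
  rewrite vS; suff : v D < w + 1 by lra.
  by rewrite ltNge; apply/negP => /minD; rewrite ltnn.
have Dd : (D < d)%N by rewrite ltn_neqAle Dd' andbT; apply: contraTneq vd => <-; rewrite -ltNge.
have HD := v_bound Dd'.
have vE : 2 * tau' = n%:R + 3 + 2 * w + D%:R - v D by rewrite /v; lra.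
(* Here [phi 3 3 w] would be called for, which has no positive lower bound. The degree is then 3,
   and [sylv_le] gives [v 2 >= (8 + 2 w) / 3], which suffices. *)
have [/andP[/eqP n3 /eqP D2]|nD] := boolP ((n == 3%N) && (D == 2%N)).
  have d3 : d = 3%N by apply/eqP; rewrite eqn_leq; move: dn Dd; rewrite n3 D2 => -> ->.
  move: HD PD vE vD2 wn wL sylv_le; rewrite /rho /P D2 n3 d3 /tau' => HD PD vE vD2 wn' wL' syl.
  have wu : w <= 2 + 298 / 1000 by lra.
  set V := v 2 in HD PD vE vD2 *.
  have Vl : (8 + 2 * w) / 3 <= V by lra.
  have r2 : 1 / 2 + 8 / 100 <= ((w + 1) / (w + 2)) ^+ 2.
    rewrite expr_div_n ler_pdivlMr ?exprn_gt0 //; last by lra.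
    by nra.
  move: r2 HD; set r := _ ^+ 2 => r2 HD.
  have : (r - 1 / 2) * ((8 + 2 * w) / 3) <= (r - 1 / 2) * V by rewrite ler_wpM2l //; lra.
  have : 8 / 100 * ((8 + 2 * w) / 3) <= (r - 1 / 2) * ((8 + 2 * w) / 3) by rewrite ler_wpM2r //; lra.
  rewrite /eta in HD *; lra.
have p1 : 1 / 1000 <= phi n D w.
  apply: phi_ge => //; first by apply: leq_trans dn; apply: ltnW.
  by apply/implyP => /eqP n3; have := leq_trans Dd dn; rewrite n3 ltnS.
have p2 : 1 / 1000 <= phi n D.+1 w.
  apply: phi_ge => //; first exact: leq_trans dn.
  apply/implyP => /eqP n3; have := leq_trans Dd dn; rewrite n3 ltnS => D2.
  by move: nD; rewrite n3 eqxx andTb => nD; rewrite leq_eqVlt (negbTE nD) in D2.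
move: p1 p2; rewrite /phi -/rho exprS -[D.+1]addn1 natrD.
have -> : 2 * (w + 2) * (rho * rho ^+ D) = 2 * (w + 1) * rho ^+ D.
  by rewrite /rho; field; rewrite lt0r_neq0 //; lra.
move: (rho ^+ D) HD => r HD p1 p2.
(* Weighting [phi n D w] by [th] and [phi n D.+1 w] by [1 - th] produces exactly the term
   [2 rho^D (v D)] bounded by [HD]. *)
pose th := v D - w - 1.
have th0 : 0 <= th by rewrite /th; move: PD; rewrite /P; lra.
have th1 : 0 <= 1 - th by rewrite /th; lra.
have := lerD (ler_wpM2l th0 p1) (ler_wpM2l th1 p2).
set A := (X in _ <= X -> _); have -> : A = n%:R + 3 + 2 * w + D%:R - v D - 4 * (w + 1) + 2 * r * v D.
  by rewrite /A /th; ring.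
have HD' : 2 * tau' - 4 * (w + 1) + 2 * (r * v D) <= 3 * eta by lra.
rewrite vE /eta in HD'; lra.
Qed.
End FinalSystem.

(** * Derivatives of integer polynomials at a badly approximable point *)

Lemma l1_int_mul_le (p q : {poly int}) m :
  (size (p * q)%R <= m)%N -> l1 p * l1 q <= m.*2%:R ^+ m * l1 (p * q).
Proof.
move=> sz; rewrite -(ler_int algC) !intrM rmorphXn /= rmorph_nat -!l1_map rmorphM /=.
by apply: l1_mul_le; rewrite -rmorphM size_map_inj_poly //; apply: intr_inj.
Qed.

(** The logarithmic derivative is the sum of the [1 / (x - a)], each of absolute value at most
    [M]. *)
Lemma norm_deriv_prod_XsubC (K : numFieldType) (rs : seq K) (x M : K) :
  0 <= M -> (forall a, a \in rs -> 1 <= M * `|x - a|) ->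
  `|(\prod_(a <- rs) ('X - a%:P))^`().[x]| <=
    (size rs)%:R * M * `|(\prod_(a <- rs) ('X - a%:P)).[x]|.
Proof.
move=> M0; elim: rs => [|a rs IH] H.
  by rewrite !big_nil derivC horner0 normr0 !mul0r.
rewrite !big_cons derivM derivXsubC mul1r.
set q := \prod_(j <- rs) _ in IH *.
have {}IH : `|q^`().[x]| <= (size rs)%:R * M * `|q.[x]|.
  by apply: IH => b brs; apply: H; rewrite in_cons brs orbT.
rewrite hornerD !hornerM hornerXsubC (le_trans (ler_normD _ _)) // !normrM.
have H1 := H a (mem_head _ _).
apply: (@le_trans _ _ (M * `|x - a| * `|q.[x]| + `|x - a| * ((size rs)%:R * M * `|q.[x]|))).
  by rewrite lerD ?ler_wpM2l // -[leLHS]mul1r ler_wpM2r.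
by rewrite /= -[(size rs).+1]addn1 natrD le_eqVlt; apply/orP; left; apply/eqP; ring.
Qed.

Lemma toQ_ratr (K : numFieldType) (p : {poly int}) :
  map_poly (@ratr K) (toQ p) = map_poly intr p.
Proof. by rewrite -map_poly_comp; apply: eq_map_poly => z /=; rewrite ratr_int. Qed.

Lemma map_intr_eq0 (K : numDomainType) (p : {poly int}) :
  (map_poly (intr : int -> K) p == 0) = (p == 0).
Proof. by rewrite -!size_poly_eq0 size_map_inj_poly //; apply: intr_inj. Qed.

Lemma int_root_algebraic (K : numFieldType) (x : K) (p : {poly int}) :
  p != 0 -> root (map_poly intr p) x -> algebraic x.
Proof. by move=> p0 px; exists (toQ p); rewrite ?map_intr_eq0 // toQ_ratr. Qed.

(** Divisibility over the rationals descends to the integers because the minimal polynomial is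
    primitive. *)
Lemma minpolyZ_dvd (K : numFieldType) (x : K) (p : {poly int}) :
  p != 0 -> root (map_poly intr p) x -> exists r, p = minpolyZ x * r.
Proof.
move=> p0 px; have [mx irm cm lm] := minpolyZP (int_root_algebraic p0 px).
set m := minpolyZ x in mx irm cm lm *.
have : m %| p.
  rewrite -dvdp_rat_int; apply/negPn/negP => nd.
  have : coprimep (toQ m) (toQ p).
    by rewrite irreducible_poly_coprime //; apply/irreducible_rat_int.
  rewrite -(coprimep_map (@ratr K)) !toQ_ratr => /coprimep_root /(_ mx).
  by rewrite (rootP px) eqxx.
case/dvdpP_int => r ->; exists r; congr (_ * r).
by rewrite [RHS]zpolyEprim cm scale1r.
Qed.

Lemma naive_height_le (K : numFieldType) (x : K) :
  ((naive_height x)%:R <= l1 (minpolyZ x) :> int).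
Proof.
rewrite /naive_height; elim/big_ind: _ => [|a b ha hb|i _]; first exact: l1_ge0.
  by rewrite /maxn; case: ifP.
by rewrite natz abszE l1_coef.
Qed.

Lemma naive_height_gt0 (K : numFieldType) (x : K) : algebraic x -> (0 < naive_height x)%N.
Proof.
move=> /minpolyZP[_ irm _ _]; have m0 := irredp_neq0 irm.
rewrite lt0n; apply: contraNneq m0 => h0; apply/eqP/polyP => i; rewrite coef0.
have [lti|] := ltnP i (size (minpolyZ x)); last exact: nth_default.
apply/eqP; rewrite -absz_eq0 -leqn0 -h0.
exact: (@leq_bigmax _ (fun i : 'I_(size (minpolyZ x)) => `|((minpolyZ x)`_i)%R|%N) (Ordinal lti)).
Qed.

(** The minimal polynomial divides [p], and the integral cofactor has norm at least 1 in Gelfond's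
    inequality. *)
Lemma root_degree_height (K : numFieldType) (x : K) (p : {poly int}) n :
  p != 0 -> (size p <= n.+1)%N -> root (map_poly intr p) x ->
  (alg_degree x <= n)%N /\ (naive_height x)%:R <= n.+1.*2%:R ^+ n.+1 * l1 p.
Proof.
move=> p0 sp px; have [r pE] := minpolyZ_dvd p0 px.
have r0 : r != 0 by apply: contraNneq p0 => r0; rewrite pE r0 mulr0.
have m0 : minpolyZ x != 0 by apply: contraNneq p0 => r0'; rewrite pE r0' mul0r.
split.
  rewrite /alg_degree -ltnS (leq_trans _ sp) //.
  rewrite pE size_mul // prednK ?size_poly_gt0 //.
  by move: r0; rewrite -size_poly_gt0; case: (size r) => // k _; rewrite addnS leq_addr.
apply: le_trans (naive_height_le x) _.
have sz : (size (minpolyZ x * r)%R <= n.+1)%N by rewrite -pE.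
have := l1_int_mul_le sz; rewrite -pE; apply: le_trans.
by rewrite ler_peMr ?l1_ge0 // l1_int_ge1.
Qed.

Section DerivBound.
Variables (R : realType) (n : nat) (xi : R).
Hypothesis hxi : transcendental xi.

Definition polyval (p : {poly int}) : R := (map_poly intr p).[xi].
Definition derivval (p : {poly int}) : R := (map_poly intr p)^`().[xi].

Lemma polyval_neq0 p : p != 0 -> polyval p != 0.
Proof. by move=> p0; apply/negP => px; apply: hxi; exact: (int_root_algebraic p0). Qed.

Lemma pos_lower_bound (T : eqType) (f : T -> R) (s : seq T) :
  (forall x, x \in s -> 0 < f x) ->
  exists2 c, 0 < c <= 1 & forall x, x \in s -> c <= f x.
Proof.
elim: s => [|a s IH] H; first by exists 1; rewrite ?ltr01 ?lexx.
have [|c /andP[c0 c1] cs] := IH; first by move=> x xs; apply: H; rewrite in_cons xs orbT.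
have fa := H a (mem_head _ _).
exists (Num.min c (f a)); first by rewrite lt_min c0 fa ge_min c1.
move=> x; rewrite in_cons => /predU1P[->|/cs cx]; first by rewrite ge_min lexx orbT.
by rewrite ge_min cx.
Qed.

Definition cdist (a : R[i]) : R := complex.Re `|xi%:C%C - a|.

Lemma cdistE a : `|xi%:C%C - a| = (cdist a)%:C%C.
Proof. by rewrite /cdist normc_def. Qed.

Lemma normcR (r : R) : `|r%:C%C| = `|r|%:C%C.
Proof. by rewrite normc_def /= expr0n addr0 sqrtr_sqr. Qed.

Lemma real_algebraic : algebraic (xi%:C%C : R[i]) -> algebraic xi.
Proof.
move=> [p p0 px]; exists p => //; move: px; rewrite /root.
have -> : map_poly (@ratr R[i]) p = map_poly (real_complex R) (map_poly (@ratr R) p).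
  rewrite -map_poly_comp; apply: eq_map_poly => q /=.
  by rewrite [RHS](fmorph_rat (real_complex R)).
by rewrite horner_map fmorph_eq0.
Qed.

Lemma cdist_gt0 a : algebraic a -> 0 < cdist a.
Proof.
move=> aa; rewrite -ltcR -cdistE normr_gt0 subr_eq0.
by apply/eqP => E; apply: hxi; apply: real_algebraic; rewrite E.
Qed.

(** Outside the finite set the bound holds with constant 1; the finitely many exceptions lie at
    positive distance from the transcendental [xi] and are absorbed into [c]. *)
Lemma cdist_ge (w : R) : 0 < w -> finite_set (good_approx n xi w) ->
  exists2 c, 0 < c & forall a, algebraic a -> (alg_degree a <= n)%N ->
    c * (naive_height a)%:R `^ (- w - 1) <= cdist a.
Proof.
move=> w0 /finite_seqP[X XE].
have XP a : a \in X -> good_approx n xi w a by rewrite XE.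
have [|c /andP[c0 c1] cX] := @pos_lower_bound _ cdist X.
  by move=> a /XP[aa _ _]; exact: cdist_gt0.
exists c => // a aa da.
have h1 : 1 <= (naive_height a)%:R :> R by rewrite ler1n naive_height_gt0.
have [aX|naX] := boolP (a \in X).
  apply: le_trans (cX a aX); rewrite -[leRHS]mulr1 ler_wpM2l ?(ltW c0) //.
  by rewrite -[leRHS](powRr0 (naive_height a)%:R) ler_powR //; lra.
have /ltW H : (naive_height a)%:R `^ (- w - 1) < cdist a.
  rewrite ltNge; apply/negP => H; move/negP: naX; apply.
  suff : good_approx n xi w a by rewrite XE.
  split=> //; apply/andP; split; first by rewrite cdistE ltcR cdist_gt0.
  by rewrite cdistE lecR.
by apply: le_trans H; rewrite -[leRHS]mul1r ler_wpM2r ?powR_ge0.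
Qed.

(** All complex roots of [p] have degree at most [n] and height [<< l1 p], so they lie at distance
    [>> l1(p)^(-w-1)] from [xi]; this bounds the logarithmic derivative. *)
Lemma deriv_bound (w : R) : 0 < w -> finite_set (good_approx n xi w) ->
  exists2 C, 1 <= C & forall p : {poly int}, p != 0 -> (size p <= n.+1)%N ->
    `|derivval p| <= C * `|polyval p| * ((l1 p)%:~R `^ (w + 1)).
Proof.
move=> w0 /(cdist_ge w0)[c c0 cP].
pose K : R := n.+1.*2%:R ^+ n.+1.
have K0 : 0 < K by rewrite exprn_gt0.
pose C := 1 + n%:R * (c^-1 * K `^ (w + 1)).
exists C => [|p p0 sp].
  by rewrite lerDl !mulr_ge0 ?powR_ge0 // invr_ge0 ltW.
have l0 : 0 < (l1 p)%:~R :> R by rewrite ltr0z l1_gt0.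
pose M : R := c^-1 * (K * (l1 p)%:~R) `^ (w + 1).
have M0 : 0 <= M by rewrite mulr_ge0 ?powR_ge0 // invr_ge0 ltW.
pose pc : {poly R[i]} := map_poly intr p.
have pcE : pc = map_poly (real_complex R) (map_poly intr p).
  by rewrite /pc -map_poly_comp; apply: eq_map_poly => z /=; rewrite rmorph_int.
have pc0 : pc != 0 by rewrite map_intr_eq0.
have [rs rsE] := closed_field_poly_normal pc.
have rsP a : a \in rs -> 1 <= M%:C%C * `|xi%:C%C - a|.
  move=> ars; have ra : root pc a.
    by rewrite rsE rootZ ?lead_coef_eq0 // root_prod_XsubC.
  have [da ha] := root_degree_height p0 sp ra.
  have aa := int_root_algebraic p0 ra.
  rewrite cdistE -rmorphM /= -[1]/(1%:C%C) lecR.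
  have := cP a aa da; rewrite -[_ - 1]opprD powRN.
  set h := (naive_height a)%:R.
  have h0 : 0 < h by rewrite ltr0n naive_height_gt0.
  have hw : 0 < h `^ (w + 1) by rewrite powR_gt0.
  rewrite ler_pdivrMr // => H.
  have hK : h `^ (w + 1) <= (K * (l1 p)%:~R) `^ (w + 1).
    rewrite ge0_ler_powR ?nnegrE ?(ltW h0) ?mulr_ge0 ?(ltW K0) ?(ltW l0) //; first lra.
    have := ha; by rewrite -(ler_int R) intrM rmorphXn /= !rmorph_nat.
  have cd : 0 <= cdist a by apply: ltW; apply: cdist_gt0.
  rewrite /M -mulrA ler_pdivlMl // mulr1 mulrC.
  by apply: le_trans H _; rewrite ler_wpM2l.
have MC : 0 <= M%:C%C by rewrite ler0c.
have := ler_wpM2l (normr_ge0 (lead_coef pc)) (norm_deriv_prod_XsubC MC rsP).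
rewrite mulrCA -!normrM -!hornerZ -derivZ -rsE.
have -> : pc.[xi%:C%C] = (polyval p)%:C%C by rewrite pcE horner_map.
have -> : pc^`().[xi%:C%C] = (derivval p)%:C%C by rewrite pcE deriv_map horner_map.
rewrite !normcR -[_%:R](rmorph_nat (real_complex R)) -!rmorphM /= lecR => /le_trans; apply.
have srs : (size rs <= n)%N.
  have : (size pc <= n.+1)%N by rewrite (leq_trans (size_poly _ _)).
  by rewrite rsE size_scale ?lead_coef_eq0 // size_prod_XsubC.
apply: (@le_trans _ _ (n%:R * M * `|polyval p|)).
  by rewrite !ler_wpM2r // ler_nat.
rewrite [leRHS]mulrAC ler_wpM2r // /M powRM ?(ltW K0) ?(ltW l0) // !mulrA ler_wpM2r ?powR_ge0 //.
by rewrite /C !mulrA lerDr.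
Qed.
End DerivBound.

(** * Determinant inequalities *)

Section Inequalities.
Variables (R : realType) (n : nat) (xi w C0 : R).
Hypotheses (hxi : transcendental xi) (w0 : 0 <= w) (C01 : 1 <= C0).
Local Notation ev := (polyval xi).
Local Notation dev := (derivval xi).
Local Notation L1 p := ((l1 p)%:~R : R).
Hypothesis hder : forall p : {poly int}, p != 0 -> (size p <= n.+1)%N ->
  `|dev p| <= C0 * `|ev p| * (L1 p `^ (w + 1)).

Let X0 : R := 1 + `|xi|.
Let X01 : 1 <= X0. Proof. by rewrite lerDl. Qed.
(** [K] absorbs the cost of multiplying by [X^j] with [j <= 2n]; [C1] absorbs all constants of a
    determinant of size at most [2n]. *)
Let K : R := (n.*2%:R + C0) * X0 ^+ n.*2.
Let C1 : R := (n.*2)`!%:R * (X0 ^+ (n.*2 * n.*2) * K ^+ n.*2).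

Lemma K_ge1 : 1 <= K.
Proof.
rewrite -[1]mulr1 ler_pM //; last by rewrite exprn_ege1.
by rewrite (le_trans C01) // lerDr.
Qed.

Lemma C1_gt0 : 0 < C1.
Proof.
have K0 := lt_le_trans ltr01 K_ge1; have X00 := lt_le_trans ltr01 X01.
by rewrite !mulr_gt0 ?exprn_gt0 // ltr0n fact_gt0.
Qed.

Lemma L1_ge1 (p : {poly int}) : p != 0 -> 1 <= L1 p.
Proof. by move=> p0; rewrite -[1]/(1%:~R) ler_int l1_int_ge1. Qed.

Lemma ev_XnM j p : (j <= n.*2)%N -> `|ev ('X^j * p)| <= X0 ^+ n.*2 * `|ev p|.
Proof.
move=> jn; rewrite /polyval rmorphM /= map_polyXn hornerM hornerXn normrM ler_wpM2r //.
rewrite normrX; apply: (@le_trans _ _ (X0 ^+ j)); last by rewrite ler_weXn2l.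
by rewrite lerXn2r ?nnegrE // ?(le_trans ler01 X01) // /X0 lerDr.
Qed.

Lemma dev_XnM j p : (j <= n.*2)%N ->
  `|dev ('X^j * p)| <= X0 ^+ n.*2 * (n.*2%:R * `|ev p| + `|dev p|).
Proof.
move=> jn; rewrite /derivval /polyval rmorphM /= map_polyXn derivM hornerD !hornerM hornerXn.
have Xj k : (k <= n.*2)%N -> `|xi ^+ k| <= X0 ^+ n.*2.
  move=> kn; rewrite normrX; apply: (@le_trans _ _ (X0 ^+ k)); last by rewrite ler_weXn2l.
  by rewrite lerXn2r ?nnegrE // ?(le_trans ler01 X01) // /X0 lerDr.
rewrite (le_trans (ler_normD _ _)) // !normrM mulrDr lerD ?ler_wpM2r ?Xj //.
rewrite mulrA ler_wpM2r // derivXn hornerMn hornerXn -mulr_natr normrM normr_nat.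
by rewrite ler_pM ?Xj ?ler_nat // (leq_trans (leq_pred _)).
Qed.

(** The derivative of [X^j p] at [xi] involves [p(xi)] and [p'(xi)], and [hder] reduces the latter
    to the former. *)
Lemma XnM_bounds j (p : {poly int}) (E v u : R) : (j <= n.*2)%N -> p != 0 -> (size p <= n.+1)%N ->
  0 < E -> L1 p <= v -> E * `|ev p| <= v -> v <= u ->
  [/\ L1 ('X^j * p) <= K * v, `|ev ('X^j * p)| <= K * v * E^-1
    & `|dev ('X^j * p)| <= K * v * (u `^ (w + 1) * E^-1)].
Proof.
move=> jn p0 sp E0 lv evv vu.
have l1p := L1_ge1 p0; have v1 : 1 <= v := le_trans l1p lv.
have v0 : 0 <= v by lra.
have K1 := K_ge1; have X00 : 0 <= X0 ^+ n.*2 by rewrite exprn_ge0 // (le_trans ler01 X01).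
have evE : `|ev p| <= v * E^-1 by rewrite ler_pdivlMr // mulrC.
have Ei : 0 <= E^-1 by rewrite invr_ge0 ltW.
have XK : X0 ^+ n.*2 <= K.
  rewrite /K -[leLHS]mul1r ler_wpM2r // (le_trans C01) // lerDr //.
have vE0 : 0 <= v * E^-1 by rewrite mulr_ge0.
split.
- by rewrite l1XnM (le_trans lv) // -[leLHS]mul1r ler_wpM2r.
- rewrite (le_trans (ev_XnM p jn)) // -mulrA; exact: ler_pM.
- have lu : L1 p `^ (w + 1) <= u `^ (w + 1).
    by apply: ge0_ler_powR; rewrite ?nnegrE ?(le_trans ler01 l1p) ?(le_trans lv) ?(le_trans v0 vu) // addr_ge0.
  have u1 : 1 <= u `^ (w + 1).
    have e1 : 1 `^ (w + 1) = 1 :> R by rewrite powR1.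
    rewrite (le_trans _ lu) // -[leLHS]e1.
    by apply: ge0_ler_powR; rewrite ?nnegrE ?(le_trans ler01 l1p) // addr_ge0.
  rewrite (le_trans (dev_XnM p jn)) // /K.
  have -> : (n.*2%:R + C0) * X0 ^+ n.*2 * v * (u `^ (w + 1) * E^-1) =
     X0 ^+ n.*2 * ((n.*2%:R + C0) * (v * E^-1 * u `^ (w + 1))) by ring.
  rewrite ler_wpM2l // mulrDl lerD //.
    by rewrite ler_wpM2l // (le_trans evE) // ler_peMr.
  rewrite (le_trans (hder p0 sp)) // -mulrA ler_wpM2l ?(le_trans ler01 C01) //.
  by rewrite ler_pM // powR_ge0.
Qed.

Lemma det_constant N (Q : 'I_N -> {poly int}) (v : 'I_N -> R) (e0 e1 P : R) :
  (1 < N <= n.*2)%N ->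
  (forall i, size (Q i) <= N)%N -> \det (coef_mx N Q) != 0 -> 0 <= e0 -> 0 <= e1 ->
  (forall i, L1 (Q i) <= K * v i) -> (forall i, `|ev (Q i)| <= K * v i * e0) ->
  (forall i, `|dev (Q i)| <= K * v i * e1) -> (forall i, 0 <= v i) -> \prod_i v i <= P ->
  1 <= C1 * (e0 * e1 * P).
Proof.
case: N Q v => [|[|m]] // Q v /andP[_ mn] sQ dQ e00 e10 b0 b1 b2 v0 vP.
have K1 := K_ge1.
apply: le_trans (int_poly_det_bound sQ dQ e00 e10 b0 b1 b2) _.
rewrite big_split /= prodr_const card_ord /C1 -/X0.
have X00 : 0 <= X0 by rewrite (le_trans ler01 X01).
have K0 : 0 <= K by rewrite (le_trans ler01 K1).
have e01 : 0 <= e0 * e1 by exact: mulr_ge0.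
have PV : 0 <= \prod_i v i by apply: prodr_ge0 => i _.
have -> : (n.*2)`!%:R * (X0 ^+ (n.*2 * n.*2) * K ^+ n.*2) * (e0 * e1 * P) =
  (n.*2)`!%:R * (X0 ^+ (n.*2 * n.*2) * (e0 * e1 * (K ^+ n.*2 * P))) by ring.
have KV : 0 <= K ^+ m.+2 * \prod_i v i by rewrite mulr_ge0 ?exprn_ge0.
have EKV : 0 <= e0 * e1 * (K ^+ m.+2 * \prod_i v i) by rewrite mulr_ge0.
apply: ler_pM => //; first by rewrite mulr_ge0 ?exprn_ge0.
  by rewrite ler_nat leq_fact.
apply: ler_pM => //; first exact: exprn_ge0.
  rewrite ler_weXn2l //; apply: leq_mul; first exact: ltnW.
  by rewrite (leq_trans _ mn) // leqW.
rewrite ler_wpM2l // ler_pM ?exprn_ge0 //.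
by rewrite ler_weXn2l.
Qed.

(** The determinant of the overview, with indices from 0: it uses [G 0, ..., G t], the shift
    [J = d - t], and [n - t] multiples of [F], in total [n - t + d + 1] polynomials of degree less
    than this number. *)
Lemma det_ineq d (F : {poly int}) (G : nat -> {poly int}) (E h : R) (z : nat -> R) t :
  irreducible_poly F -> size F = d.+2 -> (d < n)%N -> 1 <= E ->
  L1 F <= h -> E * `|ev F| <= h -> h <= z 0%N ->
  (forall i j, (i <= j <= d)%N -> z i <= z j) ->
  (forall i, (i <= d)%N -> [/\ (size (G i) <= n.+1)%N, L1 (G i) <= z i & E * `|ev (G i)| <= z i]) ->
  row_free (seq_mx (fun i => res d (toQ F) (toQ (G i))) d.+1) -> (t <= d)%N ->
  1 <= C1 * (E^-1 * (z t `^ (w + 1) * E^-1) *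
        (h ^+ (n - t) * (z 0%N ^+ (d - t) * \prod_(i < t.+1) z i))).
Proof.
move=> irrF sF dn E1 F1 F2 hz zz GP fr td.
have irrQ : irreducible_poly (toQ F) by apply/irreducible_rat_int.
have sFQ : size (toQ F) = d.+2 by rewrite size_map_inj_poly //; apply: intr_inj.
have F0 := irredp_neq0 irrF.
have E0 : 0 < E := lt_le_trans ltr01 E1.
have h1 : 1 <= h := le_trans (L1_ge1 F0) F1.
pose J := (d - t)%N; have tJ : (t + J = d)%N by rewrite subnKC.
have G0 i : (i <= d)%N -> G i != 0.
  move=> id; apply/eqP => Gi.
  have : row (Ordinal (id : (i < d.+1)%N)) (seq_mx (fun i => res d (toQ F) (toQ (G i))) d.+1) != 0.
    apply/eqP => r0; have := row_free_inj fr (_ : delta_mx 0 (Ordinal (id : (i < d.+1)%N)) *m _ = (0 : 'rV_d.+1) *m _).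
    rewrite -rowE r0 mul0mx => /(_ erefl)/rowP/(_ (Ordinal (id : (i < d.+1)%N))).
    by rewrite !mxE !eqxx => /eqP; rewrite oner_eq0.
  by rewrite rowK /= Gi rmorph0 /res mod0p linear0 eqxx.
have frt : row_free (seq_mx (fun i => res d (toQ F) (toQ (G i))) t.+1).
  apply: inj_row_free => u; rewrite mulmx_sum_row => H.
  have [le] : (t.+1 <= d.+1)%N by [].
  pose u' : 'rV[rat]_d.+1 := \row_i (if insub (nat_of_ord i) is Some j then u 0 j else 0).
  have : u' *m seq_mx (fun i => res d (toQ F) (toQ (G i))) d.+1 = 0 *m seq_mx (fun i => res d (toQ F) (toQ (G i))) d.+1.
    rewrite mul0mx mulmx_sum_row -[RHS]H.
    rewrite [RHS](eq_bigr (fun i : 'I_t.+1 => (fun k : nat => (if insub k is Some j then u 0 j else 0) *: res d (toQ F) (toQ (G k))) i)); last first.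
      by move=> i _; rewrite rowK valK.
    rewrite [RHS](big_ord_widen d.+1 (fun k : nat => (if insub k is Some j then u 0 j else 0) *: res d (toQ F) (toQ (G k))) (td : (t.+1 <= d.+1)%N)).
    rewrite [RHS]big_mkcond /=; apply: eq_bigr => i _; rewrite rowK !mxE.
    by case: ifP => // nlt; rewrite insubF ?nlt // scale0r.
  move/(row_free_inj fr)/rowP => u'0; apply/rowP => j; rewrite mxE.
  have jd : (j < d.+1)%N by rewrite (leq_trans (ltn_ord j)).
  by have := u'0 (Ordinal jd); rewrite !mxE /= valK.
have [c [frc c1 c2]] := select_multiples irrQ sFQ (eq_leq tJ) frt.
rewrite (_ : (J + t).+1 = d.+1) in frc; last by rewrite addnC tJ.
have Jt : (J + t = d)%N by rewrite addnC.
pose Q k := 'X^((c k).1) * G (c k).2.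
have c2d k : (k <= d)%N -> ((c k).2 <= d)%N.
  by move=> kd; rewrite (leq_trans (c2 k _)) ?Jt // (leq_trans (leq_subr _ _)).
have c1d k : (k <= d)%N -> ((c k).1 <= J)%N by move=> kd; rewrite c1 ?Jt.
pose a := (n - t)%N.
have Nle : (a + d.+1 <= n.*2)%N by rewrite /a; move: td dn; clear; lia.
have N1 : (1 < a + d.+1)%N by rewrite /a; move: td dn; clear; lia.
have frQ : row_free (seq_mx (fun k => res d (toQ F) (toQ (Q k))) d.+1).
  rewrite (_ : seq_mx _ _ = seq_mx (fun k => res d (toQ F) ('X^((c k).1) * toQ (G (c k).2))) d.+1) //.
  by apply/row_matrixP => k; rewrite !rowK rmorphM /= map_polyXn.
have sQ k : (k < d.+1)%N -> (size (Q k) <= a + d.+1)%N.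
  move=> kd; rewrite (leq_trans (size_polyMleq _ _)) // size_polyXn.
  have [+ _ _] := GP _ (c2d k kd); have := c1d k kd.
  by rewrite /a /J; move: td dn; clear; lia.
have := det_join_family irrF sF frQ sQ.
set P := join_family _ _ => dP.
pose v (i : 'I_(a + d.+1)) : R := match fintype.split i with inl _ => h | inr k => z (c k).2 end.
have z1 i : (i <= d)%N -> 1 <= z i.
  by move=> id; rewrite (le_trans h1) // (le_trans hz) // zz.
have zt0 : 0 <= z t `^ (w + 1) * E^-1 by rewrite mulr_ge0 ?powR_ge0 // invr_ge0 ltW.
have c2t k : (k <= d)%N -> ((c k).2 <= t)%N.
  by move=> kd; rewrite (leq_trans (c2 k _)) ?Jt // leq_subLR Jt.
have bnd i : [/\ L1 (P i) <= K * v i, `|ev (P i)| <= K * v i * E^-1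
    & `|dev (P i)| <= K * v i * (z t `^ (w + 1) * E^-1)].
  rewrite /P /join_family /v; case: fintype.split => k.
    apply: XnM_bounds => //; rewrite ?sF //; first by have := ltn_ord k; rewrite /a; move: td dn; clear; lia.
    by rewrite (le_trans hz) // zz ?td.
  have kd : (k <= d)%N by rewrite -ltnS.
  have [g1 g2 g3] := GP _ (c2d k kd).
  apply: XnM_bounds => //; last 2 first.
  - exact: G0 (c2d k kd).
  - by rewrite zz // c2t // td.
  by rewrite (leq_trans (c1d k kd)) // /J; move: td dn; clear; lia.
apply: (det_constant _ _ dP (v := v)) => //.
- by rewrite N1 Nle.
- rewrite /P /join_family => i; case: fintype.split => k; last exact: sQ.
  rewrite (leq_trans (size_polyMleq _ _)) // size_polyXn sF.
  by have := ltn_ord k; clear; lia.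
- by rewrite invr_ge0 ltW.
- by move=> i; have [] := bnd i.
- by move=> i; have [] := bnd i.
- by move=> i; have [] := bnd i.
- move=> i; rewrite /v; case: fintype.split => k; first by rewrite (le_trans ler01).
  by rewrite (le_trans ler01) // z1 // c2d // -ltnS.
rewrite big_split_ord /=.
rewrite (eq_bigr (fun=> h)) => [|i _]; last by rewrite /v (unsplitK (inl i)).
rewrite prodr_const card_ord ler_wpM2l ?exprn_ge0 ?(le_trans ler01 h1) //.
(* The product selected at rank [k] has norm at most [z (k - J)]. By truncated subtraction [z 0]
   occurs for all [k <= J], which gives [J] extra factors besides [z 0, ..., z t]. *)
apply: (@le_trans _ _ (\prod_(k < d.+1) z (k - J)%N)).
  apply: ler_prod => k _; rewrite /v (unsplitK (inr k)).
  have kd : (k <= d)%N by rewrite -ltnS.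
  rewrite (le_trans ler01 (z1 _ (c2d k kd))) /= zz // c2 ?Jt //=.
  by rewrite (leq_trans (leq_subr _ _)).
rewrite -(big_mkord xpredT (fun k => z (k - J)%N)) (@big_cat_nat _ _ _ J) //=; last by rewrite /J; clear; lia.
rewrite [X in X * _]big_nat (eq_bigr (fun=> z 0%N)); last first.
  by move=> i /andP[_ iJ]; congr z; apply/eqP; rewrite subn_eq0 ltnW.
rewrite -big_nat prodr_const_nat subn0 ler_wpM2l ?exprn_ge0 ?(le_trans ler01 (z1 _ _)) //.
rewrite -{1}[J]add0n big_addn (_ : (d.+1 - J)%N = t.+1); last by rewrite /J; move: td; clear; lia.
by rewrite big_mkord le_eqVlt; apply/orP; left; apply/eqP; apply: eq_bigr => i _; rewrite addnK.
Qed.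

Lemma det_ineq_ex : exists2 C, 0 < C & forall d (F : {poly int}) (G : nat -> {poly int})
    (E h : R) (z : nat -> R) t,
  irreducible_poly F -> size F = d.+2 -> (d < n)%N -> 1 <= E ->
  L1 F <= h -> E * `|ev F| <= h -> h <= z 0%N ->
  (forall i j, (i <= j <= d)%N -> z i <= z j) ->
  (forall i, (i <= d)%N -> [/\ (size (G i) <= n.+1)%N, L1 (G i) <= z i & E * `|ev (G i)| <= z i]) ->
  row_free (seq_mx (fun i => res d (toQ F) (toQ (G i))) d.+1) -> (t <= d)%N ->
  1 <= C * (E^-1 * (z t `^ (w + 1) * E^-1) *
        (h ^+ (n - t) * (z 0%N ^+ (d - t) * \prod_(i < t.+1) z i))).
Proof. by exists C1; [exact: C1_gt0|exact: det_ineq]. Qed.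

Lemma det_constant_ex : exists2 C, 0 < C & forall N (Q : 'I_N -> {poly int}) (v e0 e1 : R),
  (1 < N <= n.*2)%N ->
  (forall i, size (Q i) <= N)%N -> \det (coef_mx N Q) != 0 -> 0 <= e0 -> 0 <= e1 -> 1 <= v ->
  (forall i, L1 (Q i) <= v) -> (forall i, `|ev (Q i)| <= v * e0) ->
  (forall i, `|dev (Q i)| <= v * e1) -> 1 <= C * (e0 * e1 * v ^+ n.*2).
Proof.
exists C1; [exact: C1_gt0|move=> N Q v e0 e1 Nn sQ dQ e00 e10 v1 b0 b1 b2].
have K1 := K_ge1; have v0 := le_trans ler01 v1.
have vK : v <= K * v by rewrite -[leLHS]mul1r ler_wpM2r.
apply: (det_constant Nn sQ dQ e00 e10 (v := fun=> v)) => //.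
- by move=> i; apply: le_trans (b0 i) vK.
- by move=> i; apply: le_trans (b1 i) _; rewrite ler_wpM2r.
- by move=> i; apply: le_trans (b2 i) _; rewrite ler_wpM2r.
by rewrite prodr_const card_ord ler_weXn2l //; case/andP: Nn.
Qed.
End Inequalities.

(** * Resultant estimates for pairs of polynomials *)

Section TwoPolys.
Variables (R : realType) (n : nat) (xi w C0 : R).
Hypotheses (n1 : (1 < n)%N) (w0 : 0 <= w) (C01 : 1 <= C0).
Local Notation ev := (polyval xi).
Local Notation dev := (derivval xi).
Local Notation L1 p := ((l1 p)%:~R : R).
Hypothesis hder : forall p : {poly int}, p != 0 -> (size p <= n.+1)%N ->
  `|dev p| <= C0 * `|ev p| * (L1 p `^ (w + 1)).

Lemma powR_ge1 (h a : R) : 1 <= h -> 0 <= a -> 1 <= h `^ a.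
Proof.
move=> h1 a0; have e1 : 1 `^ a = 1 :> R by rewrite powR1.
by rewrite -[leLHS]e1; apply: ge0_ler_powR; rewrite ?nnegrE // (le_trans ler01).
Qed.

Lemma det_sylv_int d (F G : {poly int}) m : irreducible_poly F -> size F = d.+2 ->
  ~~ (F %| G) -> (size G <= m.+1)%N ->
  \det (coef_mx (m + d.+1) (sylv (a := m) (b := d.+1) F G 'X)) != 0.
Proof.
move=> irrF sF nFG sG.
have irrQ : irreducible_poly (toQ F) by apply/irreducible_rat_int.
have sFQ : size (toQ F) = d.+2 by rewrite size_map_inj_poly //; apply: intr_inj.
have nQ : ~~ (toQ F %| toQ G) by rewrite dvdp_rat_int.
have := @det_join_family d F m (fun k => 'X^k * G) irrF sF; apply.
  have := res_powers_free irrQ sFQ (leqnn d.+1) nQ.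
  rewrite (_ : seq_mx _ _ = \matrix_(k < d.+1) res d (toQ F) ('X^k * toQ G)) //.
  by apply/row_matrixP => k; rewrite !rowK rmorphM /= map_polyXn.
move=> k kd; rewrite (leq_trans (size_polyMleq _ _)) // size_polyXn.
by move: kd sG; clear; lia.
Qed.

(** The resultant of [F] and [G], estimated by [sylv_bound] with [e0 = 1 / E] and
    [e1 = C0 h^(w+1) / E]. This is the sharper first determinant needed for [n = 3]. *)
Lemma sylv_ineq : exists2 C, 0 < C & forall d (F G : {poly int}) (E h : R),
  irreducible_poly F -> size F = d.+2 -> (d < n)%N -> ~~ (F %| G) -> (size G <= n.+1)%N ->
  1 <= E -> L1 F <= h -> E * `|ev F| <= h -> L1 G <= h -> E * `|ev G| <= h ->
  E ^+ 3 <= C * (h ^+ (n + d.+1) * ((h `^ (w + 1)) ^+ 2 + E)).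
Proof.
pose X0 : R := 1 + `|xi|.
have X01 : 1 <= X0 by rewrite lerDl.
have X00 := lt_le_trans ltr01 X01.
exists ((n.*2)`!%:R * (X0 ^+ (n * n.*2) * C0 ^+ 2)).
  by rewrite !mulr_gt0 ?exprn_gt0 ?ltr0n ?fact_gt0 // (lt_le_trans ltr01 C01).
move=> d F G E h irrF sF dn nFG sG E1 F1 F2 G1 G2.
have E0 := lt_le_trans ltr01 E1.
have F0 := irredp_neq0 irrF.
have G0 : G != 0 by apply: contraNneq nFG => ->; rewrite Pdiv.Idomain.dvdp0.
have h1 : 1 <= h := le_trans (L1_ge1 R F0) F1.
have h0 := le_trans ler01 h1.
have hw1 : 1 <= h `^ (w + 1) by rewrite powR_ge1 // addr_ge0.
pose p : {poly R} := map_poly intr F; pose q : {poly R} := map_poly intr G.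
have sp : (size p <= d.+2)%N by rewrite -sF size_poly.
have sq : (size q <= n.+1)%N by rewrite (leq_trans (size_poly _ _)).
have sp' : (size p <= n.+1)%N by rewrite (leq_trans sp).
have dR : 1 <= `|\det (coef_mx (n + d.+1) (sylv (a := n) (b := d.+1) p q 'X))|.
  have := intmx_det_ge1 R (det_sylv_int irrF sF nFG sG).
  congr (_ <= `|\det _|); apply/matrixP => i j; rewrite !mxE /sylv.
  by case: fintype.split => k; rewrite -coef_map rmorphM /= map_polyXn.
rewrite -(det_sylv_shift xi sp sq) in dR.
pose e0 := E^-1; pose e1 := C0 * h `^ (w + 1) * E^-1.
have e00 : 0 <= e0 by rewrite invr_ge0 ltW.
have C00 : 0 <= C0 := le_trans ler01 C01.
have e01 : e0 <= e1.
  by rewrite /e1 -[leLHS]mul1r ler_wpM2r // -[leLHS]mul1r ler_pM.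
have hX : h <= h * X0 ^+ n by rewrite ler_peMr // exprn_ege1.
have gen (P : {poly int}) : P != 0 -> (size P <= n.+1)%N -> L1 P <= h -> E * `|ev P| <= h ->
   [/\ forall i, `|(map_poly intr P \Po ('X + xi%:P))`_i| <= h * X0 ^+ n,
       `|(map_poly intr P \Po ('X + xi%:P))`_0| <= h * X0 ^+ n * e0
     & `|(map_poly intr P \Po ('X + xi%:P))`_1| <= h * X0 ^+ n * e1].
  move=> P0 sP lP eP.
  have evE : `|ev P| <= h * E^-1 by rewrite ler_pdivlMr // mulrC.
  split.
  - move=> i; apply: le_trans (l1_coef _ _) _.
    have sPR : (size (map_poly intr P : {poly R}) <= n.+1)%N by rewrite (leq_trans (size_poly _ _)).
    apply: le_trans (l1_shift xi sPR) _.
    by rewrite l1_map ler_wpM2r // exprn_ge0 // ltW.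
  - by rewrite coef0_shift (le_trans evE) // ler_wpM2r.
  - rewrite coef1_shift (le_trans (hder P0 sP)) //.
    apply: (@le_trans _ _ (h * e1)); last by rewrite ler_wpM2r // (le_trans e00).
    have -> : h * e1 = C0 * (h * E^-1) * h `^ (w + 1) by rewrite /e1; ring.
    rewrite ler_pM ?mulr_ge0 ?powR_ge0 // ?ler_wpM2l //.
    by apply: ge0_ler_powR; rewrite ?nnegrE ?addr_ge0 // (le_trans ler01) // L1_ge1.
have sF' : (size F <= n.+1)%N by rewrite sF.
have [p1 p2 p3] := gen F F0 sF' F1 F2.
have [q1 q2 q3] := gen G G0 sG G1 G2.
have N2 : (2 < n + d.+1)%N by rewrite addnS ltnS (leq_trans n1) // leq_addr.
have hX0 : 0 <= h * X0 ^+ n by rewrite mulr_ge0 // exprn_ge0 // ltW.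
have NN : (n + d.+1 <= n.*2)%N by rewrite -addnn leq_add2l.
have fin M : `|\det (coef_mx (n + d.+1) (sylv (a := n) (b := d.+1) (p \Po ('X + xi%:P)) (q \Po ('X + xi%:P)) 'X))|
    <= (n + d.+1)`!%:R * ((h * X0 ^+ n) ^+ (n + d.+1) * M) ->
    0 <= M -> E ^+ 3 * M <= C0 ^+ 2 * ((h `^ (w + 1)) ^+ 2 + E) ->
    E ^+ 3 <= (n.*2)`!%:R * (X0 ^+ (n * n.*2) * C0 ^+ 2) * (h ^+ (n + d.+1) * ((h `^ (w + 1)) ^+ 2 + E)).
  move=> /(le_trans dR) H M0 EM.
  have E3 : 0 < E ^+ 3 by rewrite exprn_gt0.
  have := ler_wpM2l (ltW E3) H; rewrite mulr1 => /le_trans; apply.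
  rewrite exprMn -exprM.
  have -> : E ^+ 3 * ((n + d.+1)`!%:R * (h ^+ (n + d.+1) * X0 ^+ (n * (n + d.+1)) * M)) =
    (n + d.+1)`!%:R * (X0 ^+ (n * (n + d.+1)) * (h ^+ (n + d.+1) * (E ^+ 3 * M))) by ring.
  have -> : (n.*2)`!%:R * (X0 ^+ (n * n.*2) * C0 ^+ 2) * (h ^+ (n + d.+1) * ((h `^ (w + 1)) ^+ 2 + E)) =
    (n.*2)`!%:R * (X0 ^+ (n * n.*2) * (h ^+ (n + d.+1) * (C0 ^+ 2 * ((h `^ (w + 1)) ^+ 2 + E)))) by ring.
  have t1 : 0 <= h ^+ (n + d.+1) * (E ^+ 3 * M) by rewrite !mulr_ge0 ?exprn_ge0 // ltW.
  apply: ler_pM => //; first by rewrite mulr_ge0 // exprn_ge0 // ltW.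
    by rewrite ler_nat leq_fact.
  apply: ler_pM => //; first by rewrite exprn_ge0 // ltW.
    by rewrite ler_weXn2l // leq_mul2l NN orbT.
  by rewrite ler_wpM2l // exprn_ge0.
have e10 : 0 <= e1 := le_trans e00 e01.
have E3e : E ^+ 3 * (e0 * e1 ^+ 2 + e0 ^+ 2) = C0 ^+ 2 * (h `^ (w + 1)) ^+ 2 + E.
  by rewrite /e0 /e1; field; rewrite lt0r_neq0.
have C02 : 1 <= C0 ^+ 2 by rewrite exprn_ege1.
apply: (fin (e0 * e1 ^+ 2 + e0 ^+ 2)).
- by apply: sylv_bound => //; rewrite e00 e01.
- by apply: addr_ge0; [apply: mulr_ge0 => //|]; exact: exprn_ge0.
- by rewrite E3e mulrDr lerD2l ler_peMl // ltW.
Qed.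

(** By [hder], [F'(xi)] is small along with [F(xi)], whereas the resultant of [F] and [F'] is a
    nonzero integer. Hence exponents of approximation by irreducible polynomials are bounded. *)
Lemma irreducible_ev_ge : exists2 c, 0 < c & forall F : {poly int},
  irreducible_poly F -> (size F <= n.+1)%N -> c <= `|ev F| * (L1 F `^ (w + n.*2%:R)).
Proof.
have [C1 C10 C1P] := det_constant_ex n xi C01.
pose X0 : R := 1 + `|xi|.
have X01 : 1 <= X0 by rewrite lerDl.
have X00 := lt_le_trans ltr01 X01.
have C00 : 0 < C0 := lt_le_trans ltr01 C01.
have n0 : 0 < n%:R :> R by rewrite ltr0n ltnW.
have n1' : 1 <= n%:R :> R by rewrite ler1n ltnW.
pose A := X0 ^+ n.*2.
have A1 : 1 <= A by rewrite exprn_ege1.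
have A0 := lt_le_trans ltr01 A1.
pose e1 := 3 * n%:R * X0 ^+ n.
have e10 : 0 < e1 by rewrite !mulr_gt0 ?exprn_gt0.
pose D := C1 * (C0 * e1 * (A * n%:R) ^+ n.*2).
have D0 : 0 < D by rewrite !mulr_gt0 ?exprn_gt0 ?mulr_gt0.
exists D^-1; first by rewrite invr_gt0.
move=> F irrF sF.
have F0 := irredp_neq0 irrF.
set h := L1 F; have h1 : 1 <= h by exact: L1_ge1.
have h0 := lt_le_trans ltr01 h1.
have [d sFd] : exists d, size F = d.+2.
  by have [+ _] := irrF; case: (size F) => [//|[//|d]] _; exists d.
have dn : (d < n)%N by rewrite sFd in sF.
have dF0 : F^`() != 0 by rewrite -size_poly_gt0 size_deriv sFd.
have sdF : size F^`() = d.+1 by rewrite size_deriv sFd.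
have nF : ~~ (F %| F^`()).
  apply/negP => /(Pdiv.Idomain.dvdp_leq dF0); rewrite sdF sFd ltnn //.
have dd : \det (coef_mx (d.+1 + d.+1) (sylv (a := d.+1) (b := d.+1) F F^`() 'X)) != 0.
  by apply: det_sylv_int => //; rewrite sdF.
pose V := A * (n%:R * h).
(* Relative to row bounds of order [h], both [F(xi)] and [F'(xi)] are at most [e0]; the column of
   derivatives is bounded trivially by [e1]. *)
pose e0 := C0 * `|ev F| * h `^ w.
have hw : 1 <= h `^ w by exact: powR_ge1.
have V1 : 1 <= V by rewrite -[leLHS]mulr1 ler_pM // -[leLHS]mulr1 ler_pM.
have hE : h `^ (w + 1) = h * h `^ w.
  by rewrite powRD ?powRr1 ?(ltW h0) 1?mulrC //; apply/implyP => _; rewrite lt0r_neq0.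
have lF' : L1 F^`() <= n%:R * h.
  have sF' : (size F <= d.+1.+1)%N by rewrite sFd.
  have := l1_deriv sF'; rewrite -(ler_int R) intrM rmorph_nat => /le_trans; apply.
  by rewrite ler_wpM2r ?(ltW h0) // ler_nat.
have hn : h <= n%:R * h by rewrite ler_peMl // ltW.
have evP (P : {poly int}) : (size P <= n.+1)%N -> `|ev P| <= L1 P * X0 ^+ n.
  move=> sP; rewrite -l1_map; apply: horner_l1 => //; first by rewrite (leq_trans (size_poly _ _)).
  by rewrite lerDr.
have devP (P : {poly int}) : (size P <= n.+1)%N -> `|dev P| <= n%:R * L1 P * X0 ^+ n.
  move=> sP; apply: (@le_trans _ _ (l1 (map_poly intr P : {poly R})^`() * X0 ^+ n)).
    apply: horner_l1 => //; last by rewrite lerDr.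
    by rewrite (leq_trans (size_poly _ _)) // (leq_trans (leq_pred _)) // (leq_trans (size_poly _ _)).
  rewrite ler_wpM2r ?exprn_ge0 ?(ltW X00) // -l1_map.
  by apply: l1_deriv; rewrite (leq_trans (size_poly _ _)).
have evdE : ev F^`() = dev F by rewrite /polyval /derivval deriv_map.
have row (P : {poly int}) j : (j <= n.*2)%N -> (size P <= n.+1)%N -> L1 P <= n%:R * h ->
    `|ev P| <= n%:R * h * e0 ->
    [/\ L1 ('X^j * P) <= V, `|ev ('X^j * P)| <= V * e0 & `|dev ('X^j * P)| <= V * e1].
  move=> jn sP lP eP; split.
  - by rewrite l1XnM (le_trans lP) // -[leLHS]mul1r ler_wpM2r // mulr_ge0 // ltW.
  - by rewrite (le_trans (ev_XnM xi P jn)) // -/X0 -/A /V -mulrA ler_wpM2l // ltW.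
  - rewrite (le_trans (dev_XnM xi P jn)) // -/X0 -/A /V -mulrA ler_wpM2l ?(ltW A0) //.
    have -> : n%:R * h * e1 = n.*2%:R * (n%:R * h * X0 ^+ n) + n%:R * (n%:R * h) * X0 ^+ n.
      by rewrite /e1 -muln2 natrM; ring.
    have Xn : 0 <= X0 ^+ n by rewrite exprn_ge0 // ltW.
    rewrite lerD // ?ler_wpM2l ?ler0n // ?(le_trans (evP _ sP)) ?(le_trans (devP _ sP)) ?ler_wpM2r //.
    by rewrite ler_wpM2l // ltW.
have e00 : 0 <= e0 by rewrite !mulr_ge0 ?powR_ge0 // ltW.
have bnd i : [/\ L1 (sylv (a := d.+1) (b := d.+1) F F^`() 'X i) <= V,
    `|ev (sylv (a := d.+1) (b := d.+1) F F^`() 'X i)| <= V * e0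
  & `|dev (sylv (a := d.+1) (b := d.+1) F F^`() 'X i)| <= V * e1].
  have kn (k : 'I_d.+1) : (k <= n.*2)%N.
    by rewrite -addnn (leq_trans (ltnW (ltn_ord k))) // (leq_trans dn) // leq_addr.
  rewrite /sylv; case: fintype.split => k; apply: row => //.
  - have -> : n%:R * h * e0 = `|ev F| * (n%:R * h * (C0 * h `^ w)) by rewrite /e0; ring.
    have nh1 : 1 <= n%:R * h := le_trans h1 hn.
    have Ch : 1 <= C0 * h `^ w by rewrite -[leLHS]mulr1 ler_pM.
    by rewrite ler_peMr // -[leLHS]mulr1 ler_pM.
  - by rewrite sdF (leq_trans dn).
  - rewrite evdE (le_trans (hder F0 sF)) // -/h hE.
    have -> : n%:R * h * e0 = n%:R * (C0 * `|ev F| * (h * h `^ w)) by rewrite /e0; ring.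
    by rewrite ler_peMl // !mulr_ge0 ?powR_ge0 // ltW.
have NN : (1 < d.+1 + d.+1 <= n.*2)%N by rewrite -addnn leq_add // addSn addnS.
have sz i : (size (sylv (a := d.+1) (b := d.+1) F F^`() 'X i) <= d.+1 + d.+1)%N.
  rewrite /sylv; case: fintype.split => k; rewrite (leq_trans (size_polyMleq _ _)) // size_polyXn.
    by rewrite sFd; have := ltn_ord k; clear; lia.
  by rewrite sdF; have := ltn_ord k; clear; lia.
have := C1P _ _ V e0 e1 NN sz dd e00 (ltW e10) V1.
have b0 i := let: And3 a _ _ := bnd i in a.
have b1 i := let: And3 _ a _ := bnd i in a.
have b2 i := let: And3 _ _ a := bnd i in a.
move=> /(_ b0 b1 b2) H.
rewrite -[D^-1]mul1r ler_pdivrMr // (le_trans H) //.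
rewrite powRD; last by apply/implyP => _; rewrite lt0r_neq0.
rewrite powR_mulrn ?(ltW h0) // /D /V /e0.
rewrite mulrA exprMn le_eqVlt; apply/orP; left; apply/eqP; rewrite !exprMn; ring.
Qed.
End TwoPolys.

(** * Reduced bases of integer polynomials *)

Definition pnorm (R : realType) (xi E : R) (p : {poly int}) : R :=
  Num.max (l1 p)%:~R (E * `|polyval xi p|).

Lemma sum_le_const (R : numDomainType) m (f : 'I_m -> R) c :
  (forall j, f j <= c) -> \sum_j f j <= m%:R * c.
Proof.
move=> H; rewrite mulr_natl; apply: le_trans (ler_sum _ (fun j _ => H j)) _.
by rewrite sumr_const card_ord.
Qed.

(** Reduction is applied to the vectors with coordinate 0 equal to [E P(xi)] and the coefficients of
    positive index as the others, a lattice of determinant [E]. The constant coefficient is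
    recovered from [P(xi)], so [pnorm] is at most a constant times the sup norm. *)
Lemma reduced_polys (R : realType) (xi : R) m : exists2 C : R, 0 < C & forall E, 1 <= E ->
  exists B : 'I_m.+1 -> {poly int}, [/\ forall i, (size (B i) <= m.+1)%N,
    \det (coef_mx m.+1 B) != 0 & \prod_i pnorm xi E (B i) <= C * E].
Proof.
have [C C0 CP] := lattice_reduction R m.+1.
pose X0 : R := 1 + `|xi|.
have X01 : 1 <= X0 by rewrite lerDl.
have X00 := lt_le_trans ltr01 X01.
pose M : R := 1 + m%:R + m%:R * X0 ^+ m.
have mX : 0 <= m%:R * X0 ^+ m by rewrite mulr_ge0 // exprn_ge0 // ltW.
have M0 : 0 < M by rewrite /M; have := ler0n R m; lra.
exists (M ^+ m.+1 * C) => [|E E1]; first by rewrite mulr_gt0 // exprn_gt0.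
have E0 := lt_le_trans ltr01 E1.
pose G : 'M[R]_m.+1 := \matrix_(j, c) if c == 0 then E * xi ^+ j else (j == c)%:R.
have dG : \det G = E.
  rewrite det_trig.
    rewrite big_ord_recl mxE eqxx expr0 mulr1 big1 ?mulr1 // => i _.
    by rewrite mxE eqxx.
  by apply/is_trig_mxP => i j ij; rewrite mxE -!val_eqE /= gtn_eqF ?(leq_ltn_trans _ ij) // ltn_eqF.
have [|U uU UP] := CP G; first by rewrite dG lt0r_neq0.
rewrite dG (gtr0_norm E0) in UP.
pose B i := rVpoly (row i U).
have BU i j : (B i)`_(nat_of_ord j) = U i j by rewrite coef_rVpoly_ord mxE.
have sB i : (size (B i) <= m.+1)%N by exact: size_poly.
exists B; split => //.
  have -> : coef_mx m.+1 B = U by apply/matrixP => i j; rewrite mxE BU.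
  by rewrite -normr_gt0; move: uU; rewrite /unimod => /eqP ->.
have evE i : (map_mx intr U *m G) i 0 = E * polyval xi (B i).
  rewrite mxE /polyval (@horner_coef_wide _ m.+1) ?(leq_trans (size_poly _ _)) // mulr_sumr.
  by apply: eq_bigr => j _; rewrite !mxE eqxx coef_map BU mulrCA.
have cfE i c : c != 0 -> (map_mx intr U *m G) i c = (U i c)%:~R.
  move=> c0; rewrite mxE (bigD1 c) //= !mxE (negbTE c0) eqxx mulr1 big1 ?addr0 // => j jc.
  by rewrite !mxE (negbTE c0) (negbTE jc) mulr0.
have key i : pnorm xi E (B i) <= M * rnorm (row i (map_mx intr U *m G)).
  set nu := rnorm _.
  have nu0 : 0 <= nu by exact: rnorm_ge0.
  have e1 : E * `|polyval xi (B i)| <= nu.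
    have := rnorm_coord (row i (map_mx intr U *m G)) 0.
    by rewrite mxE evE normrM (gtr0_norm E0).
  have c1 c : c != 0 -> `|(U i c)%:~R| <= nu.
    by move=> c0; have := rnorm_coord (row i (map_mx intr U *m G)) c; rewrite mxE cfE.
  have ev1 : `|polyval xi (B i)| <= nu by rewrite (le_trans _ e1) // ler_peMl.
  have c00 : `|(U i 0)%:~R| <= nu + m%:R * X0 ^+ m * nu.
    have -> : (U i 0)%:~R = polyval xi (B i) - \sum_(j < m) (U i (lift ord0 j))%:~R * xi ^+ (lift ord0 j).
      rewrite /polyval (@horner_coef_wide _ m.+1) ?(leq_trans (size_poly _ _)) // big_ord_recl /=.
      rewrite expr0 mulr1 coef_map (BU i 0) /= -addrA -sumrB big1 ?addr0 // => j _.
      by rewrite coef_map (BU i (lift ord0 j)) subrr.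
    rewrite (le_trans (ler_normB _ _)) // lerD // (le_trans (ler_norm_sum _ _ _)) //.
    rewrite -mulrA; apply: sum_le_const => j.
    rewrite normrM mulrC ler_pM // ?c1 // normrX.
    apply: (@le_trans _ _ (X0 ^+ (lift ord0 j))).
      by rewrite lerXn2r ?nnegrE // ?(ltW X00) // lerDr.
    by rewrite ler_weXn2l // lift0.
  rewrite /pnorm ge_max; apply/andP; split; last first.
    by rewrite (le_trans e1) // ler_peMl // /M; have := ler0n R m; lra.
  have -> : (l1 (B i))%:~R = \sum_(j < m.+1) `|(U i j)%:~R| :> R.
    by rewrite (l1E (sB i)) rmorph_sum /=; apply: eq_bigr => j _; rewrite BU intr_norm.
  rewrite big_ord_recl.
  have : \sum_(j < m) `|(U i (lift ord0 j))%:~R| <= m%:R * nu.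
    by apply: sum_le_const => j; exact: c1.
  have -> : M * nu = nu + m%:R * X0 ^+ m * nu + m%:R * nu by rewrite /M; ring.
  by move=> H; apply: lerD.
apply: (@le_trans _ _ (\prod_i (M * rnorm (row i (map_mx intr U *m G))))).
  apply: ler_prod => i _; rewrite key andbT /pnorm le_max.
  by rewrite ler0z l1_ge0.
rewrite big_split /= prodr_const card_ord -mulrA ler_wpM2l // exprn_ge0 // ltW //.
Qed.

Lemma res_basis_full d m (F : {poly rat}) (B : 'I_m.+1 -> {poly int}) :
  irreducible_poly F -> size F = d.+2 -> (d <= m)%N ->
  (forall i, (size (B i) <= m.+1)%N) -> \det (coef_mx m.+1 B) != 0 ->
  row_full (\matrix_(i < m.+1) res d F (toQ (B i))).
Proof.
move=> irrF sF dm sB dB.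
pose A := map_mx (intr : int -> rat) (coef_mx m.+1 B).
have uA : A \in unitmx by rewrite unitmxE unitfE det_map_mx intr_eq0.
pose S := \matrix_(j < m.+1) res d F 'X^j.
have -> : \matrix_(i < m.+1) res d F (toQ (B i)) = A *m S.
  apply/row_matrixP => i; rewrite rowK row_mul mulmx_sum_row.
  have {1}-> : toQ (B i) = \sum_(j < m.+1) ((B i)`_j)%:~R *: 'X^j.
    rewrite -(poly_def m.+1 (fun j => ((B i)`_j)%:~R)); apply/polyP => k; rewrite coef_map coef_poly.
    by case: ltnP => // km; rewrite nth_default // (leq_trans (sB i)).
  by rewrite res_sum; apply: eq_bigr => j _; rewrite resZ rowK !mxE.
have fA : row_full A by rewrite row_full_unit.
rewrite /row_full (eqmxMfull S fA) eqn_leq rank_leq_col -[leqLHS](mxrank1 rat d.+1).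
apply: mxrankS; apply/row_subP => i; rewrite -[row i _](res_rVpoly sF) rVpolyE res_sum.
apply: summx_sub => j _; rewrite resZ; apply: scalemx_sub.
have jm : (j < m.+1)%N by rewrite (leq_trans (ltn_ord j)).
by rewrite (_ : res d F 'X^j = row (Ordinal jm) S) ?row_sub // rowK.
Qed.

(** * Choice of the irreducible polynomial *)

Lemma zprimitive_eqp (p : {poly int}) : p != 0 -> p %= zprimitive p.
Proof.
move=> p0; rewrite {1}[p]zpolyEprim; apply: Pdiv.Idomain.eqp_scale.
by rewrite zcontents_eq0.
Qed.

Lemma irreducible_eqp (p q : {poly int}) : p %= q -> irreducible_poly p -> irreducible_poly q.
Proof.
move=> pq [sp irr]; split; first by rewrite -(Pdiv.Idomain.eqp_size pq).
move=> r sr rq; apply: (Pdiv.Idomain.eqp_trans _ pq); apply: irr => //.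
by rewrite (Pdiv.Idomain.eqp_dvdr _ pq).
Qed.

Lemma irreducible_size2 (p : {poly int}) : size p = 2%N -> irreducible_poly p.
Proof.
move=> sp; split; first by rewrite sp.
have p0 : p != 0 by rewrite -size_poly_gt0 sp.
move=> q sq qp; rewrite -Pdiv.Idomain.dvdp_size_eqp // sp eqn_leq.
have q0 : q != 0 by apply: contraTneq qp => ->; rewrite Pdiv.Idomain.dvd0p.
have := Pdiv.Idomain.dvdp_leq p0 qp; rewrite sp => -> /=.
by move: sq q0; rewrite -size_poly_gt0; case: (size q) => [|[]].
Qed.

Section Selection.
Variables (R : realType) (n : nat) (xi w C0 : R).
Hypotheses (n1 : (1 < n)%N) (hxi : transcendental xi) (w0 : 0 <= w) (C01 : 1 <= C0).
Local Notation ev := (polyval xi).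
Local Notation dev := (derivval xi).
Local Notation L1 p := ((l1 p)%:~R : R).
Hypothesis hder : forall p : {poly int}, p != 0 -> (size p <= n.+1)%N ->
  `|dev p| <= C0 * `|ev p| * (L1 p `^ (w + 1)).

Lemma evM p q : ev (p * q) = ev p * ev q.
Proof. by rewrite /polyval rmorphM hornerM. Qed.

Lemma evZ a p : ev (a *: p) = a%:~R * ev p.
Proof. by rewrite /polyval map_polyZ hornerZ. Qed.

Lemma ev_const (p : {poly int}) : p != 0 -> (size p <= 1)%N -> 1 <= `|ev p|.
Proof.
move=> p0 /size1_polyC pE; rewrite pE /polyval map_polyC hornerC /=.
rewrite -intr_norm -[1]/(1%:~R) ler_int -gtz0_ge1 normr_gt0.
by apply: contraNneq p0 => c0; rewrite pE c0.
Qed.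

Lemma ev_zprimitive p : p != 0 -> `|ev (zprimitive p)| <= `|ev p|.
Proof.
move=> p0; rewrite {2}[p]zpolyEprim evZ normrM ler_peMl //.
by rewrite -intr_norm -[1]/(1%:~R) ler_int -gtz0_ge1 normr_gt0 zcontents_eq0.
Qed.

Lemma l1_zprimitive p : p != 0 -> l1 (zprimitive p) <= l1 p.
Proof.
move=> p0; rewrite {2}[p]zpolyEprim l1Z ler_peMl ?l1_ge0 //.
by rewrite -gtz0_ge1 normr_gt0 zcontents_eq0.
Qed.

(** The condition [zprimitive F = F] turns pseudo-divisibility by [F] into a factorization over the
    integers. *)
Definition pirr (F : {poly int}) :=
  [/\ irreducible_poly F, zprimitive F = F & (size F <= n.+1)%N].

Lemma pirr_zprimitive F : irreducible_poly F -> (size F <= n.+1)%N -> pirr (zprimitive F).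
Proof.
move=> irrF sF; have F0 := irredp_neq0 irrF; split.
- exact: irreducible_eqp (zprimitive_eqp F0) irrF.
- exact: zprimitive_id.
- by rewrite size_zprimitive.
Qed.

(** Arbitrarily small [c] replaces the requirement of infinitely many [F]; failure at [e] is then
    directly a uniform lower bound for [|F(xi)| l1(F)^e]. *)
Definition exponents : set R := [set e | 0 <= e /\
  forall c, 0 < c -> exists2 F, pirr F & `|ev F| <= c * L1 F `^ (- e)]%classic.

Lemma powR_gt0_of_ge1 (h e : R) : 1 <= h -> 0 < h `^ e.
Proof. by move=> h1; rewrite powR_gt0 // (lt_le_trans ltr01). Qed.

(** A reduced basis in degree at most 1 contains a polynomial of value at most [c']. Since
    [c' <= 1/2] it is not constant, hence it is linear and irreducible. *)
Lemma exponents0 : exponents 0.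
Proof.
split=> // c c0; have [C C0' CP] := reduced_polys xi 1.
pose c' := Num.min c (1 / 2); have c'0 : 0 < c' by rewrite lt_min c0; lra.
(* This makes [(c' E)^2 > C E], so the two norms cannot both exceed [c' E]. *)
pose E := 1 + C / c' ^+ 2.
have CE : 0 < C / c' ^+ 2 by rewrite divr_gt0 // exprn_gt0.
have E1 : 1 <= E by rewrite lerDl ltW.
have E0 := lt_le_trans ltr01 E1.
have [B [sB dB BP]] := CP E E1.
have [i Bi] : exists i, pnorm xi E (B i) <= c' * E.
  apply/existsP; apply: contraT; rewrite negb_exists => /forallP H.
  have {}H i : c' * E < pnorm xi E (B i) by rewrite ltNge.
  suff : C * E < C * E by rewrite ltxx.
  apply: lt_le_trans BP; rewrite !big_ord_recl big_ord0 mulr1.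
  apply: (@lt_le_trans _ _ (c' * E * (c' * E))); last first.
    by rewrite ler_pM ?mulr_ge0 ?(ltW c'0) ?(ltW E0) ?(ltW (H _)).
  have -> : c' * E * (c' * E) = c' ^+ 2 * E * E by ring.
  rewrite ltr_pM2r // /E mulrDr mulr1 mulrCA mulfV ?mulr1 ?ltrDr ?exprn_gt0 //.
  by rewrite lt0r_neq0 // exprn_gt0.
have B0 : B i != 0.
  apply: contraNneq dB => Bi0; rewrite (expand_det_row _ i) big1 // => j _.
  by rewrite mxE Bi0 coef0 mul0r.
have evB : `|ev (B i)| <= c'.
  have : E * `|ev (B i)| <= c' * E by apply: le_trans Bi; rewrite /pnorm le_max lexx orbT.
  by rewrite mulrC ler_pM2r.
have s2 : size (B i) = 2%N.
  apply/eqP; rewrite eqn_leq sB /= ltnNge; apply/negP => s1.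
  have := le_trans (ev_const B0 s1) evB; rewrite /c' le_min => /andP[_]; lra.
exists (zprimitive (B i)).
  apply: pirr_zprimitive; first exact: irreducible_size2.
  by rewrite s2 ltnS ltnW.
rewrite oppr0 powRr0 mulr1 (le_trans (ev_zprimitive B0)) // (le_trans evB) //.
by rewrite /c' ge_min lexx.
Qed.

Lemma exponents_ub (c1 : R) : 0 < c1 ->
  (forall F : {poly int}, irreducible_poly F -> (size F <= n.+1)%N ->
     c1 <= `|ev F| * (L1 F `^ (w + n.*2%:R))) ->
  ubound exponents (w + n.*2%:R).
Proof.
move=> c10 c1P e [e0 eP]; rewrite leNgt; apply/negP => ltBe.
have [|F [irrF _ sF] evF] := eP (c1 / 2); first by rewrite divr_gt0.
have h1 := L1_ge1 R (irredp_neq0 irrF); set h := L1 F in h1 evF.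
have := c1P F irrF sF; rewrite -/h; apply/negP; rewrite -ltNge.
have hB := @powR_gt0_of_ge1 h (w + n.*2%:R) h1.
apply: (@le_lt_trans _ _ (c1 / 2 * (h `^ (- e) * h `^ (w + n.*2%:R)))).
  by rewrite mulrA ler_wpM2r // ltW.
rewrite -powRD; last by apply/implyP => _; rewrite lt0r_neq0 // (lt_le_trans ltr01).
apply: (@le_lt_trans _ _ (c1 / 2 * 1)); last by lra.
rewrite ler_wpM2l //; first by lra.
by rewrite -[leRHS](powRr0 h) ler_powR //; lra.
Qed.

(** Induction on the size: when [G] factors, Gelfond's inequality bounds [|G(xi)| l1(G)^e] below by
    a constant times the product of the same quantities for the two factors. *)
Lemma ev_lower_bound (e c2 : R) : 0 <= e -> 0 < c2 ->
  (forall F, pirr F -> c2 <= `|ev F| * L1 F `^ e) ->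
  forall m, (m <= n.+1)%N -> exists2 c, 0 < c & forall G : {poly int}, G != 0 -> (size G <= m)%N ->
    c <= `|ev G| * L1 G `^ e.
Proof.
move=> e0 c20 c2P; pose Kn : R := n.+1.*2%:R ^+ n.+1.
have Kn0 : 0 < Kn by rewrite exprn_gt0.
elim=> [|m IH] mn; first by exists 1 => // G G0; rewrite leqn0 size_poly_eq0 (negbTE G0).
have [c c0 cP] := IH (ltnW mn).
pose c' := Num.min (Num.min 1 c2) (c ^+ 2 / Kn `^ e).
have KE : 0 < Kn `^ e by exact: powR_gt0.
exists c' => [|G G0 sG]; first by rewrite !lt_min ltr01 c20 divr_gt0 // exprn_gt0.
have [s1|s2] := leqP (size G) 1.
  apply: (@le_trans _ _ (1 * 1)); first by rewrite mulr1 /c' !ge_min lexx.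
  by rewrite ler_pM // ?ev_const // powR_ge1 // L1_ge1.
have Gz0 : zprimitive G != 0 by rewrite zprimitive_eq0.
have [irr|nirr] := pselect (irreducible_poly G).
  have sGn : (size G <= n.+1)%N := leq_trans sG mn.
  apply: (@le_trans _ _ c2); first by rewrite /c' !ge_min lexx orbT.
  apply: le_trans (c2P _ (pirr_zprimitive irr sGn)) _.
  apply: ler_pM => //; first exact: powR_ge0.
    exact: ev_zprimitive.
  apply: ge0_ler_powR; rewrite ?nnegrE ?ler0z ?l1_ge0 //.
  by rewrite ler_int l1_zprimitive.
have [q [sq qG nqG]] : exists q : {poly int}, [/\ size q != 1%N, q %| G & ~~ (q %= G)].
  apply: contrapT => H; apply: nirr; split=> // q sq qG.
  by apply: contrapT => nqG; apply: H; exists q; split=> //; apply/negP.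
have [r Gr] := dvdpP_int qG.
have q0 : q != 0 by apply: contraNneq G0 => q0; rewrite Gr q0 zprimitive0 mul0r.
have r0 : r != 0 by apply: contraNneq G0 => r0; rewrite Gr r0 mulr0.
set q' := zprimitive q in Gr; have q'0 : q' != 0 by rewrite zprimitive_eq0.
have sq' : size q' = size q by exact: size_zprimitive.
have sG' : size G = (size q + size r).-1 by rewrite Gr size_mul // sq'.
have q2 : (1 < size q)%N by move: sq q0; rewrite -size_poly_gt0; case: (size q) => [|[]].
have r2 : (1 < size r)%N.
  rewrite ltnNge; apply/negP => r1; move/negP: nqG; apply.
  rewrite -Pdiv.Idomain.dvdp_size_eqp // sG'.
  have -> : size r = 1%N by apply/eqP; rewrite eqn_leq r1 size_poly_gt0.
  by rewrite addn1.
have sqm : (size q' <= m)%N by rewrite sq'; move: sG sG' q2 r2; clear; lia.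
have srm : (size r <= m)%N by move: sG sG' q2 r2; clear; lia.
have H1 := cP q' q'0 sqm; have H2 := cP r r0 srm.
apply: (@le_trans _ _ (c ^+ 2 / Kn `^ e)); first by rewrite /c' ge_min lexx orbT.
rewrite ler_pdivrMr //.
have l1q := L1_ge1 R q'0; have l1r := L1_ge1 R r0; have l1G := L1_ge1 R G0.
apply: (@le_trans _ _ (`|ev G| * (L1 q' * L1 r) `^ e)).
  rewrite Gr evM normrM powRM ?(le_trans ler01) //.
  have -> : `|ev q'| * `|ev r| * (L1 q' `^ e * L1 r `^ e) =
    (`|ev q'| * L1 q' `^ e) * (`|ev r| * L1 r `^ e) by ring.
  by rewrite expr2 ler_pM // ltW.
rewrite -mulrA -powRM ?(le_trans ler01 l1G) ?(ltW Kn0) // ler_wpM2l //.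
apply: ge0_ler_powR; rewrite ?nnegrE ?mulr_ge0 ?ler0z ?l1_ge0 ?(ltW Kn0) //.
have sqr : (size (q' * r)%R <= n.+1)%N by rewrite -Gr (leq_trans sG).
have := l1_int_mul_le sqr; rewrite -(ler_int R) -Gr !intrM rmorphXn /= rmorph_nat.
by rewrite [L1 G * _]mulrC.
Qed.
End Selection.

Section Selection2.
Variables (R : realType) (n : nat) (xi w C0 : R).
Hypotheses (n1 : (1 < n)%N) (hxi : transcendental xi) (w0 : 0 <= w) (C01 : 1 <= C0).
Local Notation ev := (polyval xi).
Local Notation dev := (derivval xi).
Local Notation L1 p := ((l1 p)%:~R : R).
Hypothesis hder : forall p : {poly int}, p != 0 -> (size p <= n.+1)%N ->
  `|dev p| <= C0 * `|ev p| * (L1 p `^ (w + 1)).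

Lemma powR_large (a : R) (M : R) : 0 < a -> exists2 H, 1 <= H & forall h, H <= h -> M <= h `^ a.
Proof.
move=> a0; pose M1 := Num.max 1 M; have M11 : 1 <= M1 by rewrite le_max lexx.
have M10 := lt_le_trans ltr01 M11.
exists (M1 `^ a^-1); first by rewrite powR_ge1 // invr_ge0 ltW.
move=> h Hh; apply: (@le_trans _ _ M1); first by rewrite le_max lexx orbT.
have -> : M1 = (M1 `^ a^-1) `^ a.
  by rewrite -powRrM mulVf ?powRr1 ?(ltW M10) // lt0r_neq0.
apply: ge0_ler_powR; rewrite ?nnegrE ?(ltW a0) ?powR_ge0 //.
by rewrite (le_trans _ Hh) // powR_ge0.
Qed.

(* [F] is an irreducible polynomial whose exponent of approximation is nearly *)
(* extremal; [E] is increased, by factors 2, until a polynomial prime to [F]  *)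
(* has norm comparable with that of [F].                                      *)
Lemma select_poly (delta H0 : R) : 0 < delta < 1 -> exists (d : nat) (F : {poly int}) (E : R) (Gs : {poly int}),
  [/\ [/\ irreducible_poly F, size F = d.+2, (d < n)%N & H0 <= L1 F],
      1 <= E, E * `|ev F| <= L1 F,
      [/\ ~~ (F %| Gs), (size Gs <= n.+1)%N, L1 Gs <= L1 F & E * `|ev Gs| <= L1 F]
    & forall G : {poly int}, G != 0 -> (size G <= n.+1)%N -> L1 F `^ (1 - delta) <= pnorm xi E G].
Proof.
move=> /andP[d0 d1].
have [c1 c10 c1P] := irreducible_ev_ge n1 w0 C01 hder.
have ubE := exponents_ub c10 c1P.
have supE : has_sup (exponents n xi).
  by split; [exists 0; exact: exponents0|exists (w + n.*2%:R)].
(* With this [eps], the exponents [e1] and [e2] around [om] differ by less than [delta / 2]. *)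
pose om := sup (exponents n xi); pose eps := delta / 4.
have eps0 : 0 < eps by rewrite divr_gt0.
have [e1 [e10 e1P] e1om] := sup_adherent eps0 supE.
have om0 : 0 <= om by apply: (ub_le_sup supE.2); exact: exponents0.
pose e2 := om + eps; have e20 : 0 <= e2 by rewrite addr_ge0 // ltW.
have [c2 c20 c2P] : exists2 c2, 0 < c2 & forall F, pirr n F -> c2 <= `|ev F| * L1 F `^ e2.
  have ne2 : ~ exponents n xi e2.
    by move=> /(ub_le_sup supE.2); rewrite -/om /e2; lra.
  apply: contrapT => H; apply: ne2; split=> // c c0.
  apply: contrapT => H'; apply: H; exists c => // F pF.
  have h1 : 1 <= L1 F by case: pF => irrF _ _; exact: L1_ge1 (irredp_neq0 irrF).
  rewrite leNgt; apply/negP => lt; apply: H'; exists F => //.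
  by rewrite powRN -ler_pdivrMr ?invr_gt0 ?powR_gt0_of_ge1 // invrK ltW.
have [c3 c30 c3P] := ev_lower_bound e20 c20 c2P (leqnn n.+1).
pose Kn : R := n.+1.*2%:R ^+ n.+1.
have [Ha Ha1 HaP] := powR_large (Num.max 2 Kn) d0.
have [|Hb Hb1 HbP] := @powR_large (delta / 2) (3 / c3); first by rewrite divr_gt0.
pose H := Num.max H0 (Num.max Ha Hb).
have H1 : 1 <= H by rewrite !le_max Ha1 orbT.
pose B := w + n.*2%:R; have B0 : 0 < B.
  by rewrite ltr_wpDl // ltr0n double_gt0 ltnW.
have HB : 0 < H `^ B by exact: powR_gt0_of_ge1.
(* This forces [h >= H]: a polynomial of norm below [H] takes a value larger than [c1 / H^B] at
   [xi]. *)
pose c := Num.min 1 (c1 / H `^ B).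
have c0 : 0 < c by rewrite lt_min ltr01 divr_gt0.
have [F [irrF zF sF] evF] := e1P c c0.
have F0 := irredp_neq0 irrF.
set h := L1 F in evF *; have h1 : 1 <= h by exact: L1_ge1.
have h0 := lt_le_trans ltr01 h1.
have hH : H <= h.
  rewrite leNgt; apply/negP => hH.
  have := c1P F irrF sF; rewrite -/h -/B; apply/negP; rewrite -ltNge.
  apply: (@lt_le_trans _ _ (c * H `^ B)); last first.
    by rewrite -ler_pdivlMr // ge_min lexx orbT.
  apply: (@le_lt_trans _ _ (c * h `^ B)).
    rewrite ler_wpM2r ?powR_ge0 // (le_trans evF) // -[leRHS]mulr1 ler_wpM2l ?(ltW c0) //.
    by rewrite -[leRHS](powRr0 h) ler_powR // oppr_le0.
  by rewrite ltr_pM2l // gt0_ltr_powR ?nnegrE // ltW // (lt_le_trans ltr01).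
have evF1 : `|ev F| <= h `^ (- e1).
  rewrite (le_trans evF) // -[leRHS]mul1r ler_wpM2r ?powR_ge0 // ge_min lexx //.
have evF0 : 0 < `|ev F| by rewrite normr_gt0 polyval_neq0.
(* For [k = 0] the constant 1 is a polynomial prime to [F]; [k] is bounded because [F(xi)] is
   nonzero. *)
pose P (k : nat) := `[< 2 ^+ k * `|ev F| <= h /\ exists G : {poly int},
  [/\ ~~ (F %| G), (size G <= n.+1)%N, L1 G <= h & 2 ^+ k * `|ev G| <= h] >].
have sF2 : (1 < size F)%N by case: irrF.
have exP : exists k, P k.
  exists 0%N; apply/asboolP; rewrite expr0 mul1r; split.
    rewrite (le_trans evF1) // (le_trans _ h1) // -[leRHS](powRr0 h) ler_powR // oppr_le0 //.
  exists 1; split; rewrite ?size_poly1 //.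
  - apply/negP => /(Pdiv.Idomain.dvdp_leq (oner_neq0 _)); rewrite size_poly1.
    by rewrite leqNgt sF2.
  - by rewrite -polyC1 l1C normr1.
  - by rewrite ?mul1r /polyval rmorph1 hornerC normr1.
have [M ubP] : exists M, forall k, P k -> (k <= M)%N.
  exists (Num.trunc (h / `|ev F|)) => k /asboolP[kF _].
  have kle : k%:R <= h / `|ev F|.
    rewrite ler_pdivlMr // (le_trans _ kF) // ler_wpM2r // -natrX ler_nat.
    exact: ltnW (ltn_expl _ _).
  by rewrite truncn_ge_nat // divr_ge0 // ltW.
case: (ex_maxnP exP ubP) => k /asboolP[kF [Gs [G1 G2 G3 G4]]] kmax.
pose E : R := 2 ^+ k.
have E1 : 1 <= E by rewrite exprn_ege1 // ler1n.
have E0 := lt_le_trans ltr01 E1.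
have [d sFd] : exists d, size F = d.+2.
  by move: sF2; case: (size F) => [//|[//|d]] _; exists d.
exists d, F, E, Gs; split => //.
  split=> //; first by rewrite sFd in sF.
  by rewrite (le_trans _ hH) // le_max lexx.
move=> G G0 sG; rewrite -/h.
have hd : Num.max 2 Kn <= h `^ delta by apply: HaP; rewrite (le_trans _ hH) // !le_max lexx orbT.
have hd0 : 0 < h `^ delta by exact: powR_gt0_of_ge1.
have hE : h `^ (1 - delta) = h / h `^ delta.
  by rewrite powRB ?powRr1 ?(ltW h0) //; apply/implyP => _; rewrite lt0r_neq0.
have l1G := L1_ge1 R G0.
(* For a multiple of [F], Gelfond's inequality already gives a norm of at least [h / Kn]. *)
have [FG|nFG] := boolP (F %| G).
  have [r Gr] := dvdpP_int FG; rewrite zF in Gr.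
  have r0 : r != 0 by apply: contraNneq G0 => r0; rewrite Gr r0 mulr0.
  have sFr : (size (F * r)%R <= n.+1)%N by rewrite -Gr.
  have := l1_int_mul_le sFr; rewrite -(ler_int R) -Gr !intrM rmorphXn /= rmorph_nat -/Kn -/h => HH.
  rewrite /pnorm le_max; apply/orP; left; rewrite hE ler_pdivrMr //.
  apply: (@le_trans _ _ (h * L1 r)); first by rewrite ler_peMr ?(ltW h0) // L1_ge1.
  rewrite (le_trans HH) // mulrC ler_wpM2l ?(le_trans ler01) //.
  by rewrite (le_trans _ hd) // le_max lexx orbT.
(* If [F] keeps norm at most [h] at [2 E], the maximality of [k] denies this to every [G] prime to
   [F], whose norm at [E] is thus at least [h / 2]. *)
have [hF2|hF2] := lerP (2 ^+ k.+1 * `|ev F|) h.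
  have : ~ P k.+1 by move=> /kmax; rewrite ltnn.
  move=> nP; have {}nP : ~ (L1 G <= h /\ 2 ^+ k.+1 * `|ev G| <= h).
    by move=> [g1 g2]; apply: nP; apply/asboolP; split=> //; exists G.
  rewrite hE ler_pdivrMr //; apply: (@le_trans _ _ (pnorm xi E G * 2)); last first.
    have p0 : 0 <= pnorm xi E G by rewrite /pnorm le_max (le_trans ler01 l1G).
    by rewrite ler_wpM2l // (le_trans _ hd) // le_max lexx.
  rewrite leNgt; apply/negP => lt; apply: nP.
  have : L1 G <= pnorm xi E G by rewrite le_max lexx.
  have : E * `|ev G| <= pnorm xi E G by rewrite le_max lexx orbT.
  rewrite exprS -/E -mulrA; split; last by lra.
  by lra.
(* Otherwise [2 E > h / |F(xi)| >= h^(1+e1)], while the lower bound with exponent [e2] gives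
   [c3 E <= y^(1+e2)]; as [e1] and [e2] are close, [y < h^(1-delta)] is impossible for large [h]. *)
set y := pnorm xi E G.
have yL : L1 G <= y by rewrite le_max lexx.
have yE : E * `|ev G| <= y by rewrite le_max lexx orbT.
have y1 := le_trans l1G yL; have y0 := lt_le_trans ltr01 y1.
rewrite leNgt; apply/negP => ylt.
have Elow : h `^ (1 + e1) <= 2 * E.
  rewrite powRD; last by apply/implyP => _; rewrite lt0r_neq0.
  rewrite powRr1 ?(ltW h0) // -[e1]opprK powRN -ler_pdivlMr ?invr_gt0 ?powR_gt0_of_ge1 // invrK.
  apply: (le_trans (ltW hF2)); rewrite exprS -/E.
  by rewrite ler_wpM2l // mulr_ge0 // ltW.
have y2 : c3 * E <= y `^ (1 + e2).
  rewrite powRD; last by apply/implyP => _; rewrite lt0r_neq0.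
  rewrite powRr1 ?(ltW y0) //.
  apply: (@le_trans _ _ (E * `|ev G| * L1 G `^ e2)).
    by rewrite mulrC -mulrA ler_wpM2l ?(ltW E0) // c3P.
  apply: ler_pM => //; rewrite ?mulr_ge0 ?powR_ge0 ?(ltW E0) //.
  apply: ge0_ler_powR; rewrite ?nnegrE ?(ltW y0) // (le_trans ler01) //.
have y3 : y `^ (1 + e2) <= h `^ (1 + e1 - delta / 2).
  apply: (@le_trans _ _ ((h `^ (1 - delta)) `^ (1 + e2))).
    apply: ge0_ler_powR; rewrite ?nnegrE ?(ltW y0) ?powR_ge0 ?(ltW ylt) // addr_ge0 //.
  rewrite -powRrM ler_powR //.
  have : 0 <= delta * e2 by rewrite mulr_ge0 // ltW.
  have : om - eps < e1 by [].
  rewrite /e2 /eps; nra.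
have hb : 3 / c3 <= h `^ (delta / 2) by apply: HbP; rewrite (le_trans _ hH) // !le_max lexx !orbT.
have E4 : h `^ (1 + e1) = h `^ (1 + e1 - delta / 2) * h `^ (delta / 2).
  rewrite -powRD; first by congr (_ `^ _); lra.
  by apply/implyP => _; rewrite lt0r_neq0.
have P1 : 0 < h `^ (1 + e1 - delta / 2) by exact: powR_gt0_of_ge1.
have := le_trans y2 y3 => y4.
have : h `^ (1 + e1 - delta / 2) * (3 / c3) <= 2 * E.
  by apply: le_trans Elow; rewrite E4 ler_wpM2l // ltW.
rewrite mulrA ler_pdivrMr // => y5.
have E5 : 2 * E * c3 = 2 * (c3 * E) by ring.
by rewrite E5 in y5; lra.
Qed.
End Selection2.

(** * The contradiction *)

Lemma ln_prod (R : realType) (I : Type) (r : seq I) (f : I -> R) :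
  (forall i, 0 < f i) -> ln (\prod_(i <- r) f i) = \sum_(i <- r) ln (f i).
Proof.
move=> f0; elim: r => [|i r IH]; first by rewrite !big_nil ln1.
by rewrite !big_cons lnM ?posrE ?prodr_gt0 // IH.
Qed.

Lemma ler_lnW (R : realType) (x y : R) : 0 < x -> x <= y -> ln x <= ln y.
Proof. by move=> x0 xy; rewrite ler_ln ?posrE // (lt_le_trans x0). Qed.

Section Contradiction.
Variables (R : realType) (n : nat) (xi w C0 : R).
Hypotheses (n1 : (1 < n)%N) (hxi : transcendental xi) (C01 : 1 <= C0).
Hypotheses (wn : 76 / 100 * n%:R <= w) (nw : w * (2 - ln 2) <= n%:R).
Local Notation ev := (polyval xi).
Local Notation dev := (derivval xi).
Local Notation L1 p := ((l1 p)%:~R : R).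
Hypothesis hder : forall p : {poly int}, p != 0 -> (size p <= n.+1)%N ->
  `|dev p| <= C0 * `|ev p| * (L1 p `^ (w + 1)).

Lemma approximation_contradiction : False.
Proof.
have w0 : 0 <= w by apply: le_trans wn; rewrite mulr_ge0.
have [C1 C10 C1P] := det_ineq_ex w0 C01 hder.
have [C2 C20 C2P] := sylv_ineq n1 w0 C01 hder.
have [C3 C30 C3P] := reduced_polys xi n.
pose eta : R := 1 / 100 / 100.
have eta0 : 0 < eta by rewrite /eta; lra.
(* Each of the [n + 1] basis polynomials may lose [delta] in the volume bound, hence [eta / 2] in
   all. *)
pose delta := eta / (2 * n.+1%:R).
have np : 1 <= n.+1%:R :> R by rewrite ler1n.
have del0 : 0 < delta by rewrite divr_gt0 // mulr_gt0 // ltr0n.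
have delE : n.+1%:R * delta = eta / 2 by rewrite /delta; field; rewrite lt0r_neq0 // ltr0n.
have del1 : delta < 1.
  rewrite /delta ltr_pdivrMr; last by rewrite mulr_gt0 // ltr0n.
  by rewrite /eta; lra.
(* Once [log h >= T], the logarithms of the constants are negligible against [eta * log h]. *)
pose T := 1 + (`|ln C1| + `|ln (2 * C2)| + 2 * `|ln C3|) / eta.
have [|d [F [E [Gs [[irrF sF dn hT] E1 EF [nFG sGs G3 G4] Nlow]]]]] :=
  select_poly n1 hxi w0 C01 hder (expR T) (_ : 0 < delta < 1); first by rewrite del0.
set h := L1 F in hT EF G3 G4 Nlow.
have h0 : 0 < h by apply: lt_le_trans hT; exact: expR_gt0.
pose l := ln h.
have lT : T <= l by rewrite /l -ler_expR lnK ?posrE.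
have c_le a : `|a| <= `|ln C1| + `|ln (2 * C2)| + 2 * `|ln C3| -> a <= eta * l.
  move=> aT; apply: (@le_trans _ _ (eta * (T - 1))); last first.
    by rewrite ler_pM2l //; lra.
  rewrite /T addrC addKr mulrCA mulfV ?lt0r_neq0 // mulr1.
  exact: le_trans (ler_norm _) aT.
have n_1 := normr_ge0 (ln C1); have n_2 := normr_ge0 (ln (2 * C2)); have n_3 := normr_ge0 (ln C3).
have b1 : ln C1 <= eta * l by apply: c_le; lra.
have b2 : ln (2 * C2) <= eta * l by apply: c_le; lra.
have b3 : 2 * ln C3 <= eta * l.
  by apply: c_le; rewrite normrM ger0_norm //; lra.
have lge1 : 1 <= l.
  apply: le_trans lT; rewrite lerDl divr_ge0 ?(ltW eta0) //; lra.
have l0 : 0 < l by lra.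
have h1 : 1 <= h by rewrite -ler_ln ?posrE // ln1 ltW.
have E0 := lt_le_trans ltr01 E1.
have [B [sB dB BP]] := C3P E E1.
have irrQ : irreducible_poly (toQ F) by apply/irreducible_rat_int.
have sFQ : size (toQ F) = d.+2 by rewrite size_map_inj_poly //; apply: intr_inj.
have v0 : res d (toQ F) (toQ Gs) != 0 by rewrite (res_eq0 irrQ sFQ) dvdp_rat_int.
have fullB := res_basis_full irrQ sFQ (ltnW dn) sB dB.
have [s [us ss frs]] := complete_basis v0 (leqnn d) fullB.
have B0 j : B j != 0.
  apply: contraNneq dB => Bi0; rewrite (expand_det_row _ j) big1 // => k _.
  by rewrite mxE Bi0 coef0 mul0r.
pose pn j := pnorm xi E (B j).
have pn0 j : 0 < pn j.
  by rewrite /pn /pnorm lt_max (lt_le_trans ltr01) // L1_ge1.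
have pnl j : (1 - delta) * l <= ln (pn j).
  by rewrite /l -ln_powR ler_ln ?posrE ?powR_gt0 // Nlow.
pose leT i j := pn i <= pn j.
pose s' := sort leT s.
have ps : perm_eq s' s by rewrite perm_sort.
have ss' : size s' = d by rewrite size_sort.
have srt : sorted leT s' by apply: sort_sorted => i j; exact: le_total.
pose G i := if i is i'.+1 then nth 0 (map B s') i' else Gs.
(* Norms are raised to at least [h] so that [z i >= 1] holds exactly; by [Nlow] this costs at most
   [delta] each. *)
pose zz i := if i is i'.+1 then Num.max h (nth 0 (map pn s') i') else h.
have zh i : h <= zz i by case: i => [|i] /=; rewrite ?lexx // le_max lexx.
have zz0 i : 0 < zz i := lt_le_trans h0 (zh i).
have zmono i j : (i <= j <= d)%N -> zz i <= zz j.
  case: i => [|i]; first by move=> _; exact: zh.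
  case: j => [|j] //= /andP[ij jd].
  have js : (j < size s')%N by rewrite ss'.
  have is_ : (i < size s')%N by rewrite (leq_ltn_trans _ js).
  rewrite ge_max le_max lexx /= le_max; apply/orP; right.
  rewrite !(nth_map ord0) //.
  have leT_tr : transitive leT by move=> a b c; exact: le_trans.
  by apply: (sorted_leq_nth leT_tr (fun a => lexx (pn a)) ord0 srt).
have GP i : (i <= d)%N -> [/\ (size (G i) <= n.+1)%N, L1 (G i) <= zz i & E * `|ev (G i)| <= zz i].
  case: i => [|i] //= id.
  have is_ : (i < size s')%N by rewrite ss'.
  rewrite !(nth_map ord0) //; split => //.
  - by rewrite le_max /pn /pnorm le_max lexx orbT.
  - by rewrite le_max /pn /pnorm le_max lexx !orbT.
have frG : row_free (seq_mx (fun i => res d (toQ F) (toQ (G i))) d.+1).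
  set f' := fun i => res _ _ _; set f := fun k => _ in frs.
  have : (seq_mx f d.+1 <= seq_mx f' d.+1)%MS.
    apply/row_subP => k; rewrite rowK /f; case: k => [[|k] kd] /=.
      by rewrite (_ : res _ _ _ = row ord0 (seq_mx f' d.+1)) ?row_sub // rowK.
    have ks : (k < size s)%N by rewrite ss.
    rewrite (nth_map ord0) //; set j := nth ord0 s k.
    have js : j \in s' by rewrite (perm_mem ps) mem_nth.
    have jd : (index j s' < d)%N by rewrite -ss' index_mem.
    rewrite (_ : res _ _ _ = row (lift ord0 (Ordinal jd)) (seq_mx f' d.+1)) ?row_sub // rowK.
    by rewrite /f' /G /= (nth_map ord0) ?ss' // nth_index.
  move/mxrankS; move: frs; rewrite /row_free => /eqP -> rk.
  by rewrite eqn_leq rank_leq_row.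
pose z i := ln (zz i) / l; pose tau := ln E / l.
have lzz i : l <= ln (zz i) by rewrite /l ler_ln ?posrE.
have z1 i : 1 <= z i by rewrite /z ler_pdivlMr // mul1r.
have sum_z t : (\sum_(i < t) z i) * l = \sum_(i < t) ln (zz i).
  by rewrite mulr_suml; apply: eq_bigr => i _; rewrite /z divfK // lt0r_neq0.
have tauE : tau * l = ln E by rewrite /tau divfK // lt0r_neq0.
have zE i : z i * l = ln (zz i) by rewrite /z divfK // lt0r_neq0.
have dn' : d.+1%:R = d%:R + 1 :> R by rewrite -addn1 natrD.
(* The [n + 1 - d] basis polynomials outside [s] contribute almost 1 each, which pays for the
   [n - d] factors [h] and for [Gs]. *)
have vol : n%:R + 1 - d.+1%:R + \sum_(i < d.+1) z i <= tau + eta.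
  rewrite -(ler_pM2r l0) mulrDl sum_z big_ord_recl /= [leRHS]mulrDl tauE.
  have sumS : \sum_(i < d) ln (zz (lift ord0 i)) = \sum_(j in s) ln (Num.max h (pn j)).
    rewrite -big_uniq //= -(perm_big _ ps) (big_nth ord0) ss' big_mkord.
    by apply: eq_bigr => i _; rewrite /= add0n (nth_map ord0) ?ss'.
  rewrite sumS -/l.
  have tot : \sum_j ln (pn j) <= ln C3 + ln E.
    rewrite -ln_prod // -lnM ?posrE // ler_ln ?posrE ?prodr_gt0 ?mulr_gt0 //.
  have : \sum_(j in s) ln (Num.max h (pn j)) + (n.+1%:R - d%:R) * l <= \sum_j (ln (pn j) + delta * l).
    rewrite [leRHS](bigID (mem s)) /= lerD //.
      apply: ler_sum => j _; have := pnl j => pj.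
      have [le|lt] := leP h (pn j); first by rewrite lerDl mulr_ge0 // ltW.
      by rewrite -/l; lra.
    have -> : (n.+1%:R - d%:R) * l = \sum_(j | j \notin s) l.
      rewrite sumr_const -[RHS]mulr_natl; congr (_ * _).
      have := cardC (mem s); rewrite card_ord => /esym cE.
      have -> : #|[pred j | j \notin s]| = #|[predC mem s]| by apply: eq_card.
      have cs : #|mem s| = d by rewrite -ss; apply/card_uniqP.
      have -> : n.+1%:R = d%:R + #|[predC mem s]|%:R :> R by rewrite cs in cE; rewrite -natrD -cE.
      by rewrite addrAC subrr add0r.
    apply: ler_sum => j _; have := pnl j; lra.
  have dl : delta * l *+ n.+1 = eta / 2 * l by rewrite -[LHS]mulr_natl mulrA delE.
  rewrite big_split /= sumr_const card_ord dl dn'.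
  have nS : n.+1%:R = n%:R + 1 :> R by rewrite -addn1 natrD.
  rewrite nS; move: tot b3; set S1 := \sum_(j in s) _; set S2 := \sum_j _.
  by clear; move=> t1 t2 t3; lra.
have tau_ge : n%:R + 1 - eta <= tau.
  suff : d.+1%:R <= \sum_(i < d.+1) z i by lra.
  rewrite -[leLHS]mulr1 mulr_natl -{1}[d.+1]card_ord -sumr_const.
  by apply: ler_sum => i _.
apply: (@final_system_inconsistent R n d.+1 w tau z) => //.
- by rewrite /z /= divff // lt0r_neq0.
- move=> t td.
  have := C1P d F G E h zz t irrF sF dn E1 (lexx _) EF (lexx _) zmono GP frG td.
  set P := \prod_(i < t.+1) zz i.
  have P0 : 0 < P by rewrite prodr_gt0.
  have zt0 : 0 < zz t `^ (w + 1) by rewrite powR_gt0.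
  have Ei : 0 < E^-1 by rewrite invr_gt0.
  have q1 : 0 < zz t `^ (w + 1) * E^-1 by exact: mulr_gt0.
  have q2 : 0 < E^-1 * (zz t `^ (w + 1) * E^-1) by exact: mulr_gt0.
  have q3 : 0 < zz 0%N ^+ (d - t) by exact: exprn_gt0.
  have q4 : 0 < zz 0%N ^+ (d - t) * P by exact: mulr_gt0.
  have q5 : 0 < h ^+ (n - t) by exact: exprn_gt0.
  have q6 : 0 < h ^+ (n - t) * (zz 0%N ^+ (d - t) * P) by exact: mulr_gt0.
  have q7 : 0 < E^-1 * (zz t `^ (w + 1) * E^-1) * (h ^+ (n - t) * (zz 0%N ^+ (d - t) * P)).
    exact: mulr_gt0.
  have r1 : ln (zz t `^ (w + 1) * E^-1) = (w + 1) * ln (zz t) - ln E.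
    by rewrite lnM ?posrE // lnV ?posrE // ln_powR.
  have r2 : ln (E^-1 * (zz t `^ (w + 1) * E^-1)) = - ln E + ((w + 1) * ln (zz t) - ln E).
    by rewrite lnM ?posrE // lnV ?posrE // r1.
  have r3 : ln (zz 0%N ^+ (d - t) * P) = l *+ (d - t) + ln P.
    by rewrite lnM ?posrE // lnXn.
  have r4 : ln (h ^+ (n - t) * (zz 0%N ^+ (d - t) * P)) = l *+ (n - t) + (l *+ (d - t) + ln P).
    by rewrite lnM ?posrE // r3 lnXn.
  move/ln_ge0; rewrite lnM ?posrE // lnM ?posrE // r2 r4.
  rewrite /P ln_prod // -sum_z -zE -tauE -/l.
  have nt : l *+ (n - t) = (n%:R - t%:R) * l.
    by rewrite -natrB ?mulr_natl //; apply: ltnW; exact: leq_trans td dn.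
  have dt : l *+ (d - t) = (d%:R - t%:R) * l by rewrite -natrB ?mulr_natl.
  rewrite nt dt.
  have tS : t.+1%:R = t%:R + 1 :> R by rewrite -addn1 natrD.
  move=> H; rewrite -(ler_pM2r l0) tS dn'.
  by move: H b1; set S := \sum_(i < t.+1) z i; rewrite -/eta; clear; lra.
- have := C2P d F Gs E h irrF sF dn nFG sGs E1 (lexx _) EF G3 G4.
  set hw := h `^ (w + 1); have hw0 : 0 < hw by rewrite powR_gt0.
  have lhw : ln (hw ^+ 2) = 2 * (w + 1) * l by rewrite lnXn // ln_powR -/l mulr2n; ring.
  have lN : ln (h ^+ (n + d.+1)) = (n%:R + d.+1%:R) * l by rewrite lnXn // -[LHS]mulr_natl natrD.
  have lE3 : ln (E ^+ 3) = 3 * (tau * l) by rewrite tauE lnXn // -[LHS]mulr_natl.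
  (* Either term of [hw^2 + E] may dominate. If [E] does, then [2 tau <= n + deg F + eta], against
     [tau_ge]. *)
  have [EH|EH] := lerP E (hw ^+ 2) => H.
    have : E ^+ 3 <= 2 * C2 * (h ^+ (n + d.+1) * hw ^+ 2).
      apply: le_trans H _.
      have -> : 2 * C2 * (h ^+ (n + d.+1) * hw ^+ 2) = C2 * (h ^+ (n + d.+1) * (hw ^+ 2 + hw ^+ 2)) by ring.
      by rewrite ler_pM2l // ler_pM2l ?exprn_gt0 // lerD2l.
    move/(ler_lnW (exprn_gt0 3 E0)); rewrite lE3 lnM ?posrE ?mulr_gt0 ?exprn_gt0 // lnM ?posrE ?exprn_gt0 // lhw lN => HH.
    rewrite -(ler_pM2r l0) -/eta; move: HH b2; clear; lra.
  exfalso.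
  have : E ^+ 3 <= 2 * C2 * (h ^+ (n + d.+1) * E).
    apply: le_trans H _.
    have -> : 2 * C2 * (h ^+ (n + d.+1) * E) = C2 * (h ^+ (n + d.+1) * (E + E)) by ring.
    by rewrite ler_pM2l // ler_pM2l ?exprn_gt0 // lerD2r ltW.
  move/(ler_lnW (exprn_gt0 3 E0)); rewrite lE3 lnM ?posrE ?mulr_gt0 ?exprn_gt0 // lnM ?posrE ?exprn_gt0 // lN -tauE => HH.
  have : 2 * tau <= n%:R + d.+1%:R + eta.
    by rewrite -(ler_pM2r l0); move: HH b2; clear; lra.
  have : d.+1%:R <= n%:R :> R by rewrite ler_nat.
  by move: tau_ge; rewrite /eta; lra.
Qed.
End Contradiction.

Theorem theorem1p1 (R : realType) (n : nat) (hn : (2 <= n)%N) (xi : R)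
    (hxi : transcendental xi) :
  (((1 / (2 - ln 2)) * n%:R)%:E <= omega_star n xi)%E.
Proof.
rewrite leNgt; apply/negP => lt_om.
have [L1 L2] := (ln2_ge R, ln2_le R).
have n0 : 0 < n%:R :> R by rewrite ltr0n ltnW.
set a := 1 / (2 - ln 2) * n%:R in lt_om.
have aE : a * (2 - ln 2) = n%:R by rewrite /a; field; rewrite lt0r_neq0 //; lra.
have a76 : 76 / 100 * n%:R < a.
  rewrite /a ltr_pM2r // ltr_pdivlMr; last by lra.
  by lra.
(* [w] lies above [omega_star] and below [a], and also above [0.76 n] as the numerical estimates
   require; [omega_star] may be [-oo]. *)
have [w wn [wa omw]] : exists2 w, 76 / 100 * n%:R <= w & w < a /\ (omega_star n xi < w%:E)%E.
  move: lt_om; case: (omega_star n xi) => [r||] //.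
    rewrite lte_fin => ra; pose m := Num.max (76 / 100 * n%:R) r.
    have ma : m < a by rewrite gt_max a76.
    have m1 : 76 / 100 * n%:R <= m by rewrite le_max lexx.
    have m2 : r <= m by rewrite le_max lexx orbT.
    exists ((m + a) / 2); first by lra.
    by rewrite lte_fin; split; lra.
  by move=> _; exists (76 / 100 * n%:R) => //; split; rewrite ?ltNyr.
have w0 : 0 < w by apply: lt_le_trans wn; rewrite mulr_gt0 //; lra.
have fin : finite_set (good_approx n xi w).
  apply: contrapT => inf; move: omw; apply/negP; rewrite -leNgt.
  by apply: ereal_sup_ubound; exists w.
have [C C1 CP] := deriv_bound hxi w0 fin.
apply: (approximation_contradiction hn hxi C1 wn _ CP).
by rewrite -aE ler_wpM2r ?(ltW wa) //; lra.
Qed.
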